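(* Let $d$ be an integer with $5\le d\leq 10000$. Let $f=x^2y^2g(x,y)$ be a degree $d$ polynomial with support in the triangle $\Delta_d$ with vertices $(2,2),(d-2,2),(2,d-2)$, where $g\in\mathbb{R}[x,y]$ is a complete polynomial of degree $d-4$. Let $\tau$ be the convex polyhedral subdivision of $\Delta_d$ into the triangles $\Delta^1_{(i,2)}$, $\Delta^2_{(k,l)}$, $\Delta^3_{(k,l)}$ (described in the context), induced by a convex function $\lambda:\Delta_d\to\mathbb{R}_{\ge0}$, and let $f_t$ be the patchworking polynomial of $f$ induced by $\lambda$. Then there exists $\varepsilon>0$ such that $$|TSPP(f_t)^{*}|\geq (d-4)(2d-9)\qquad\text{for } 0<|t|<\varepsilon.$$
   Context: The triangulation. For integers $i,k,l\ge 2$: $\Delta^1_{(i,2)}$ is the triangle with vertices $(i,2),(i+1,2),(i,3)$; $\Delta^2_{(k,l)}$ is the triangle with vertices $(k+1,l),(k,l+1),(k,l+2)$; $\Delta^3_{(k,l)}$ is the triangle with vertices $(k+1,l),(k,l+2),(k+1,l+1)$. The subdivision $\tau$ of $\Delta_d$ consists of the $d-4$ triangles $\Delta^1_{(i,2)}$, $2\le i\le d-3$, together with the triangles $\Delta^2_{(k,l)}$ and $\Delta^3_{(k,l)}$ for integers $k\ge2$ and $2\le l\le d-k-2$. It is convex, i.e. there is a convex piecewise linear function $\lambda:\Delta_d\to\mathbb{R}_{\ge0}$ taking integer values on the vertices of $\tau$, linear (affine) on each triangle of $\tau$ and not linear on the union of any two distinct triangles of $\tau$; such a $\lambda$ is said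 to induce $\tau$. A polynomial $g$ of degree $m$ in two variables is complete if all monomials of degree $\le m$ appear in it with nonzero coefficient. The support of $f=\sum a_{i,j}x^iy^j$ is $\{(i,j):a_{i,j}\neq0\}$. The patchworking polynomial of $f$ induced by $\lambda$ is $f_t(x,y)=\sum_{(i,j)}a_{i,j}t^{\lambda(i,j)}x^iy^j\in\mathbb{R}[t][x,y]$; for a fixed real $t$ it is regarded as a polynomial in $x,y$. Special parabolic points. $\mathbb{R}^*=\mathbb{R}\setminus\{0\}$; $\pi:\mathbb{R}^3\to\mathbb{R}^2$ is the projection to the $xy$-plane. For $h\in\mathbb{R}[x,y]$, $\Gamma_h=\{(x,y,z)\in\mathbb{R}^3: z=h(x,y)\}$ is its graph and $V(h)$ its zero set in $\mathbb{R}^2$. Put $F(x,y,z)=h(x,y)-z$. A line $l(u)=p+(u-u_0)w$, $w\neq0$, with $p=l(u_0)\in\Gamma_h$, has contact order $k$ with $\Gamma_h$ at $p$ if $(F\circ l)^{(m)}(u_0)=0$ for $m=0,\dots,k-1$ and $(F\circ l)^{(k)}(u_0)\ne0$ (contact order $\infty$ if all derivatives vanish). A line with contact order $\ge3$ at $p$ is an asymptotic direction at $p$. The point $p$ is a special parabolic point if there is exactly one asymptotic direction at $p$ and its contact order is $\ge4$. Put $H_h=h_{xx}h_{yy}-h_{xy}^2$ (the Hessian), $E_{1,h}=-h_{xx}(H_h)_y+h_{xy}(H_h)_x$ and $E_{2,h}=-h_{xy}(H_h)_y+h_{yy}(H_h)_x$. A special parabolic point $p=(q,h(q))$ is transversal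 if the curve $V(H_h)$ is non-singular at $q$ ($\nabla H_h(q)\neq0$) and $V(E_{1,h})$, $V(E_{2,h})$ intersect transversally at $q$ (both pass through $q$, are non-singular there, with distinct tangent lines, i.e. $\nabla E_{1,h}(q),\nabla E_{2,h}(q)$ are linearly independent). $TSPP(h)$ is the set of transversal special parabolic points of $\Gamma_h$ and $TSPP(h)^*=TSPP(h)\cap\pi^{-1}((\mathbb{R}^* )^2)$. *)

(* Defs.v *)
From HB Require Import structures.
From mathcomp Require Import all_boot all_order all_algebra.
(* mpoly has to be imported before the MathComp-Analysis files: their notations
   clash in the other order. *)
From mathcomp Require Import mpoly.
From mathcomp Require Import classical_sets functions cardinality reals convex.

Set Implicit Arguments.
Unset Strict Implicit.
Unset Printing Implicit Defensive.

Import Order.TTheory GRing.Theory Num.Theory.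

Local Open Scope classical_set_scope.
Local Open Scope ring_scope.

(* A polynomial in x, y is an element of {mpoly R[2]}; x is variable ord0 and
   y is variable ord_max.  Points of R^2 and R^3 are row vectors. *)

Section Triangulation.
Variable R : realType.

Definition lattice_point (v : nat * nat) : 'rV[R]_2 :=
  \row_(i < 2) (if i == ord0 then v.1 else v.2)%:R.

Definition exponent_pair (m : 'X_{1..2}) : nat * nat := (m ord0, m ord_max).

Definition triangle := 3.-tuple (nat * nat).

Definition hull (T : triangle) : set 'rV[R]_2 :=
  [set q : 'rV[R]_2 | exists s : 'I_3 -> R,
     [/\ forall i, 0 <= s i, \sum_i s i = 1
       & q = \sum_i s i *: lattice_point (tnth T i)]].

Definition Delta (d : nat) : set 'rV[R]_2 :=
  hull [tuple (2, 2); (d - 2, 2); (2, d - 2)]%N.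

Definition Delta1 (i : nat) : triangle :=
  [tuple (i, 2); (i + 1, 2); (i, 3)]%N.

Definition Delta2 (k l : nat) : triangle :=
  [tuple (k + 1, l); (k, l + 1); (k, l + 2)]%N.

Definition Delta3 (k l : nat) : triangle :=
  [tuple (k + 1, l); (k, l + 2); (k + 1, l + 1)]%N.

(* The truncated subtractions agree with the integer ones here: for k > d - 2
   the range 2 <= l <= d - k - 2 is empty under both readings. *)
Inductive tau (d : nat) : triangle -> Prop :=
| Tau1 i : (2 <= i <= d - 3)%N -> tau d (Delta1 i)
| Tau2 k l : (2 <= k)%N -> (2 <= l <= d - k - 2)%N -> tau d (Delta2 k l)
| Tau3 k l : (2 <= k)%N -> (2 <= l <= d - k - 2)%N -> tau d (Delta3 k l).

Definition affine_on (A : set 'rV[R]_2) (lambda : 'rV[R]_2 -> R) : Prop :=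
  exists (a : 'I_2 -> R) (b : R),
    forall q, A q -> lambda q = \sum_i a i * q 0 i + b.

(* A function on Delta d is given by a total function, constrained on Delta d
   only. *)
Record induces_tau (d : nat) (lambda : 'rV[R]_2 -> R) : Prop := InducesTau {
  lambda_ge0 : forall q, Delta d q -> 0 <= lambda q;
  lambda_convex : @convex_function R 'rV[R]_2 (Delta d) lambda;
  lambda_int : forall T v, tau d T -> v \in T ->
    lambda (lattice_point v) \is a Num.int;
  lambda_affine : forall T, tau d T -> affine_on (hull T) lambda;
  lambda_break : forall T1 T2, tau d T1 -> tau d T2 -> hull T1 <> hull T2 ->
    ~ affine_on (hull T1 `|` hull T2) lambda }.

Definition complete (m : nat) (g : {mpoly R[2]}) : Prop :=
  msize g = m.+1 /\ forall e : 'X_{1..2}, (mdeg e <= m)%N -> g@_e != 0.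

(* Num.truncn turns the value of lambda into an exponent; it changes nothing
   when that value is a nonnegative integer. *)
Definition patchwork (lambda : 'rV[R]_2 -> R) (f : {mpoly R[2]}) (t : R)
    : {mpoly R[2]} :=
  \sum_(m <- msupp f)
    (f@_m * t ^+ Num.truncn (lambda (lattice_point (exponent_pair m))))
      *: 'X_[m].

End Triangulation.

Section SpecialParabolicPoints.
Variable R : realType.
Implicit Types (h g : {mpoly R[2]}) (q : 'rV[R]_2) (p w : 'rV[R]_3).

Definition eval2 h q : R := h.@[fun i => q 0 i].

Definition proj p : 'rV[R]_2 := \row_(i < 2) p 0 (widen_ord (leqnSn 2) i).

Definition graph h : set 'rV[R]_3 :=
  [set p : 'rV[R]_3 | p 0 ord_max = eval2 h (proj p)].

(* F(x, y, z) = h(x, y) - z *)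
Definition graph_eq h : {mpoly R[3]} := mwiden h - 'X_ord_max.

Definition param_line p (u0 : R) w (u : R) : 'rV[R]_3 := p + (u - u0) *: w.

(* The polynomial (F o l)(u) for l = param_line p u0 w: since it is polynomial
   in u, its derivatives are the formal ones. *)
Definition along_line h p (u0 : R) w : {poly R} :=
  mmap (@polyC R)
    (fun i : 'I_3 => (p 0 i)%:P + ('X - u0%:P) * (w 0 i)%:P) (graph_eq h).

(* Contact order k, where None stands for the contact order infinity. *)
Definition contact_order h p (u0 : R) w (k : option nat) : Prop :=
  if k is Some k then
    (forall m, (m < k)%N -> (along_line h p u0 w)^`(m).[u0] = 0) /\
    (along_line h p u0 w)^`(k).[u0] != 0
  else forall m, (along_line h p u0 w)^`(m).[u0] = 0.

Definition contact_ge (n : nat) h p (L : set 'rV[R]_3) : Prop :=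
  exists (u0 : R) w (k : option nat),
    [/\ w != 0, L = range (param_line p u0 w), contact_order h p u0 w k
      & if k is Some k then (n <= k)%N else True].

Definition asymptotic_direction h p (L : set 'rV[R]_3) : Prop :=
  contact_ge 3 h p L.

Definition special_parabolic h p : Prop :=
  graph h p /\
  exists L, unique (asymptotic_direction h p) L /\ contact_ge 4 h p L.

Definition dx h : {mpoly R[2]} := h^`M(ord0).
Definition dy h : {mpoly R[2]} := h^`M(ord_max).

Definition hess h : {mpoly R[2]} :=
  dx (dx h) * dy (dy h) - dx (dy h) ^+ 2.

Definition E1 h : {mpoly R[2]} :=
  - dx (dx h) * dy (hess h) + dx (dy h) * dx (hess h).

Definition E2 h : {mpoly R[2]} :=
  - dx (dy h) * dy (hess h) + dy (dy h) * dx (hess h).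

Definition grad g q : 'rV[R]_2 := \row_(i < 2) eval2 g^`M(i) q.

Definition transversal_at g1 g2 q : Prop :=
  [/\ eval2 g1 q = 0, eval2 g2 q = 0
    & row_free (col_mx (grad g1 q) (grad g2 q))].

Definition TSPP h : set 'rV[R]_3 :=
  [set p : 'rV[R]_3 | [/\ special_parabolic h p, grad (hess h) (proj p) != 0
    & transversal_at (E1 h) (E2 h) (proj p)]].

Definition TSPP_star h : set 'rV[R]_3 :=
  TSPP h `&` proj @^-1` [set q : 'rV[R]_2 | forall i, q 0 i != 0].

End SpecialParabolicPoints.

(* Main.v *)
Require Import Defs.
From HB Require Import structures.
From mathcomp Require Import all_boot all_order all_algebra.
From mathcomp Require Import mpoly.
From mathcomp Require Import ring lra zify polyrcf.
From mathcomp Require Import interval_inference.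
From mathcomp Require Import classical_sets functions cardinality reals convex.
From mathcomp Require Import boolp.

(* Where grad H <> 0, the equations E1 = E2 = 0 force H = 0 and make the kernel of
   the second fundamental form tangent to H = 0, which is the condition for a special
   parabolic point; transversality then says that (E1, E2) has a nondegenerate zero.
   Such zeros survive small perturbations.

   For a triangle of tau on which lambda is p x + r y + c, the substitution
   (x, y) -> (t^-p x, t^-r y) turns f_t, up to t^c, into a polynomial in t, x, y whose
   value at t = 0 is the trinomial of f carried by the triangle. Hence every
   nondegenerate zero (with nonzero coordinates) of a trinomial gives one point for f_t,
   and different triangles give different points because their slopes (p, r) differ.

   For a unimodular trinomial the monomials X1, X2, X3 are homogeneous coordinates on
   the torus, H = 0 is the conic h_xx h_yy = h_xy^2 in them, parametrized by the kernel
   direction (s : 1), and on this conic E1 is, up to a nonzero constant, a quintic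
   P(s): nondegenerate zeros are simple real roots of P. For the triangles of types
   1, 2, 3 explicit arcs on which the coefficients of P have a single sign change give
   respectively 1, 1 and 3 of them, and
   (d - 4) + (1 + 3) (d - 4) (d - 5) / 2 = (d - 4) (2 d - 9). *)

Set Implicit Arguments.
Unset Strict Implicit.
Unset Printing Implicit Defensive.

Import Order.TTheory GRing.Theory Num.Theory.

Local Open Scope classical_set_scope.
Local Open Scope ring_scope.

(** * Transversal special parabolic points in terms of the 4-jet *)

(* [J i j] stands for the value of the derivative of order [(i, j)]. *)
Section JetFormulas.
Variable R : comRingType.
Implicit Type J : nat -> nat -> R.

(** All conditions are stated on the values of derivatives at one point, because they are
    homogeneous under scaling of x, y and h: the actual polynomial, the trinomial moved to (1, 1),
    and the rescaled family (whose scalings are negative or positive powers of t) are then compared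
    through the single predicate [tspp_jet]. The quintic P depends only on the exponents of the
    triangle, not on the coefficients of f, so its real roots can be counted once for all k, l. Each
    root gives a point of the torus for any nonzero real coefficients: since the triangles have area
    1/2, ratios of monomials are inverted rationally, with no root extraction and hence no sign or
    parity condition. The delicate point is that a simple root of P is a nondegenerate zero of (E1,
    E2) in the plane. The Jacobian contains the factor D Q - 3 u^2, where Q is the fourth derivative
    along the kernel, D = h_xx, and u is the x-derivative of the second derivative along the kernel;
    this factor equals N P'(s), where N and u are nonzero because the three exponents are not
    collinear. *)

Definition jhess J := J 2 0 * J 0 2 - J 1 1 ^+ 2.
Definition jhess_x J := J 3 0 * J 0 2 + J 2 0 * J 1 2 - 2 * J 1 1 * J 2 1.
Definition jhess_y J := J 2 1 * J 0 2 + J 2 0 * J 0 3 - 2 * J 1 1 * J 1 2.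
Definition jhess_xx J := J 4 0 * J 0 2 + 2 * J 3 0 * J 1 2 + J 2 0 * J 2 2
  - 2 * J 2 1 ^+ 2 - 2 * J 1 1 * J 3 1.
Definition jhess_xy J := J 3 1 * J 0 2 + J 3 0 * J 0 3 + J 2 1 * J 1 2
  + J 2 0 * J 1 3 - 2 * J 1 2 * J 2 1 - 2 * J 1 1 * J 2 2.
Definition jhess_yy J := J 2 2 * J 0 2 + 2 * J 2 1 * J 0 3 + J 2 0 * J 0 4
  - 2 * J 1 2 ^+ 2 - 2 * J 1 1 * J 1 3.

Definition jE1 J := - J 2 0 * jhess_y J + J 1 1 * jhess_x J.
Definition jE2 J := - J 1 1 * jhess_y J + J 0 2 * jhess_x J.
Definition jE1_x J := - J 3 0 * jhess_y J - J 2 0 * jhess_xy J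
  + J 2 1 * jhess_x J + J 1 1 * jhess_xx J.
Definition jE1_y J := - J 2 1 * jhess_y J - J 2 0 * jhess_yy J
  + J 1 2 * jhess_x J + J 1 1 * jhess_xy J.
Definition jE2_x J := - J 2 1 * jhess_y J - J 1 1 * jhess_xy J
  + J 1 2 * jhess_x J + J 0 2 * jhess_xx J.
Definition jE2_y J := - J 1 2 * jhess_y J - J 1 1 * jhess_yy J
  + J 0 3 * jhess_x J + J 0 2 * jhess_xy J.
Definition jdet J := jE1_x J * jE2_y J - jE1_y J * jE2_x J.

Definition tspp_jet J : Prop :=
  [/\ jE1 J = 0, jE2 J = 0, (jhess_x J != 0) || (jhess_y J != 0)
    & jdet J != 0].

End JetFormulas.

Section Jets.
Variable R : realType.
Implicit Types (g h : {mpoly R[2]}) (q : 'rV[R]_2) (p w : 'rV[R]_3).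

Definition jet h q (i j : nat) : R := eval2 (iter i (@dx R) (iter j (@dy R) h)) q.

Lemma dy_iter_dx i j h :
  dy (iter i (@dx R) (iter j (@dy R) h)) = iter i (@dx R) (iter j.+1 (@dy R) h).
Proof. by elim: i => //= i <-; rewrite /dx /dy mderiv_comm. Qed.

Let dxE g : g^`M(ord0) = dx g. Proof. by []. Qed.
Let dyE g : g^`M(ord_max) = dy g. Proof. by []. Qed.
Let dyxx h : dy (dx h) = dx (dy h). Proof. exact: (dy_iter_dx 1 0). Qed.

Lemma dx_hess h : dx (hess h) = dx (dx (dx h)) * dy (dy h)
   + dx (dx h) * dx (dy (dy h)) - 2 * dx (dy h) * dx (dx (dy h)).
Proof.
rewrite {1}/dx mderivB expr2 !mderivM !dxE; ring.
Qed.

Lemma dy_hess h : dy (hess h) = dx (dx (dy h)) * dy (dy h)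
   + dx (dx h) * dy (dy (dy h)) - 2 * dx (dy h) * dx (dy (dy h)).
Proof.
rewrite {1}/dy mderivB expr2 !mderivM !dyE !dyxx; ring.
Qed.

Lemma eval2D g h q : eval2 (g + h) q = eval2 g q + eval2 h q.
Proof. exact: mevalD. Qed.
Lemma eval2N g q : eval2 (- g) q = - eval2 g q.
Proof. exact: mevalN. Qed.
Lemma eval2M g h q : eval2 (g * h) q = eval2 g q * eval2 h q.
Proof. exact: mevalM. Qed.
Lemma eval2_2 q : eval2 2 q = 2.
Proof. by rewrite -[2%R in LHS](@mpolyC_nat _ _ 2) /eval2 mevalC. Qed.

Lemma eval2_hess_x h q : eval2 (dx (hess h)) q = jhess_x (jet h q).
Proof. by rewrite dx_hess !(eval2D, eval2N, eval2M, eval2_2). Qed.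

Lemma eval2_hess_y h q : eval2 (dy (hess h)) q = jhess_y (jet h q).
Proof. by rewrite dy_hess !(eval2D, eval2N, eval2M, eval2_2). Qed.

Lemma eval2_hess_xx h q : eval2 (dx (dx (hess h))) q = jhess_xx (jet h q).
Proof.
have -> : dx (dx (hess h)) = dx (dx (dx (dx h))) * dy (dy h)
   + 2 * dx (dx (dx h)) * dx (dy (dy h)) + dx (dx h) * dx (dx (dy (dy h)))
   - 2 * (dx (dx (dy h)) * dx (dx (dy h)))
   - 2 * dx (dy h) * dx (dx (dx (dy h))).
  rewrite dx_hess {1}/dx mderivB mderivD -!mulrA (mulr_natl _ 2) mderivMn.
  rewrite !mderivM !dxE -(mulr_natl _ 2); ring.
by rewrite !(eval2D, eval2N, eval2M, eval2_2) -expr2.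
Qed.

Lemma eval2_hess_xy h q : eval2 (dy (dx (hess h))) q = jhess_xy (jet h q).
Proof.
have -> : dy (dx (hess h)) = dx (dx (dx (dy h))) * dy (dy h)
   + dx (dx (dx h)) * dy (dy (dy h))
   + dx (dx (dy h)) * dx (dy (dy h)) + dx (dx h) * dx (dy (dy (dy h)))
   - 2 * dx (dy (dy h)) * dx (dx (dy h))
   - 2 * dx (dy h) * dx (dx (dy (dy h))).
  rewrite dx_hess {1}/dy mderivB mderivD -!mulrA (mulr_natl _ 2) mderivMn.
  rewrite !mderivM !dyE !dyxx -(mulr_natl _ 2); ring.
by rewrite !(eval2D, eval2N, eval2M, eval2_2).
Qed.

Lemma eval2_hess_yy h q : eval2 (dy (dy (hess h))) q = jhess_yy (jet h q).
Proof.
have -> : dy (dy (hess h)) = dx (dx (dy (dy h))) * dy (dy h)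
   + 2 * dx (dx (dy h)) * dy (dy (dy h)) + dx (dx h) * dy (dy (dy (dy h)))
   - 2 * (dx (dy (dy h)) * dx (dy (dy h)))
   - 2 * dx (dy h) * dx (dy (dy (dy h))).
  rewrite dy_hess {1}/dy mderivB mderivD -!mulrA (mulr_natl _ 2) mderivMn.
  rewrite !mderivM !dyE !dyxx -(mulr_natl _ 2); ring.
by rewrite !(eval2D, eval2N, eval2M, eval2_2) -expr2.
Qed.

Let evalE := (eval2D, eval2N, eval2M, eval2_hess_x, eval2_hess_y, eval2_hess_xx,
  eval2_hess_xy, eval2_hess_yy).

Lemma eval2_E1 h q : eval2 (E1 h) q = jE1 (jet h q).
Proof. by rewrite !evalE. Qed.

Lemma eval2_E2 h q : eval2 (E2 h) q = jE2 (jet h q).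
Proof. by rewrite !evalE. Qed.

Lemma eval2_E1_x h q : eval2 (dx (E1 h)) q = jE1_x (jet h q).
Proof.
have -> : dx (E1 h) = - dx (dx (dx h)) * dy (hess h) - dx (dx h) * dy (dx (hess h))
   + dx (dx (dy h)) * dx (hess h) + dx (dy h) * dx (dx (hess h)).
  by rewrite {1}/dx mderivD !mderivM mderivN !dxE !dyxx; ring.
by rewrite !evalE.
Qed.

Lemma eval2_E1_y h q : eval2 (dy (E1 h)) q = jE1_y (jet h q).
Proof.
have -> : dy (E1 h) = - dx (dx (dy h)) * dy (hess h) - dx (dx h) * dy (dy (hess h))
   + dx (dy (dy h)) * dx (hess h) + dx (dy h) * dy (dx (hess h)).
  by rewrite {1}/dy mderivD !mderivM mderivN !dyE !dyxx; ring.
by rewrite !evalE.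
Qed.

Lemma eval2_E2_x h q : eval2 (dx (E2 h)) q = jE2_x (jet h q).
Proof.
have -> : dx (E2 h) = - dx (dx (dy h)) * dy (hess h) - dx (dy h) * dy (dx (hess h))
   + dx (dy (dy h)) * dx (hess h) + dy (dy h) * dx (dx (hess h)).
  by rewrite {1}/dx mderivD !mderivM mderivN !dxE !dyxx; ring.
by rewrite !evalE.
Qed.

Lemma eval2_E2_y h q : eval2 (dy (E2 h)) q = jE2_y (jet h q).
Proof.
have -> : dy (E2 h) = - dx (dy (dy h)) * dy (hess h) - dx (dy h) * dy (dy (hess h))
   + dy (dy (dy h)) * dx (hess h) + dy (dy h) * dy (dx (hess h)).
  by rewrite {1}/dy mderivD !mderivM mderivN !dyE !dyxx; ring.
by rewrite !evalE.
Qed.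

End Jets.

Section JetKernel.
Variable R : fieldType.
Implicit Type J : nat -> nat -> R.

(** Cramer's rule: E1 and E2 are linear in (H_x, H_y) with determinant H up to sign, so E1 = E2 = 0
    gives H grad H = 0. *)
Lemma tspp_jet_hess0 J : tspp_jet J -> jhess J = 0.
Proof.
case=> e1 e2 gH _; have [] := orP gH => nz; apply: (mulIf nz); rewrite mul0r.
  have -> : jhess J * jhess_x J = J 2 0 * jE2 J - J 1 1 * jE1 J.
    by rewrite /jE1 /jE2 /jhess; ring.
  by rewrite e1 e2; ring.
have -> : jhess J * jhess_y J = J 1 1 * jE2 J - J 0 2 * jE1 J.
  by rewrite /jE1 /jE2 /jhess; ring.
by rewrite e1 e2; ring.
Qed.

(** As H = 0, the second fundamental form has rank one, and its kernel is spanned by w = (h_xy,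
    -h_xx), or by (1, 0) when h_xx = 0. E1 is the derivative of H along the former w; in the other
    case E2 is h_yy H_x. On a form of rank one, the derivative of H along the kernel is a multiple
    of the third derivative of h along it. *)
Lemma tspp_jet_kernel J : tspp_jet J -> exists w0 w1 : R,
  [/\ (w0 != 0) || (w1 != 0),
      J 2 0 * w0 ^+ 2 + 2 * J 1 1 * w0 * w1 + J 0 2 * w1 ^+ 2 = 0,
      J 3 0 * w0 ^+ 3 + 3 * J 2 1 * w0 ^+ 2 * w1 + 3 * J 1 2 * w0 * w1 ^+ 2
        + J 0 3 * w1 ^+ 3 = 0
    & forall v0 v1, J 2 0 * v0 ^+ 2 + 2 * J 1 1 * v0 * v1 + J 0 2 * v1 ^+ 2 = 0 ->
        v0 * w1 = v1 * w0].
Proof.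
move=> tJ; have H0 := tspp_jet_hess0 tJ; case: tJ => e1 e2 gH _.
have H0' : J 2 0 * J 0 2 = J 1 1 ^+ 2.
  by apply/eqP; rewrite -subr_eq0; apply/eqP.
have [a0|a0] := eqVneq (J 2 0) 0.
  have b0 : J 1 1 = 0 by apply/eqP; rewrite -sqrf_eq0 -H0' a0 mul0r.
  (* Otherwise all second derivatives would vanish, and grad H with them. *)
  have c0 : J 0 2 != 0.
    apply: contraTneq gH => c0; rewrite /jhess_x /jhess_y a0 b0 c0.
    by rewrite !(mulr0, mul0r, addr0, subr0) eqxx.
  exists 1, 0; split; first by rewrite oner_eq0.
  - by rewrite a0; ring.
  - have : jE2 J = J 0 2 ^+ 2 * J 3 0.
      by rewrite /jE2 /jhess_x /jhess_y a0 b0; ring.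
    rewrite e2 => /esym/eqP; rewrite mulf_eq0 sqrf_eq0 (negPf c0) /= => /eqP ->.
    by ring.
  - move=> v0 v1; rewrite a0 b0 !(mul0r, mulr0, add0r) => /eqP.
    by rewrite mulf_eq0 sqrf_eq0 (negPf c0) /= => /eqP ->; rewrite mul0r.
exists (J 1 1), (- J 2 0); split; first by rewrite oppr_eq0 a0 orbT.
- have -> : J 2 0 * J 1 1 ^+ 2 + 2 * J 1 1 * J 1 1 * - J 2 0
    + J 0 2 * (- J 2 0) ^+ 2 = J 2 0 * jhess J by rewrite /jhess; ring.
  by rewrite H0 mulr0.
- set c := LHS.
  have -> : c = J 2 0 * jE1 J
     + jhess J * (- J 3 0 * J 1 1 + J 2 1 * J 2 0).
    by rewrite /c /jE1 /jhess_x /jhess_y /jhess; ring.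
  by rewrite e1 H0; ring.
- move=> v0 v1 q0; apply/eqP; rewrite -subr_eq0 -sqrf_eq0.
  (* With H = 0, h_xx times the quadratic form is the square of the linear form that vanishes on the
     kernel. *)
  have -> : (v0 * - J 2 0 - v1 * J 1 1) ^+ 2 =
    J 2 0 * (J 2 0 * v0 ^+ 2 + 2 * J 1 1 * v0 * v1 + J 0 2 * v1 ^+ 2)
    - jhess J * v1 ^+ 2 by rewrite /jhess; ring.
  by rewrite q0 H0 mulr0 mul0r subrr.
Qed.

End JetKernel.

(** * Contact of a line with the graph *)

Section Restriction.
Variable R : comRingType.

(** The chain rule. Both sides are additive and satisfy the Leibniz rule, so constants and variables
    suffice. *)
Lemma deriv_mmap n (l : 'I_n -> {poly R}) (g : {mpoly R[n]}) :
  (mmap (@polyC R) l g)^`() = \sum_i (l i)^`() * mmap (@polyC R) l g^`M(i).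
Proof.
pose Q (g : {mpoly R[n]}) :=
  (mmap (@polyC R) l g)^`() = \sum_i (l i)^`() * mmap (@polyC R) l g^`M(i).
have QC c : Q c%:MP.
  rewrite /Q mmapC derivC big1 // => i _.
  by rewrite mderivC mmapC mulr0.
have QM g1 g2 : Q g1 -> Q g2 -> Q (g1 * g2).
  rewrite /Q rmorphM derivM => -> ->.
  rewrite mulr_suml mulr_sumr -big_split; apply: eq_bigr => i _ /=.
  by rewrite mderivM rmorphD !rmorphM /=; ring.
have QX i : Q 'X_i.
  rewrite /Q mmapX mmap1U (bigD1 i) //= mderivX mnm1E eqxx scale1r.
  have -> : (U_(i) - U_(i) = 0)%MM by apply/mnmP => j; rewrite mnmBE mnm0E subnn.
  rewrite mpolyX0 rmorph1 mulr1 big1 ?addr0 // => j ji.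
  by rewrite mderivX mnm1E eq_sym (negPf ji) scale0r rmorph0 mulr0.
have QXm m : Q 'X_[m].
  rewrite mpolyXE_id; apply: (big_ind Q) => //; first by rewrite -mpolyC1; apply: QC.
  move=> i _; elim: (m i) => [|k IH]; first by rewrite expr0 -mpolyC1; apply: QC.
  by rewrite exprS; apply: QM.
rewrite -/(Q g); elim/mpolyind: g => [|c m g _ _ Qg].
  by rewrite -mpolyC0; apply: QC.
have : Q (c *: 'X_[m]) by rewrite -mul_mpolyC; apply: QM.
move: Qg; rewrite /Q => Qg Qc; rewrite rmorphD derivD Qg Qc -big_split.
by apply: eq_bigr => i _; rewrite mderivD rmorphD mulrDr.
Qed.

Lemma horner_mmap n (l : 'I_n -> {poly R}) (g : {mpoly R[n]}) (u : R) :
  (mmap (@polyC R) l g).[u] = g.@[fun i => (l i).[u]].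
Proof.
rewrite /mmap horner_sum mevalE; apply: eq_bigr => m _.
rewrite hornerM hornerC /mmap1; congr (_ * _).
by rewrite horner_prod; apply: eq_bigr => i _; rewrite horner_exp.
Qed.

Lemma mmap_mwiden (S : comRingType) (f : {rmorphism R -> S}) n
    (l : 'I_n.+1 -> S) (g : {mpoly R[n]}) :
  mmap f l (mwiden g) = mmap f (fun i => l (widen_ord (leqnSn n) i)) g.
Proof.
elim/mpolyind: g => [|c m g _ _ IH]; first by rewrite mwiden0 !mmap0.
rewrite mwidenD !mmapD IH mwidenZ !mmapZ mwidenX !mmapX; congr (_ * _ + _).
rewrite /mmap1 big_ord_recr /= mnmwiden_ordmax expr0 mulr1.
by apply: eq_bigr => i _; rewrite mnmwiden_widen.
Qed.

End Restriction.

Section Contact.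
Variable R : realType.
Implicit Types (g h : {mpoly R[2]}) (q : 'rV[R]_2) (p w : 'rV[R]_3).

Let i0 : 'I_3 := widen_ord (leqnSn 2) ord0.
Let i1 : 'I_3 := widen_ord (leqnSn 2) ord_max.

Definition restrict (g : {mpoly R[2]}) p (u0 : R) w : {poly R} :=
  mmap (@polyC R) (fun i : 'I_2 =>
    (p 0 (widen_ord (leqnSn 2) i))%:P
      + ('X - u0%:P) * (w 0 (widen_ord (leqnSn 2) i))%:P) g.

Lemma horner_restrict g p u0 w : (restrict g p u0 w).[u0] = eval2 g (proj p).
Proof.
rewrite /restrict horner_mmap; apply: meval_eq => i.
by rewrite hornerD hornerM hornerXsubC !hornerC subrr mul0r addr0 mxE.
Qed.

Lemma deriv_restrict g p u0 w : (restrict g p u0 w)^`() =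
  (w 0 i0) *: restrict (dx g) p u0 w + (w 0 i1) *: restrict (dy g) p u0 w.
Proof.
have dl (a b : R) : (a%:P + ('X - u0%:P) * b%:P)^`() = b%:P.
  by rewrite derivD derivM derivB derivX !derivC subr0 add0r mul1r mulr0 addr0.
have lift1 : lift ord0 ord0 = ord_max :> 'I_2 by apply/val_inj.
by rewrite /restrict deriv_mmap big_ord_recl big_ord1 !dl !mul_polyC lift1.
Qed.

Lemma along_lineE h p u0 w : along_line h p u0 w =
  restrict h p u0 w - ((p 0 ord_max)%:P + ('X - u0%:P) * (w 0 ord_max)%:P).
Proof. by rewrite /along_line /graph_eq mmapB mmap_mwiden mmapX mmap1U. Qed.

Let dlin (a b u0 : R) : (a%:P + ('X - u0%:P) * b%:P)^`() = b%:P.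
Proof.
by rewrite derivD derivM derivB derivX !derivC subr0 add0r mul1r mulr0 addr0.
Qed.

Lemma contact0 h p u0 w :
  (along_line h p u0 w).[u0] = eval2 h (proj p) - p 0 ord_max.
Proof.
rewrite along_lineE hornerD hornerN horner_restrict hornerD hornerM hornerXsubC.
by rewrite !hornerC subrr mul0r addr0.
Qed.

Lemma contact1 h p u0 w : (along_line h p u0 w)^`().[u0] =
  jet h (proj p) 1 0 * w 0 i0 + jet h (proj p) 0 1 * w 0 i1 - w 0 ord_max.
Proof.
rewrite along_lineE derivB deriv_restrict dlin hornerD hornerN hornerD !hornerZ.
by rewrite !horner_restrict hornerC mulrC [w 0 i1 * _]mulrC.
Qed.

Let dyxx h : dy (dx h) = dx (dy h). Proof. exact: (dy_iter_dx 1 0). Qed.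

Lemma deriv2_along_line h p u0 w : (along_line h p u0 w)^`(2) =
  (w 0 i0 ^+ 2) *: restrict (dx (dx h)) p u0 w
  + (2 * w 0 i0 * w 0 i1) *: restrict (dx (dy h)) p u0 w
  + (w 0 i1 ^+ 2) *: restrict (dy (dy h)) p u0 w.
Proof.
rewrite derivSn derivn1 along_lineE [X in X^`()]derivB deriv_restrict dlin.
rewrite derivB derivC subr0 derivD !derivZ !deriv_restrict dyxx.
rewrite -!mul_polyC; ring.
Qed.

Lemma contact2 h p u0 w : (along_line h p u0 w)^`(2).[u0] =
  jet h (proj p) 2 0 * w 0 i0 ^+ 2
  + 2 * jet h (proj p) 1 1 * w 0 i0 * w 0 i1
  + jet h (proj p) 0 2 * w 0 i1 ^+ 2.
Proof.
rewrite deriv2_along_line !hornerD !hornerZ !horner_restrict /jet /=; ring.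
Qed.

Lemma contact3 h p u0 w : (along_line h p u0 w)^`(3).[u0] =
  jet h (proj p) 3 0 * w 0 i0 ^+ 3
  + 3 * jet h (proj p) 2 1 * w 0 i0 ^+ 2 * w 0 i1
  + 3 * jet h (proj p) 1 2 * w 0 i0 * w 0 i1 ^+ 2
  + jet h (proj p) 0 3 * w 0 i1 ^+ 3.
Proof.
have -> : (along_line h p u0 w)^`(3) =
    (w 0 i0 ^+ 3) *: restrict (dx (dx (dx h))) p u0 w
    + (3 * w 0 i0 ^+ 2 * w 0 i1) *: restrict (dx (dx (dy h))) p u0 w
    + (3 * w 0 i0 * w 0 i1 ^+ 2) *: restrict (dx (dy (dy h))) p u0 w
    + (w 0 i1 ^+ 3) *: restrict (dy (dy (dy h))) p u0 w.
  rewrite derivnS deriv2_along_line !derivD !derivZ !deriv_restrict !dyxx.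
  move: (restrict (dx (dx (dx h))) p u0 w) (restrict (dx (dx (dy h))) p u0 w).
  move: (restrict (dx (dy (dy h))) p u0 w) (restrict (dy (dy (dy h))) p u0 w).
  by move: (w 0 i0) (w 0 i1) => a b C D A B; rewrite -!mul_polyC; ring.
have hornerZ4 (a b c d : R) A B C D :
    (a *: A + b *: B + c *: C + d *: D).[u0]
      = A.[u0] * a + B.[u0] * b + C.[u0] * c + D.[u0] * d.
  by rewrite !hornerD !hornerZ; ring.
rewrite hornerZ4 !horner_restrict /jet /=.
move: (eval2 (dx (dx (dx h))) _) (eval2 (dx (dx (dy h))) _) => j30 j21.
move: (eval2 (dx (dy (dy h))) _) (eval2 (dy (dy (dy h))) _) => j12 j03.
by move: (w 0 i0) (w 0 i1) => a b; ring.
Qed.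

Lemma contact_order_exists h p u0 w n :
  (forall m, (m < n)%N -> (along_line h p u0 w)^`(m).[u0] = 0) ->
  exists k, contact_order h p u0 w k /\ (if k is Some k then (n <= k)%N : Prop else True).
Proof.
move=> h0; set F := along_line h p u0 w in h0 *.
have [[m Fm]|nF] := pselect (exists m, F^`(m).[u0] != 0).
  have ex : exists m, F^`(m).[u0] != 0 by exists m.
  case: (ex_minnP ex) => k Fk mink; exists (Some k); split; first split => //.
    by move=> j jk; apply/eqP; apply: contraTT jk => /mink; rewrite -leqNgt.
  by rewrite leqNgt; apply/negP => /h0 F0; rewrite F0 eqxx in Fk.
exists None; split=> // m; apply/eqP; apply: contra_notT nF => Fm.
by exists m.
Qed.

Lemma contact_ge_deriv h p u0 w k n m : contact_order h p u0 w k ->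
  (if k is Some k then (n <= k)%N : Prop else True) -> (m < n)%N ->
  (along_line h p u0 w)^`(m).[u0] = 0.
Proof.
by case: k => [k [F0 _] nk mn|F0 _ _]; apply: F0; exact: leq_trans nk.
Qed.

(** An asymptotic direction is a set of points, so its uniqueness has to ignore the base parameter
    and the length of the direction vector. *)
Lemma eq_range_param_line p (u0 u1 c : R) w w' : c != 0 -> w' = c *: w ->
  range (param_line p u0 w') = range (param_line p u1 w).
Proof.
move=> c0 ->; apply/seteqP; split=> _ [u _ <-]; rewrite /param_line.
  exists (u1 + (u - u0) * c) => //; rewrite scalerA; congr (_ + _ *: _).
  by rewrite addrC addKr.
exists (u0 + (u - u1) / c) => //; rewrite scalerA; congr (_ + _ *: _).
by rewrite addrC addKr mulfVK.
Qed.

Lemma special_parabolic_jet h p : graph h p -> tspp_jet (jet h (proj p)) ->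
  special_parabolic h p.
Proof.
move=> gp tJ; split=> //.
have [a [b [ab0 q0 cub0 uniq_ab]]] := tspp_jet_kernel tJ.
set J := jet h (proj p) in tJ q0 cub0 uniq_ab.
(* The vertical component that makes the line tangent to the graph. *)
pose c := J 1 0 * a + J 0 1 * b.
pose w : 'rV[R]_3 := \row_i (if i == i0 then a else if i == i1 then b else c).
have wa : w 0 i0 = a by rewrite mxE.
have wb : w 0 i1 = b by rewrite mxE.
have wc : w 0 ord_max = c by rewrite mxE.
have w0 : w != 0.
  apply: contraTneq ab0 => w0.
  by rewrite -wa -wb w0 !mxE eqxx.
have F0 m : (m < 4)%N -> (along_line h p 0 w)^`(m).[0] = 0.
  case: m => [|[|[|[|//]]]] _.
  - by rewrite derivn0 contact0 gp subrr.
  - by rewrite derivn1 contact1 wa wb wc subrr.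
  - by rewrite contact2 wa wb.
  - by rewrite contact3 wa wb.
have [k [ck k4]] := contact_order_exists F0.
exists (range (param_line p 0 w)); split; last by exists 0, w, k.
split; first by exists 0, w, k; split=> //; case: k k4 {ck} => // k; exact: ltnW.
move=> L [u1 [w' [k' [w'0 -> ck' k'3]]]].
have F0' m := contact_ge_deriv (m := m) ck' k'3.
(* For any line of contact at least 3, the first derivative determines the vertical component and
   the second puts the horizontal part in the kernel. *)
have := F0' 1%N isT; rewrite derivn1 contact1 => /eqP; rewrite subr_eq0 => /eqP w'c.
have := F0' 2%N isT; rewrite contact2 => /uniq_ab w'ab.
suff [r ra rb] : exists2 r, w' 0 i0 = r * a & w' 0 i1 = r * b.
  have w'E : w' = r *: w.
    apply/rowP => i; rewrite mxE.
    have [->|[->|->]] : i = i0 \/ i = i1 \/ i = ord_max.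
      case: i => [[|[|[|//]]]] Hi; [left|right;left|right;right]; exact/val_inj.
    - by rewrite wa.
    - by rewrite wb.
    - by rewrite wc -w'c ra rb /c; ring.
  have r0 : r != 0 by apply: contraNneq w'0 => r0; rewrite w'E r0 scale0r.
  exact/esym/(eq_range_param_line _ _ _ r0).
have [a0|a0] := eqVneq a 0; last first.
  exists (w' 0 i0 / a); first by rewrite divfK.
  by rewrite mulrAC w'ab mulfK.
have b0 : b != 0 by rewrite a0 eqxx in ab0.
exists (w' 0 i1 / b); last by rewrite divfK.
by rewrite mulrAC -w'ab mulfK.
Qed.

Lemma det_mx22 (M : 'M[R]_2) :
  \det M = M ord0 ord0 * M ord_max ord_max - M ord0 ord_max * M ord_max ord0.
Proof.
rewrite (expand_det_row _ ord0) big_ord_recl big_ord1 /cofactor !det_mx11 !mxE.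
have lift1 : lift ord0 ord0 = ord_max :> 'I_2 by apply/val_inj.
have lift0 : lift (ord_max : 'I_2) 0 = ord0 by apply/val_inj.
by rewrite !lift1 lift0 expr0 expr1; ring.
Qed.

Lemma row_free_col_mx (u v : 'rV[R]_2) : row_free (col_mx u v) =
  (u 0 ord0 * v 0 ord_max - u 0 ord_max * v 0 ord0 != 0).
Proof.
have hu j : col_mx u v ord0 j = u 0 j.
  by rewrite -(col_mxEu u v); congr (col_mx _ _ _ _); apply/val_inj.
have hv j : col_mx u v ord_max j = v 0 j.
  by rewrite -(col_mxEd u v); congr (col_mx _ _ _ _); apply/val_inj.
by rewrite row_free_unit unitmxE unitfE det_mx22 !hu !hv.
Qed.

Lemma tspp_of_jet h p : graph h p -> tspp_jet (jet h (proj p)) -> TSPP h p.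
Proof.
move=> gp tJ; have sp := special_parabolic_jet gp tJ.
case: tJ => e1 e2 gH det0; split=> //.
  apply: contraTneq gH => /rowP gH; have := gH ord0; have := gH ord_max.
  by rewrite !mxE -eval2_hess_x -eval2_hess_y => -> ->; rewrite eqxx.
split; [by rewrite eval2_E1|by rewrite eval2_E2|].
rewrite row_free_col_mx !mxE -/(dx _) -/(dy _).
have := det0; rewrite /jdet -!eval2_E1_x -!eval2_E1_y -!eval2_E2_x -!eval2_E2_y.
by rewrite [eval2 (dy (E1 h)) _ * _]mulrC [_ * eval2 (dy (E1 h)) _]mulrC.
Qed.

End Contact.

(** * Trinomials *)

Section JetOnParabolicCone.
Variable R : fieldType.
Implicit Type J : nat -> nat -> R.

Definition quartic_form J (s : R) := J 4 0 * s ^+ 4 + 4 * J 3 1 * s ^+ 3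
  + 6 * J 2 2 * s ^+ 2 + 4 * J 1 3 * s + J 0 4.

(** With one axis along the kernel (s, 1), the jet has principal part D X^2 / 2 + u X Y^2 / 2 + Q
    Y^4 / 24, Q being [quartic_form]. Completing the square leaves (D Q - 3 u^2) Y^4 / (24 D): the
    last factor of the Jacobian is the usual nondegeneracy condition for a cusp of the Gauss map. *)
Lemma jdet_on_cone J (s D u : R) :
  J 2 0 = D -> J 1 1 = - s * D -> J 0 2 = s ^+ 2 * D ->
  J 3 0 * s ^+ 3 + 3 * J 2 1 * s ^+ 2 + 3 * J 1 2 * s + J 0 3 = 0 ->
  J 3 0 * s ^+ 2 + 2 * J 2 1 * s + J 1 2 = u ->
  [/\ jE1 J = 0, jE2 J = 0, jhess_x J = D * u
    & jdet J = D ^+ 2 * u ^+ 2 * (D * quartic_form J s - 3 * u ^+ 2)].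
Proof.
move=> Jxx Jxy Jyy P0 Ju.
have Jxyy : J 1 2 = u - J 3 0 * s ^+ 2 - 2 * J 2 1 * s by rewrite -Ju; ring.
have Jyyy : J 0 3 = - (J 3 0 * s ^+ 3 + 3 * J 2 1 * s ^+ 2 + 3 * J 1 2 * s).
  by rewrite -[LHS]subr0 -P0; ring.
rewrite /jdet /jE1_x /jE1_y /jE2_x /jE2_y /jE1 /jE2.
rewrite /jhess_xx /jhess_xy /jhess_yy /jhess_x /jhess_y /quartic_form.
rewrite Jyyy Jxyy Jxx Jxy Jyy; split; ring.
Qed.

End JetOnParabolicCone.

Section TrinomialJets.
Variable R : fieldType.
Variables (a1 b1 a2 b2 a3 b3 : R).

Let al (a b : R) := a * (a - 1).
Let be (a b : R) := a * b.
Let ga (a b : R) := b * (b - 1).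

(* The monomials X with (h_xx, h_xy, h_yy) proportional to (1, -s, s^2), that is, with
   degenerate Hessian of kernel (s, 1), are the cross products below, up to scaling. *)
Definition conic_coord (a b a' b' s : R) :=
  (al a b * be a' b' - al a' b' * be a b) * s ^+ 2
  + (al a b * ga a' b' - al a' b' * ga a b) * s
  + (be a b * ga a' b' - be a' b' * ga a b).

Definition conic_coord' (a b a' b' s : R) :=
  2 * (al a b * be a' b' - al a' b' * be a b) * s
  + (al a b * ga a' b' - al a' b' * ga a b).

(* Third derivative of the monomial x^a y^b at (1, 1) in the direction (s, 1). *)
Definition cubic_weight (a b s : R) :=
  a * (a - 1) * (a - 2) * s ^+ 3 + 3 * (a * (a - 1)) * b * s ^+ 2
  + 3 * a * (b * (b - 1)) * s + b * (b - 1) * (b - 2).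

Definition cubic_weight' (a b s : R) :=
  3 * (a * (a - 1) * (a - 2)) * s ^+ 2 + 6 * (a * (a - 1)) * b * s
  + 3 * a * (b * (b - 1)).

Definition falling (x : R) (i : nat) := \prod_(k < i) (x - k%:R).

(** The derivatives at (1, 1) of the sum of the X_i x^a_i y^b_i; rescaling x and y moves any point
    of the torus there. Exponents are field elements, so that [ring] can treat them as variables. *)
Definition tri_jet (X1 X2 X3 : R) i j :=
  X1 * falling a1 i * falling b1 j + X2 * falling a2 i * falling b2 j
  + X3 * falling a3 i * falling b3 j.

(** The third derivative of the trinomial along its own kernel direction. *)
Definition tri_quintic s :=
  cubic_weight a1 b1 s * conic_coord a2 b2 a3 b3 s
  + cubic_weight a2 b2 s * conic_coord a3 b3 a1 b1 s
  + cubic_weight a3 b3 s * conic_coord a1 b1 a2 b2 s.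

Definition tri_quintic' s :=
  cubic_weight' a1 b1 s * conic_coord a2 b2 a3 b3 s
  + cubic_weight' a2 b2 s * conic_coord a3 b3 a1 b1 s
  + cubic_weight' a3 b3 s * conic_coord a1 b1 a2 b2 s
  + (cubic_weight a1 b1 s * conic_coord' a2 b2 a3 b3 s
  + cubic_weight a2 b2 s * conic_coord' a3 b3 a1 b1 s
  + cubic_weight a3 b3 s * conic_coord' a1 b1 a2 b2 s).

(** The determinant of the linear map from (X1, X2, X3) to (h_xx, h_xy, h_yy). *)
Definition conic_det :=
  al a1 b1 * (be a2 b2 * ga a3 b3 - be a3 b3 * ga a2 b2)
  + al a2 b2 * (be a3 b3 * ga a1 b1 - be a1 b1 * ga a3 b3)
  + al a3 b3 * (be a1 b1 * ga a2 b2 - be a2 b2 * ga a1 b1).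

(** Twice the signed area of the triangle of exponents. *)
Definition affine_det := (a2 - a1) * (b3 - b1) - (a3 - a1) * (b2 - b1).

Lemma falling0 x : falling x 0 = 1. Proof. exact: big_ord0. Qed.
Lemma fallingS x i : falling x i.+1 = falling x i * (x - i%:R).
Proof. exact: big_ord_recr. Qed.

Let fallE := (falling0, fallingS, mul1r, subr0).

Lemma tri_jet_tspp s (X1 := conic_coord a2 b2 a3 b3 s)
    (X2 := conic_coord a3 b3 a1 b1 s) (X3 := conic_coord a1 b1 a2 b2 s) :
  conic_det != 0 -> affine_det != 0 -> X1 != 0 -> X2 != 0 -> X3 != 0 ->
  tri_quintic s = 0 -> tri_quintic' s != 0 ->
  [/\ tspp_jet (tri_jet X1 X2 X3), tri_jet X1 X2 X3 2 0 != 0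
    & tri_jet X1 X2 X3 1 1 = - s * tri_jet X1 X2 X3 2 0].
Proof.
move=> D0 V0 X10 X20 X30 P0 P'0.
pose X1' := conic_coord' a2 b2 a3 b3 s.
pose X2' := conic_coord' a3 b3 a1 b1 s.
pose X3' := conic_coord' a1 b1 a2 b2 s.
set D := conic_det in D0.
(* Injectivity of the matrix with determinant D, obtained by applying its adjugate. *)
have adj Y1 Y2 Y3 : al a1 b1 * Y1 + al a2 b2 * Y2 + al a3 b3 * Y3 = 0 ->
    be a1 b1 * Y1 + be a2 b2 * Y2 + be a3 b3 * Y3 = 0 ->
    ga a1 b1 * Y1 + ga a2 b2 * Y2 + ga a3 b3 * Y3 = 0 ->
    [/\ Y1 = 0, Y2 = 0 & Y3 = 0].
  move=> e1 e2 e3; split; apply: (mulfI D0); rewrite mulr0.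
  - transitivity ((be a2 b2 * ga a3 b3 - be a3 b3 * ga a2 b2)
      * (al a1 b1 * Y1 + al a2 b2 * Y2 + al a3 b3 * Y3)
      + (ga a2 b2 * al a3 b3 - ga a3 b3 * al a2 b2)
      * (be a1 b1 * Y1 + be a2 b2 * Y2 + be a3 b3 * Y3)
      + (al a2 b2 * be a3 b3 - al a3 b3 * be a2 b2)
      * (ga a1 b1 * Y1 + ga a2 b2 * Y2 + ga a3 b3 * Y3)).
      rewrite /D /conic_det.
      by move: (al a1 b1) (al a2 b2) (al a3 b3) (be a1 b1) (be a2 b2) (be a3 b3)
        (ga a1 b1) (ga a2 b2) (ga a3 b3) => *; ring.
    by rewrite e1 e2 e3; ring.
  - transitivity ((be a3 b3 * ga a1 b1 - be a1 b1 * ga a3 b3)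
      * (al a1 b1 * Y1 + al a2 b2 * Y2 + al a3 b3 * Y3)
      + (ga a3 b3 * al a1 b1 - ga a1 b1 * al a3 b3)
      * (be a1 b1 * Y1 + be a2 b2 * Y2 + be a3 b3 * Y3)
      + (al a3 b3 * be a1 b1 - al a1 b1 * be a3 b3)
      * (ga a1 b1 * Y1 + ga a2 b2 * Y2 + ga a3 b3 * Y3)).
      rewrite /D /conic_det.
      by move: (al a1 b1) (al a2 b2) (al a3 b3) (be a1 b1) (be a2 b2) (be a3 b3)
        (ga a1 b1) (ga a2 b2) (ga a3 b3) => *; ring.
    by rewrite e1 e2 e3; ring.
  - transitivity ((be a1 b1 * ga a2 b2 - be a2 b2 * ga a1 b1)
      * (al a1 b1 * Y1 + al a2 b2 * Y2 + al a3 b3 * Y3)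
      + (ga a1 b1 * al a2 b2 - ga a2 b2 * al a1 b1)
      * (be a1 b1 * Y1 + be a2 b2 * Y2 + be a3 b3 * Y3)
      + (al a1 b1 * be a2 b2 - al a2 b2 * be a1 b1)
      * (ga a1 b1 * Y1 + ga a2 b2 * Y2 + ga a3 b3 * Y3)).
      rewrite /D /conic_det.
      by move: (al a1 b1) (al a2 b2) (al a3 b3) (be a1 b1) (be a2 b2) (be a3 b3)
        (ga a1 b1) (ga a2 b2) (ga a3 b3) => *; ring.
    by rewrite e1 e2 e3; ring.
(* By construction X(s) is the Cramer solution with right-hand side D (1, -s, s^2); the next block
   is the derivative of this in s. *)
have [A0 B0 C0] : [/\ al a1 b1 * X1 + al a2 b2 * X2 + al a3 b3 * X3 = D,
    be a1 b1 * X1 + be a2 b2 * X2 + be a3 b3 * X3 = - s * D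
  & ga a1 b1 * X1 + ga a2 b2 * X2 + ga a3 b3 * X3 = s ^+ 2 * D].
  rewrite /X1 /X2 /X3 /conic_coord /D /conic_det.
  by move: (al a1 b1) (al a2 b2) (al a3 b3) (be a1 b1) (be a2 b2) (be a3 b3)
        (ga a1 b1) (ga a2 b2) (ga a3 b3) => *; split; ring.
have [A1 B1 C1] : [/\ al a1 b1 * X1' + al a2 b2 * X2' + al a3 b3 * X3' = 0,
    be a1 b1 * X1' + be a2 b2 * X2' + be a3 b3 * X3' = - D
  & ga a1 b1 * X1' + ga a2 b2 * X2' + ga a3 b3 * X3' = 2 * s * D].
  rewrite /X1' /X2' /X3' /conic_coord' /D /conic_det.
  by move: (al a1 b1) (al a2 b2) (al a3 b3) (be a1 b1) (be a2 b2) (be a3 b3)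
        (ga a1 b1) (ga a2 b2) (ga a3 b3) => *; split; ring.
have {P0}P0 : cubic_weight a1 b1 s * X1 + cubic_weight a2 b2 s * X2
  + cubic_weight a3 b3 s * X3 = 0 by [].
have {}P'0 : cubic_weight' a1 b1 s * X1 + cubic_weight' a2 b2 s * X2
  + cubic_weight' a3 b3 s * X3 + (cubic_weight a1 b1 s * X1'
  + cubic_weight a2 b2 s * X2' + cubic_weight a3 b3 s * X3') != 0 by [].
have defD : D = conic_det by [].
(* Only the relations just proved are used from here on; forgetting the definitions of the
   coordinates keeps the [ring] goals small. *)
move: X1 X2 X3 X1' X2' X3' D defD D0 adj X10 X20 X30 P0 P'0 A0 B0 C0 A1 B1 C1.
move=> X1 X2 X3 X1' X2' X3' D defD D0 adj X10 X20 X30 P0 P'0 A0 B0 C0 A1 B1 C1.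
set J := tri_jet X1 X2 X3.
have Jxx : J 2 0 = D by rewrite -A0 /J /tri_jet !fallE /al; ring.
have Jxy : J 1 1 = - s * D by rewrite -B0 /J /tri_jet !fallE /be; ring.
have Jyy : J 0 2 = s ^+ 2 * D by rewrite -C0 /J /tri_jet !fallE /ga; ring.
have PJ : J 3 0 * s ^+ 3 + 3 * J 2 1 * s ^+ 2 + 3 * J 1 2 * s + J 0 3 = 0.
  by rewrite -P0 /J /tri_jet !fallE /cubic_weight; ring.
have [e1 e2 ehx edet] := jdet_on_cone Jxx Jxy Jyy PJ erefl.
set u := J 3 0 * s ^+ 2 + 2 * J 2 1 * s + J 1 2 in ehx edet.
have tj i j : J i j = X1 * falling a1 i * falling b1 j
   + X2 * falling a2 i * falling b2 j + X3 * falling a3 i * falling b3 j by [].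
(* If [u = 0] then the conic would be singular at [X] in the torus. *)
have u0 : u != 0.
  apply/eqP => u0.
  pose g a b := s ^+ 2 * al a b + 2 * s * be a b + ga a b.
  have S0 : g a1 b1 * X1 + g a2 b2 * X2 + g a3 b3 * X3 = 0.
    transitivity (s ^+ 2 * J 2 0 + 2 * s * J 1 1 + J 0 2).
      by rewrite !tj !fallE /g /al /be /ga; ring.
    by rewrite Jxx Jxy Jyy; ring.
  have Sa : a1 * (g a1 b1 * X1) + a2 * (g a2 b2 * X2) + a3 * (g a3 b3 * X3) = 0.
    transitivity (u + 2 * s ^+ 2 * J 2 0 + 2 * s * J 1 1).
      by rewrite /u !tj !fallE /g /al /be /ga; ring.
    by rewrite u0 Jxx Jxy; ring.
  have Sb : b1 * (g a1 b1 * X1) + b2 * (g a2 b2 * X2) + b3 * (g a3 b3 * X3) = 0.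
    transitivity (J 3 0 * s ^+ 3 + 3 * J 2 1 * s ^+ 2 + 3 * J 1 2 * s + J 0 3
       - s * u + 2 * s * J 1 1 + 2 * J 0 2).
      by rewrite /u !tj !fallE /g /al /be /ga; ring.
    by rewrite PJ u0 Jxy Jyy; ring.
  have adjV (G1 G2 G3 : R) : G1 + G2 + G3 = 0 -> a1 * G1 + a2 * G2 + a3 * G3 = 0 ->
      b1 * G1 + b2 * G2 + b3 * G3 = 0 -> [/\ G1 = 0, G2 = 0 & G3 = 0].
    move=> e e' e''; split; apply: (mulfI V0); rewrite mulr0.
    - transitivity ((a2 * b3 - a3 * b2) * (G1 + G2 + G3)
        + (b2 - b3) * (a1 * G1 + a2 * G2 + a3 * G3)
        + (a3 - a2) * (b1 * G1 + b2 * G2 + b3 * G3)); first by rewrite /affine_det; ring.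
      by rewrite e e' e''; ring.
    - transitivity ((a3 * b1 - a1 * b3) * (G1 + G2 + G3)
        + (b3 - b1) * (a1 * G1 + a2 * G2 + a3 * G3)
        + (a1 - a3) * (b1 * G1 + b2 * G2 + b3 * G3)); first by rewrite /affine_det; ring.
      by rewrite e e' e''; ring.
    - transitivity ((a1 * b2 - a2 * b1) * (G1 + G2 + G3)
        + (b1 - b2) * (a1 * G1 + a2 * G2 + a3 * G3)
        + (a2 - a1) * (b1 * G1 + b2 * G2 + b3 * G3)); first by rewrite /affine_det; ring.
      by rewrite e e' e''; ring.
  have [/eqP g1 /eqP g2 /eqP g3] := adjV _ _ _ S0 Sa Sb.
  move: g1 g2 g3; rewrite !mulf_eq0 (negPf X10) (negPf X20) (negPf X30) !orbF.
  have gE a b : g a b == 0 -> ga a b = - (s ^+ 2 * al a b + 2 * s * be a b).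
    by move=> /eqP g0; rewrite -[LHS]subr0 -g0 /g; ring.
  move=> /gE g1 /gE g2 /gE g3; case/eqP: D0.
  rewrite defD /conic_det g1 g2 g3.
  move: (al a1 b1) (al a2 b2) (al a3 b3) (be a1 b1) (be a2 b2) (be a3 b3) => *; ring.
(* The logarithmic vector field (s, 1) is tangent to the cone over the conic:
   at [X] it is [(M X + N X') / D]. *)
pose M := s * J 3 0 + J 2 1 + 2 * s * D; pose N := - u - (s ^+ 2 - s) * D.
have Jyyy : J 0 3 = - (J 3 0 * s ^+ 3 + 3 * J 2 1 * s ^+ 2 + 3 * J 1 2 * s).
  by rewrite -[LHS]subr0 -PJ; ring.
have [Y1 Y2 Y3] : [/\ (a1 * s + b1) * X1 * D - M * X1 - N * X1' = 0,
    (a2 * s + b2) * X2 * D - M * X2 - N * X2' = 0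
  & (a3 * s + b3) * X3 * D - M * X3 - N * X3' = 0].
  apply: adj.
  - transitivity (D * (s * (J 3 0 + 2 * J 2 0) + J 2 1)
      - M * (al a1 b1 * X1 + al a2 b2 * X2 + al a3 b3 * X3)
      - N * (al a1 b1 * X1' + al a2 b2 * X2' + al a3 b3 * X3')).
      by rewrite /M !tj !fallE /al; ring.
    by rewrite A0 A1 Jxx /M; ring.
  - transitivity (D * (s * (J 2 1 + J 1 1) + (J 1 2 + J 1 1))
      - M * (be a1 b1 * X1 + be a2 b2 * X2 + be a3 b3 * X3)
      - N * (be a1 b1 * X1' + be a2 b2 * X2' + be a3 b3 * X3')).
      by rewrite /M !tj !fallE /be; ring.
    by rewrite B0 B1 Jxy /M /N /u; ring.
  - transitivity (D * (s * J 1 2 + (J 0 3 + 2 * J 0 2))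
      - M * (ga a1 b1 * X1 + ga a2 b2 * X2 + ga a3 b3 * X3)
      - N * (ga a1 b1 * X1' + ga a2 b2 * X2' + ga a3 b3 * X3')).
      by rewrite /M !tj !fallE /ga; ring.
    by rewrite C0 C1 Jyy Jyyy /M /N /u; ring.
(* If N = 0, the three exponents satisfy D (a_i s + b_i) = M and are collinear. *)
have N0 : N != 0.
  apply/eqP => N0; case/eqP: V0; apply: (mulfI D0); rewrite mulr0.
  have bE a b X Y : X != 0 -> (a * s + b) * X * D - M * X - N * Y = 0 ->
      D * b = M - D * a * s.
    rewrite N0 => X0 e; apply: (mulfI X0); rewrite -[LHS]subr0 -e; ring.
  rewrite /affine_det; set v := LHS.
  have -> : v = (a2 - a1) * (D * b3 - D * b1) - (a3 - a1) * (D * b2 - D * b1).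
    by rewrite /v; ring.
  by rewrite (bE _ _ _ _ X10 Y1) (bE _ _ _ _ X20 Y2) (bE _ _ _ _ X30 Y3); ring.
(* The quartic form arises by differentiating the third-derivative form along the logarithmic vector
   field. Replacing that field by (M X + N X') / D kills the M term, as P(s) = 0, and leaves N
   P'(s). *)
have NP' : D * quartic_form J s - 3 * u ^+ 2 != 0.
  set v := (X in X != 0); set P' := (X in X != 0) in P'0.
  have -> : v = N * P'; last by rewrite mulf_neq0.
  have wJ : cubic_weight' a1 b1 s * X1 + cubic_weight' a2 b2 s * X2
      + cubic_weight' a3 b3 s * X3 = 3 * u.
    by rewrite /u !tj !fallE /cubic_weight'; ring.
  have wX : cubic_weight a1 b1 s * ((a1 * s + b1) * X1)
      + cubic_weight a2 b2 s * ((a2 * s + b2) * X2)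
      + cubic_weight a3 b3 s * ((a3 * s + b3) * X3)
      = quartic_form J s + 3 * (s ^+ 4 * J 3 0 + (2 * s ^+ 3 + s ^+ 2) * J 2 1
           + (s ^+ 2 + 2 * s) * J 1 2 + J 0 3).
    by rewrite /quartic_form !tj !fallE /cubic_weight; ring.
  have NY a b X Y : (a * s + b) * X * D - M * X - N * Y = 0 ->
      N * Y = (a * s + b) * X * D - M * X by move/eqP; rewrite subr_eq0 => /eqP.
  transitivity (N * (3 * u) + (cubic_weight a1 b1 s * (N * X1')
      + cubic_weight a2 b2 s * (N * X2') + cubic_weight a3 b3 s * (N * X3'))).
    transitivity (3 * u * N + D * (cubic_weight a1 b1 s * ((a1 * s + b1) * X1)
      + cubic_weight a2 b2 s * ((a2 * s + b2) * X2)
      + cubic_weight a3 b3 s * ((a3 * s + b3) * X3))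
      - M * (cubic_weight a1 b1 s * X1 + cubic_weight a2 b2 s * X2
      + cubic_weight a3 b3 s * X3)).
      rewrite wX P0 Jyyy /v /N /u; move: (quartic_form J s) => Q; ring.
    by rewrite (NY _ _ _ _ Y1) (NY _ _ _ _ Y2) (NY _ _ _ _ Y3); ring.
  by rewrite /P' wJ; ring.
have eJ : J 2 0 != 0 by rewrite Jxx.
split; [split|by []|by rewrite Jxy Jxx].
- by [].
- by [].
- by rewrite ehx mulf_neq0.
- by rewrite edet !mulf_neq0 // expf_neq0.
Qed.

End TrinomialJets.

(** * Simple real roots from sign changes on an arc *)

Section SimpleRoots.
Variable R : rcfType.
Implicit Types p q : {poly R}.

Lemma eq_poly_on_nat p q : (forall n : nat, p.[n%:R] = q.[n%:R]) -> p = q.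
Proof.
move=> pq; apply/eqP; rewrite -subr_eq0; apply/negPn/negP => nz.
pose s := [seq i%:R : R | i <- iota 0 (size (p - q))].
have us : uniq s by rewrite map_inj_uniq ?iota_uniq // => i j /eqP; rewrite eqr_nat => /eqP.
have rs : all (root (p - q)) s.
  by apply/allP => _ /mapP[i _ ->]; rewrite rootE hornerD hornerN pq subrr.
by have := max_poly_roots nz rs us; rewrite size_map size_iota ltnn.
Qed.

(* At a positive root [x], subtracting [j * p.[x] = 0] from [x * p^`().[x]] leaves
   only nonpositive terms [(i - j) p_i x^i]; the constant term makes it negative. *)
Lemma one_sign_change_simple_root p j :
  (forall i, (i < j)%N -> 0 <= p`_i) -> (forall i, (j <= i)%N -> p`_i <= 0) ->
  0 < p`_0 -> lead_coef p < 0 ->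
  exists2 x, 0 < x & p.[x] = 0 /\ p^`().[x] != 0.
Proof.
move=> pge ple p0 lp.
have [b pb] : exists b, forall x, b <= x -> p.[x] < 0.
  have [|b Hb] := @poly_pinfty_gt_lc _ (- p); first by rewrite lead_coefN oppr_gt0.
  exists b => x /Hb; rewrite lead_coefN hornerN lerN2 => /le_lt_trans; exact.
pose c := Num.max b 1.
have c0 : 0 <= c by rewrite le_max ler01 orbT.
have [x /andP[x0 _] /rootP px] : exists2 x, 0 <= x <= c & root (- p) x.
  apply: Num.Theory.poly_ivt => //; rewrite !hornerN oppr_le0 oppr_ge0.
  by rewrite horner_coef0 !ltW // pb // le_max lexx.
move: px => /eqP; rewrite hornerN oppr_eq0 => /eqP px.
have {x0}x0 : 0 < x.
  rewrite lt_neqAle x0 andbT; apply/eqP => x00.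
  by move: px p0; rewrite -x00 horner_coef0 => ->; rewrite ltxx.
exists x => //; split=> //.
have j0 : (0 < j)%N by rewrite lt0n; apply: contraTneq p0 => j0; rewrite -leNgt ple ?j0.
suff : x * p^`().[x] < 0 by apply: contraTneq => ->; rewrite mulr0 ltxx.
have sp : (0 < size p)%N.
  by rewrite lt0n size_poly_eq0; apply: contraTneq p0 => ->; rewrite coef0 ltxx.
have -> : x * p^`().[x] = \sum_(i < size p) p`_i * i%:R * x ^+ i.
  rewrite /deriv horner_poly mulr_sumr -(big_mkord predT (fun i => p`_i * i%:R * x ^+ i)).
  case: (size p) sp => // n _; rewrite big_nat_recl //= mulr0 mul0r add0r big_mkord.
  by apply: eq_bigr => i _; rewrite exprS -mulr_natr; ring.
have -> : \sum_(i < size p) p`_i * i%:R * x ^+ i =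
   \sum_(i < size p) p`_i * (i%:R - j%:R) * x ^+ i.
  have -> : \sum_(i < size p) p`_i * i%:R * x ^+ i =
      \sum_(i < size p) p`_i * i%:R * x ^+ i - j%:R * p.[x].
    by rewrite px mulr0 subr0.
  rewrite horner_coef mulr_sumr -sumrB; apply: eq_bigr => i _; ring.
case: (size p) sp => // n _; rewrite big_ord_recl /= expr0 mulr1 sub0r.
rewrite mulrN -oppr_gt0 opprD opprK ltr_wpDr ?mulr_gt0 ?ltr0n //.
rewrite oppr_ge0 sumr_le0 // => i _; rewrite pmulr_lle0 ?exprn_gt0 //.
have [ij|ji] := ltnP (lift ord0 i) j.
  by rewrite mulr_ge0_le0 ?pge // subr_le0 ler_nat ltnW.
by rewrite mulr_le0_ge0 ?ple // subr_ge0 ler_nat.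
Qed.

(** With e = A1 + B1 x and s the image of x, p'(x) = e^4 ((B0 - s B1) q'(s) + 5 B1 q(s)). So a
    double root of q at s would force p'(x) = 0. *)
Lemma mobius_simple_root p q (A0 A1 B0 B1 : R) :
  (size q <= 6)%N -> 0 <= A1 -> 0 <= B1 -> (0 < A1) || (0 < B1) ->
  (forall x : R, A1 + B1 * x != 0 ->
    p.[x] = (A1 + B1 * x) ^+ 5 * q.[(A0 + B0 * x) / (A1 + B1 * x)]) ->
  forall x : R, 0 < x -> p.[x] = 0 -> p^`().[x] != 0 ->
  q.[(A0 + B0 * x) / (A1 + B1 * x)] = 0 /\
  q^`().[(A0 + B0 * x) / (A1 + B1 * x)] != 0.
Proof.
move=> sq A10 B10 AB10 pq x x0 px p'x.
have den_gt0 y : 0 < y -> 0 < A1 + B1 * y.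
  move=> y0; case/orP: AB10 => h; first by rewrite ltr_pwDl // mulr_ge0 // ltW.
  by rewrite ltr_wpDl // mulr_gt0.
pose r := \sum_(i < 6) q`_i *: ((A0%:P + B0 *: 'X) ^+ i * (A1%:P + B1 *: 'X) ^+ (5 - i)).
have qE y : q.[y] = \sum_(i < 6) q`_i * y ^+ i by rewrite (horner_coef_wide _ sq).
have rE y : A1 + B1 * y != 0 ->
    r.[y] = (A1 + B1 * y) ^+ 5 * q.[(A0 + B0 * y) / (A1 + B1 * y)].
  move=> e0; rewrite qE mulr_sumr horner_sum; apply: eq_bigr => i _.
  rewrite hornerZ hornerM !horner_exp !(hornerD, hornerZ, hornerC, hornerX).
  have -> : (A1 + B1 * y) ^+ 5 = (A1 + B1 * y) ^+ i * (A1 + B1 * y) ^+ (5 - i).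
    by rewrite -exprD subnKC // -ltnS.
  by rewrite expr_div_n; field; rewrite expf_neq0.
(* A1 may be 0, so the hypothesis is available at positive integers only; the factor ['X] takes care
   of 0. *)
have pr : 'X * p = 'X * r.
  apply: eq_poly_on_nat => -[|n]; rewrite !hornerM !hornerX ?mul0r //.
  by have e0 : A1 + B1 * n.+1%:R != 0; [rewrite gt_eqF ?den_gt0 ?ltr0n|rewrite pq ?rE].
have {}pr : p = r by apply: (mulfI (negbT (polyX_eq0 R))).
have e0 : A1 + B1 * x != 0 by rewrite gt_eqF // den_gt0.
set e := A1 + B1 * x in e0 *; set s := (A0 + B0 * x) / e.
have q0 : q.[s] = 0.
  apply: (mulfI (expf_neq0 5 e0)); rewrite mulr0 -px pq //.
split=> //; apply: contraNneq p'x => q's.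
have -> : p^`().[x] = e ^+ 4 * ((B0 - s * B1) * q^`().[s] + 5 * B1 * q.[s]).
  have n_se : A0 + B0 * x = s * e by rewrite /s divfK.
  rewrite pr /r raddf_sum /= horner_sum qE.
  have -> : q^`().[s] = \sum_(i < 6) q`_i * (i%:R * s ^+ i.-1).
    have sq' : (size q^`() <= 5)%N by rewrite (leq_trans (size_poly _ _)) // -subn1 leq_subLR.
    rewrite (horner_coef_wide _ sq') [RHS]big_ord_recl /= mul0r mulr0 add0r.
    by apply: eq_bigr => i _; rewrite coef_deriv -[q`_i.+1 *+ _]mulr_natr mulrA.
  rewrite !mulr_sumr -big_split mulr_sumr; apply: eq_bigr => -[i Hi] _ /=.
  rewrite derivZ hornerZ derivM hornerD !hornerM !deriv_exp !derivD !derivC !derivZ !derivX.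
  rewrite !add0r !hornerMn !hornerM !horner_exp !hornerZ !hornerD !hornerZ !hornerC !hornerX.
  rewrite -/e n_se.
  by case: i Hi => [|[|[|[|[|[|//]]]]]] _; rewrite ?subSS ?subn0 ?subnn /=; ring.
by rewrite q's q0 !mulr0 addr0 mulr0.
Qed.

End SimpleRoots.

Section QuinticPoly.
Variable R : rcfType.

Definition conic_poly (a b a' b' : R) : {poly R} :=
  (a * (a - 1) * (a' * b') - a' * (a' - 1) * (a * b)) *: 'X^2
  + (a * (a - 1) * (b' * (b' - 1)) - a' * (a' - 1) * (b * (b - 1))) *: 'X
  + (a * b * (b' * (b' - 1)) - a' * b' * (b * (b - 1)))%:P.

Definition weight_poly (a b : R) : {poly R} :=
  (a * (a - 1) * (a - 2)) *: 'X^3 + (3 * (a * (a - 1)) * b) *: 'X^2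
  + (3 * a * (b * (b - 1))) *: 'X + (b * (b - 1) * (b - 2))%:P.

Definition quintic_poly (a1 b1 a2 b2 a3 b3 : R) :=
  weight_poly a1 b1 * conic_poly a2 b2 a3 b3
  + weight_poly a2 b2 * conic_poly a3 b3 a1 b1
  + weight_poly a3 b3 * conic_poly a1 b1 a2 b2.

Lemma horner_conic_poly a b a' b' s :
  (conic_poly a b a' b').[s] = conic_coord a b a' b' s.
Proof. by rewrite /conic_poly !(hornerD, hornerZ, hornerC, hornerXn, hornerX). Qed.

Lemma horner_weight_poly a b s : (weight_poly a b).[s] = cubic_weight a b s.
Proof. by rewrite /weight_poly !(hornerD, hornerZ, hornerC, hornerXn, hornerX). Qed.

Lemma horner_deriv_conic_poly a b a' b' s :
  (conic_poly a b a' b')^`().[s] = conic_coord' a b a' b' s.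
Proof.
rewrite /conic_poly !derivD !derivZ derivC derivXn derivX.
rewrite !(hornerD, hornerZ, hornerC, hornerMn, hornerXn, hornerX) /conic_coord'.
by ring.
Qed.

Lemma horner_deriv_weight_poly a b s : (weight_poly a b)^`().[s] = cubic_weight' a b s.
Proof.
rewrite /weight_poly !derivD !derivZ derivC !derivXn derivX.
rewrite !(hornerD, hornerZ, hornerC, hornerMn, hornerXn, hornerX) /cubic_weight'.
by ring.
Qed.

Lemma horner_quintic_poly a1 b1 a2 b2 a3 b3 s :
  (quintic_poly a1 b1 a2 b2 a3 b3).[s] = tri_quintic a1 b1 a2 b2 a3 b3 s.
Proof. by rewrite !hornerD !hornerM !horner_weight_poly !horner_conic_poly. Qed.

Lemma horner_deriv_quintic_poly a1 b1 a2 b2 a3 b3 s :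
  (quintic_poly a1 b1 a2 b2 a3 b3)^`().[s] = tri_quintic' a1 b1 a2 b2 a3 b3 s.
Proof.
rewrite !derivD !derivM !hornerD !hornerM !horner_weight_poly !horner_conic_poly.
rewrite !horner_deriv_weight_poly !horner_deriv_conic_poly /tri_quintic'; ring.
Qed.

Lemma size_quintic_poly a1 b1 a2 b2 a3 b3 :
  (size (quintic_poly a1 b1 a2 b2 a3 b3) <= 6)%N.
Proof.
have szZ c n m : (n < m)%N -> (size (c *: 'X^n : {poly R}) <= m)%N.
  by move=> nm; rewrite (leq_trans (size_scale_leq _ _)) // size_polyXn.
have szX c m : (1 < m)%N -> (size (c *: 'X : {poly R}) <= m)%N.
  by move=> m1; rewrite (leq_trans (size_scale_leq _ _)) // size_polyX.
have szC c m : (0 < m)%N -> (size (c%:P : {poly R}) <= m)%N.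
  by move=> m0; rewrite (leq_trans (size_polyC_leq1 _)).
have szD (p q : {poly R}) m : (size p <= m)%N -> (size q <= m)%N -> (size (p + q)%R <= m)%N.
  by move=> pm qm; rewrite (leq_trans (size_polyD _ _)) // geq_max pm.
have szc a b a' b' : (size (conic_poly a b a' b') <= 3)%N.
  by rewrite /conic_poly !(szD, szZ, szX, szC).
have szw a b : (size (weight_poly a b) <= 4)%N.
  by rewrite /weight_poly !(szD, szZ, szX, szC).
have szM (p q : {poly R}) : (size p <= 4)%N -> (size q <= 3)%N -> (size (p * q)%R <= 6)%N.
  move=> p4 q3; rewrite (leq_trans (size_polyMleq _ _)) // -subn1 leq_subLR.
  exact: leq_add p4 q3.
rewrite /quintic_poly; apply: (szD); [apply: (szD)|]; apply: szM; rewrite ?szw ?szc //.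
Qed.

(** A real quadratic with negative discriminant has no real root. *)
Lemma conic_coord_neq0 (a b a' b' s : R) :
  (a * (a - 1) * (b' * (b' - 1)) - a' * (a' - 1) * (b * (b - 1))) ^+ 2
  - 4 * (a * (a - 1) * (a' * b') - a' * (a' - 1) * (a * b))
      * (a * b * (b' * (b' - 1)) - a' * b' * (b * (b - 1))) < 0 ->
  conic_coord a b a' b' s != 0.
Proof.
rewrite /conic_coord; set c2 := _ - _ * (a * b); set c1 := _ - _ * (b * (b - 1)).
set c0 := _ - _ * (b * (b - 1)) => disc; apply/eqP => e.
suff : 0 <= c1 ^+ 2 - 4 * c2 * c0 by rewrite leNgt disc.
have -> : c1 ^+ 2 - 4 * c2 * c0 =
    (2 * c2 * s + c1) ^+ 2 - 4 * c2 * (c2 * s ^+ 2 + c1 * s + c0) by ring.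
by rewrite e mulr0 subr0 sqr_ge0.
Qed.

(** Homogenized in s = n / e: substituting an arc for (n, e) stays polynomial, so [ring] can verify
    the coefficient lists below. *)
Definition cubic_form (a b n e : R) :=
  a * (a - 1) * (a - 2) * n ^+ 3 + 3 * (a * (a - 1)) * b * n ^+ 2 * e
  + 3 * a * (b * (b - 1)) * n * e ^+ 2 + b * (b - 1) * (b - 2) * e ^+ 3.

Definition conic_form (a b a' b' n e : R) :=
  (a * (a - 1) * (a' * b') - a' * (a' - 1) * (a * b)) * n ^+ 2
  + (a * (a - 1) * (b' * (b' - 1)) - a' * (a' - 1) * (b * (b - 1))) * n * e
  + (a * b * (b' * (b' - 1)) - a' * b' * (b * (b - 1))) * e ^+ 2.

Definition quintic_form (a1 b1 a2 b2 a3 b3 n e : R) :=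
  cubic_form a1 b1 n e * conic_form a2 b2 a3 b3 n e
  + cubic_form a2 b2 n e * conic_form a3 b3 a1 b1 n e
  + cubic_form a3 b3 n e * conic_form a1 b1 a2 b2 n e.

Lemma quintic_formE a1 b1 a2 b2 a3 b3 n e : e != 0 ->
  quintic_form a1 b1 a2 b2 a3 b3 n e = e ^+ 5 * tri_quintic a1 b1 a2 b2 a3 b3 (n / e).
Proof.
move=> e0.
have cE a b : cubic_form a b n e = e ^+ 3 * cubic_weight a b (n / e).
  by rewrite /cubic_form /cubic_weight; field.
have kE a b a' b' : conic_form a b a' b' n e = e ^+ 2 * conic_coord a b a' b' (n / e).
  by rewrite /conic_form /conic_coord; field.
by rewrite /quintic_form !cE !kE /tri_quintic; ring.
Qed.

(** For x > 0 the slope runs over the arc from A0 / A1 to B0 / B1, and [r] lists the coefficients of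
    the quintic along it, with the sign change at index [j]. The sign of the last entry ensures that
    [Poly r] has exactly these coefficients. *)
Lemma arc_simple_root (a1 b1 a2 b2 a3 b3 A0 A1 B0 B1 : R) (r : seq R) j :
  (forall x, (Poly r).[x]
     = quintic_form a1 b1 a2 b2 a3 b3 (A0 + B0 * x) (A1 + B1 * x)) ->
  0 <= A1 -> 0 <= B1 -> (0 < A1) || (0 < B1) ->
  (forall i, (i < j)%N -> 0 <= r`_i) -> (forall i, (j <= i)%N -> r`_i <= 0) ->
  0 < r`_0 -> last 0 r < 0 ->
  exists2 x, 0 < x & tri_quintic a1 b1 a2 b2 a3 b3 ((A0 + B0 * x) / (A1 + B1 * x)) = 0
    /\ tri_quintic' a1 b1 a2 b2 a3 b3 ((A0 + B0 * x) / (A1 + B1 * x)) != 0.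
Proof.
move=> rE A10 B10 AB10 rge rle r0 rl.
have PE : Poly r = r :> seq R.
  by rewrite (PolyK (c := 0)) // lt_eqF // ; case: (r) r0 rl => //=; rewrite ltxx.
have [||||x x0 [px p'x]] := @one_sign_change_simple_root R (Poly r) j.
- by rewrite PE.
- by rewrite PE.
- by rewrite PE.
- by rewrite lead_coefE PE nth_last.
exists x => //; rewrite -horner_quintic_poly -horner_deriv_quintic_poly.
apply: mobius_simple_root (px) (p'x) => //; first exact: size_quintic_poly.
by move=> y e0; rewrite rE quintic_formE // horner_quintic_poly.
Qed.

End QuinticPoly.

(** * Roots of the quintic for the three families of triangles, uniformly in k and l *)

Section SlopesOfTau.
Variable R : rcfType.
Variables k l : R.
Hypotheses (k2 : 2 <= k) (l2 : 2 <= l).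

Definition simple_slope (a1 b1 a2 b2 a3 b3 s : R) : Prop :=
  [/\ tri_quintic a1 b1 a2 b2 a3 b3 s = 0, tri_quintic' a1 b1 a2 b2 a3 b3 s != 0,
      conic_coord a2 b2 a3 b3 s != 0, conic_coord a3 b3 a1 b1 s != 0
    & conic_coord a1 b1 a2 b2 s != 0].

Let k0 : 0 < k. Proof. exact: lt_le_trans k2. Qed.
Let l0 : 0 < l. Proof. exact: lt_le_trans l2. Qed.
Let k1 : 0 < k + 1. Proof. exact: addr_gt0. Qed.
Let l1 : 0 < l + 1. Proof. exact: addr_gt0. Qed.
Let km1 : 0 < k - 1. Proof. by rewrite subr_gt0 (lt_le_trans _ k2) // ltr1n. Qed.
Let lm1 : 0 < l - 1. Proof. by rewrite subr_gt0 (lt_le_trans _ l2) // ltr1n. Qed.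
Let kl : 0 < k + l. Proof. exact: addr_gt0. Qed.
Let kl1 : 0 < k + l + 1. Proof. exact: addr_gt0. Qed.
Let kl2 : 0 < k + l + 2. Proof. exact: addr_gt0. Qed.
Let kkl : 0 < 2 * k + l. Proof. by rewrite addr_gt0 // mulr_gt0. Qed.
Let kkl1 : 0 < 2 * k + l + 1. Proof. exact: addr_gt0. Qed.
Let kkl2 : 0 < 2 * k + l + 2. Proof. exact: addr_gt0. Qed.

Let neg_of (y x : R) : x = - y -> 0 < y -> x < 0.
Proof. by move=> ->; rewrite oppr_lt0. Qed.

Ltac pos := repeat first [done | apply: mulr_gt0 | apply: exprn_gt0 | apply: addr_gt0].

(** Here a rational root is explicit: k s + l = 0, the direction in which x^k y^l is stationary at
    (1, 1). *)
Lemma Delta1_slope : simple_slope k l (k + 1) l k (l + 1) (- l / k).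
Proof.
have kn0 : k != 0 by rewrite gt_eqF.
split.
- rewrite /tri_quintic /cubic_weight /conic_coord; field; exact: kn0.
- have -> : tri_quintic' k l (k + 1) l k (l + 1) (- l / k)
      = - (3 * k ^+ 3 * l ^+ 2 * (k + l) ^+ 2) / k ^+ 4.
    by rewrite /tri_quintic' /cubic_weight /conic_coord /cubic_weight' /conic_coord'; field.
  by rewrite mulf_neq0 ?invr_eq0 ?expf_neq0 // oppr_eq0 gt_eqF //; pos.
(* Here and below [y] is minus the discriminant, factored. *)
- by apply/conic_coord_neq0/(neg_of (y := 4 * k * l * (k + l) ^+ 2 * (k + l + 1)));
    [ring|pos].
- by apply/conic_coord_neq0/(neg_of (y := 4 * k ^+ 2 * l * (k - 1) * (k + l)));
    [ring|pos].
- by apply/conic_coord_neq0/(neg_of (y := 4 * k * l ^+ 2 * (l - 1) * (k + l)));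
    [ring|pos].
Qed.

(** A discriminant factor shared by the second and third families; its two negative terms are
    absorbed using l > 1. *)
Let mix : 0 < 4 * k ^+ 2 * l - k ^+ 2 + 4 * k * l ^+ 2 + 3 * k * l - k
   + l ^+ 3 + 2 * l ^+ 2.
Proof.
have -> : 4 * k ^+ 2 * l - k ^+ 2 + 4 * k * l ^+ 2 + 3 * k * l - k + l ^+ 3 + 2 * l ^+ 2
  = 3 * k ^+ 2 * l + k ^+ 2 * (l - 1) + 4 * k * l ^+ 2 + 2 * k * l + k * (l - 1)
    + l ^+ 3 + 2 * l ^+ 2 by ring.
by pos.
Qed.

(** The arc goes from -l / k down to -(l + 1) / k. On it the coefficients of x^4 and x^5 are the
    negative ones; the sign of the x^3 coefficient is the only one that needs an argument,
    [r3_gt0]. *)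
Lemma Delta2_slope : exists s, simple_slope (k + 1) l k (l + 1) k (l + 2) s.
Proof.
have r3_gt0 : 0 < k * (l - 1) + k * l + l * (l - 1) - 2.
  have -> : k * (l - 1) + k * l + l * (l - 1) - 2 = (k - 1) * (l - 1) + (l - 1)
    + k * l + (l - 2) * (l + 1) by ring.
  by rewrite ltr_wpDr ?mulr_ge0 ?subr_ge0 ?(ltW l1) //; pos.
pose r := [:: 2 * k ^+ 3 * l * (k + l) ^+ 2 * (2 * k + l);
  k ^+ 3 * l * (k + l) * (2 * k + l) * (7 * k + 7 * l + 4);
  8 * k ^+ 3 * l * (k + l) * (k + l + 1) * (2 * k + l);
  2 * k ^+ 3 * (k + l) * (k + l + 1) * (k * (l - 1) + k * l + l * (l - 1) - 2);
  - (2 * k ^+ 3 * (l + 1) * (k + l + 1) ^+ 2 * (2 * k + l + 1));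
  - (k ^+ 3 * (l + 1) * (k + l + 1) ^+ 2 * (2 * k + l + 1))].
have [||||||||x x0 [P0 P'0]] := @arc_simple_root R (k + 1) l k (l + 1) k (l + 2)
    (- l) k (- l - 1) k r 4.
- move=> x; rewrite horner_Poly /= /quintic_form /cubic_form /conic_form; ring.
- exact: ltW.
- exact: ltW.
- by rewrite k0.
- by move=> [|[|[|[|//]]]] _; rewrite ltW //=; pos.
- move=> [|[|[|[|[|[|i]]]]]] //= _; rewrite ?oppr_le0 ?nth_nil // ltW //; pos.
- by rewrite /=; pos.
- by rewrite /= oppr_lt0; pos.
set s := _ / _ in P0 P'0; exists s; split=> //.
- by apply/conic_coord_neq0/(neg_of (y := 4 * k ^+ 2 * (l + 1) * (k - 1) * (k + l + 1)));
    [ring|pos].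
- apply/conic_coord_neq0/(neg_of (y := 4 * k * (k + l + 1) * (4 * k ^+ 2 * l - k ^+ 2
    + 4 * k * l ^+ 2 + 3 * k * l - k + l ^+ 3 + 2 * l ^+ 2))); [ring|].
  by pos; exact: mix.
- by apply/conic_coord_neq0/(neg_of (y := 4 * k * l * (k + l) ^+ 2 * (k + l + 1)));
    [ring|pos].
Qed.

Lemma Delta3_conic_neq0 s :
  [/\ conic_coord k (l + 2) (k + 1) (l + 1) s != 0,
      conic_coord (k + 1) (l + 1) (k + 1) l s != 0
    & conic_coord (k + 1) l k (l + 2) s != 0].
Proof.
split.
- by apply/conic_coord_neq0/(neg_of (y := 4 * k * (l + 1) * (k + l + 1) ^+ 2 * (k + l + 2)));
    [ring|pos].
- by apply/conic_coord_neq0/(neg_of (y := 4 * k * l * (k + 1) ^+ 2 * (k + l + 1)));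
    [ring|pos].
- apply/conic_coord_neq0/(neg_of (y := 4 * k * (k + l + 1) * (4 * k ^+ 2 * l - k ^+ 2
    + 4 * k * l ^+ 2 + 3 * k * l - k + l ^+ 3 + 2 * l ^+ 2))); [ring|].
  by pos; exact: mix.
Qed.

Lemma Delta3_slopes : exists s1 s2 s3, [/\ s1 < s2, s2 < s3,
  simple_slope (k + 1) l k (l + 2) (k + 1) (l + 1) s1,
  simple_slope (k + 1) l k (l + 2) (k + 1) (l + 1) s2
  & simple_slope (k + 1) l k (l + 2) (k + 1) (l + 1) s3].
Proof.
pose r1 := [:: k ^+ 2 * (l + 1) * (k + l + 1) ^+ 3 * (2 * k + l + 1);
  k ^+ 2 * (l + 1) * (k + l + 1) ^+ 2 * (2 * k + l + 1) * (3 * k + 5);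
  2 * k ^+ 2 * (k + 1) * (k + l + 1)
    * (3 * k ^+ 2 + 10 * k * l + 10 * k + 5 * l ^+ 2 + 10 * l + 5);
  2 * k ^+ 2 * (k + 1) * (k + l + 1) ^+ 2 * (k + 5);
  k ^+ 2 * (k + 1) * (k + l + 1) * (k + 5);
  - (k ^+ 2 * (k + 1) ^+ 2 * (k - 1))].
pose r2 := [:: k ^+ 2 * (l + 1) * (k + l + 1) ^+ 3 * (2 * k + l + 1);
  2 * k ^+ 2 * (l + 1) * (k + l + 1) ^+ 3 * (2 * k + l + 1);
  - (2 * k * (k + 1) * (k + l + 1) ^+ 3 * (k * (l - 1) + k * l + l ^+ 2 + 2 * l + 1));
  - (8 * k * l * (k + 1) * (k + l + 1) ^+ 3 * (2 * k + l + 2));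
  - (l * (k + 1) * (k + l + 1) ^+ 3 * (2 * k + l + 2) * (7 * k + 3));
  - (2 * l * (k + 1) ^+ 2 * (k + l + 1) ^+ 3 * (2 * k + l + 2))].
pose r3 := [:: (k + l) * (k + l + 1) ^+ 3 * (k + l + 2);
  2 * (k + l) * (k + l + 1) ^+ 3 * (k + l + 2);
  - (2 * (k + 1) * (k + l + 1) ^+ 3 * (k * (k - 1) + 2 * k * l + l ^+ 2 + 2 * l));
  - (8 * l * (k + 1) * (k + l + 1) ^+ 3 * (2 * k + l + 2));
  - (l * (k + 1) * (k + l + 1) ^+ 3 * (2 * k + l + 2) * (3 * k + 7));
  - (2 * l * (k + 1) ^+ 2 * (k + l + 1) ^+ 3 * (2 * k + l + 2))].
have [||||||||x x0 [Px P'x]] := @arc_simple_root R (k + 1) l k (l + 2) (k + 1) (l + 1)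
    (- (l + 1)) k (- 1) 0 r1 5.
- move=> x; rewrite horner_Poly /= /quintic_form /cubic_form /conic_form; ring.
- exact: ltW.
- by [].
- by rewrite k0.
- move=> [|[|[|[|[|//]]]]] _; rewrite ltW //=; pos.
- move=> [|[|[|[|[|[|i]]]]]] //= _; rewrite ?oppr_le0 ?nth_nil // ltW //; pos.
- by rewrite /=; pos.
- by rewrite /= oppr_lt0; pos.
have [||||||||y y0 [Py P'y]] := @arc_simple_root R (k + 1) l k (l + 2) (k + 1) (l + 1)
    (- (l + 1)) k (- l) (k + 1) r2 2.
- move=> y; rewrite horner_Poly /= /quintic_form /cubic_form /conic_form; ring.
- exact: ltW.
- exact: ltW.
- by rewrite k0.
- move=> [|[|//]] _; rewrite ltW //=; pos.
- move=> [|[|[|[|[|[|i]]]]]] //= _; rewrite ?oppr_le0 ?nth_nil // ltW //;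
    pos.
- by rewrite /=; pos.
- by rewrite /= oppr_lt0; pos.
have [||||||||z z0 [Pz P'z]] := @arc_simple_root R (k + 1) l k (l + 2) (k + 1) (l + 1)
    1 1 (- l) (k + 1) r3 2.
- move=> z; rewrite horner_Poly /= /quintic_form /cubic_form /conic_form; ring.
- by [].
- exact: ltW.
- by rewrite ltr01.
- move=> [|[|//]] _; rewrite ltW //=; pos.
- move=> [|[|[|[|[|[|i]]]]]] //= _; rewrite ?oppr_le0 ?nth_nil // ltW //;
    pos.
- by rewrite /=; pos.
- by rewrite /= oppr_lt0; pos.
exists ((- (l + 1) + -1 * x) / (k + 0 * x)), ((- (l + 1) + - l * y) / (k + (k + 1) * y)),
  ((1 + - l * z) / (1 + (k + 1) * z)).
have ny : 0 < k + (k + 1) * y by rewrite addr_gt0 // mulr_gt0.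
have nz : 0 < 1 + (k + 1) * z by rewrite addr_gt0 // mulr_gt0.
split.
- rewrite mul0r addr0 ltr_pdivrMr // mulrAC ltr_pdivlMr // -subr_gt0.
  have -> : (- (l + 1) + - l * y) * k - (- (l + 1) + -1 * x) * (k + (k + 1) * y)
    = (k + l + 1) * y + x * (k + (k + 1) * y) by ring.
  by rewrite addr_gt0 // mulr_gt0.
- rewrite ltr_pdivrMr // mulrAC ltr_pdivlMr // -subr_gt0.
  have -> : (1 + - l * z) * (k + (k + 1) * y) - (- (l + 1) + - l * y) * (1 + (k + 1) * z)
    = (k + l + 1) * (1 + y + z) by ring.
  by rewrite mulr_gt0 // !addr_gt0.
- by have [? ? ?] := Delta3_conic_neq0 ((- (l + 1) + -1 * x) / (k + 0 * x)).
- by have [? ? ?] := Delta3_conic_neq0 ((- (l + 1) + - l * y) / (k + (k + 1) * y)).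
- by have [? ? ?] := Delta3_conic_neq0 ((1 + - l * z) / (1 + (k + 1) * z)).
Qed.

Lemma Delta1_dets : conic_det k l (k + 1) l k (l + 1) != 0
  /\ affine_det k l (k + 1) l k (l + 1) != 0.
Proof.
split; last by have -> : affine_det k l (k + 1) l k (l + 1) = 1;
  [rewrite /affine_det; ring | rewrite oner_eq0].
rewrite lt_eqF //; apply: (neg_of (y := 2 * k * l * (k + l))); last by pos.
by rewrite /conic_det; ring.
Qed.

Lemma Delta2_dets : conic_det (k + 1) l k (l + 1) k (l + 2) != 0
  /\ affine_det (k + 1) l k (l + 1) k (l + 2) != 0.
Proof.
split; last by have -> : affine_det (k + 1) l k (l + 1) k (l + 2) = - 1;
  [rewrite /affine_det; ring | rewrite oppr_eq0 oner_eq0].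
have -> : conic_det (k + 1) l k (l + 1) k (l + 2) = 2 * k * (k + l) * (k + l + 1).
  by rewrite /conic_det; ring.
by rewrite gt_eqF //; pos.
Qed.

Lemma Delta3_dets : conic_det (k + 1) l k (l + 2) (k + 1) (l + 1) != 0
  /\ affine_det (k + 1) l k (l + 2) (k + 1) (l + 1) != 0.
Proof.
split; last by have -> : affine_det (k + 1) l k (l + 2) (k + 1) (l + 1) = - 1;
  [rewrite /affine_det; ring | rewrite oppr_eq0 oner_eq0].
rewrite lt_eqF //; apply: (neg_of (y := 2 * k * (k + 1) * (k + l + 1))); last by pos.
by rewrite /conic_det; ring.
Qed.

End SlopesOfTau.

(** * Persistence of nondegenerate zeros *)

Section LipschitzIVT.
Variable R : realType.

(** The zero is c, the supremum of the points with f <= 0. If f(c) > 0, the Lipschitz bound excludes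
    such points within f(c) / K below c; if f(c) < 0, it produces one above c. *)
Lemma lipschitz_ivt (f : R -> R) (a b K : R) : a <= b -> 0 < K ->
  (forall x y, a <= x <= b -> a <= y <= b -> `|f x - f y| <= K * `|x - y|) ->
  f a <= 0 -> 0 <= f b -> exists2 x, a <= x <= b & f x = 0.
Proof.
move=> ab K0 lip fa fb.
pose S := [set x | a <= x <= b /\ f x <= 0].
have Sa : S a by split; rewrite ?lexx.
have ubS : ubound S b by move=> x [/andP[]].
have supS : has_sup S by split; [exists a|exists b].
have ac : a <= sup S by apply: sup_upper_bound.
have cb : sup S <= b by apply: ge_sup => //; exists a.
have c_ab : a <= sup S <= b by rewrite ac.
exists (sup S) => //; apply/eqP; rewrite eq_le; apply/andP; split.
  rewrite leNgt; apply/negP => fc0.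
  have e0 : 0 < f (sup S) / K by rewrite divr_gt0.
  have [x [xab fx] xc] := sup_adherent e0 supS.
  have xS : x <= sup S by apply: sup_upper_bound.
  have := lip _ _ c_ab xab; rewrite (ger0_norm (x := sup S - x)) ?subr_ge0 //.
  rewrite leNgt => /negP; apply; rewrite (lt_le_trans (y := f (sup S))) //.
    by rewrite mulrC -ltr_pdivlMr // ltrBlDr -ltrBlDl.
  by rewrite (le_trans _ (ler_norm _)) // lerDl oppr_ge0.
rewrite leNgt; apply/negP => fc0.
have [cb'|bc] := ltP (sup S) b; last first.
  have e : sup S = b by apply/le_anti; rewrite cb bc.
  by move: fc0; rewrite e ltNge fb.
pose x := Num.min b (sup S - f (sup S) / K).
have cx : sup S < x by rewrite lt_min cb' ltrDl oppr_gt0 pmulr_llt0 ?invr_gt0.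
have xab : a <= x <= b by rewrite (le_trans ac (ltW cx)) ge_min lexx.
suff Sx : S x by have := sup_upper_bound supS Sx; rewrite leNgt cx.
split=> //; have := lip _ _ xab c_ab.
rewrite (gtr0_norm (x := x - _)) ?subr_gt0 // => /(le_trans (ler_norm _)).
rewrite lerBlDr => /le_trans; apply.
have : x - sup S <= - (f (sup S) / K) by rewrite lerBlDl ge_min lexx orbT.
by rewrite -mulNr ler_pdivlMr // mulrC -lerBrDr sub0r.
Qed.

End LipschitzIVT.

Section Perturbation.
Variable R : realType.
Implicit Types (F : R -> R -> R -> R) (G : R -> R -> R -> R -> R -> R).

Definition near_base (d t x y : R) := [&& `|t| <= d, `|x - 1| <= d & `|y - 1| <= d].

(** Continuity at the base point (0, 1, 1) only, but with a linear modulus, so that sums and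
    products have explicit constants. *)
Definition lip_at F (v : R) := exists2 K : R, 0 <= K &
  forall d t x y, d <= 1 -> near_base d t x y -> `|F t x y - v| <= K * d.

Definition lip_at2 G (v : R) := exists2 K : R, 0 <= K &
  forall d t x y x' y', d <= 1 -> near_base d t x y -> near_base d t x' y' ->
    `|G t x y x' y' - v| <= K * d.

Lemma near_base_ge0 d t x y : near_base d t x y -> 0 <= d.
Proof. by case/and3P => /(le_trans (normr_ge0 _)). Qed.

Lemma lip_mul_bound (d f g v w K L : R) : 0 <= d <= 1 -> 0 <= K -> 0 <= L ->
  `|f - v| <= K * d -> `|g - w| <= L * d ->
  `|f * g - v * w| <= (K * (`|w| + L) + `|v| * L) * d.
Proof.
move=> /andP[d0 d1] K0 L0 fv gw.
have -> : f * g - v * w = (f - v) * g + v * (g - w) by ring.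
rewrite (le_trans (ler_normD _ _)) // !normrM mulrDl lerD //.
  rewrite [_ * d]mulrAC ler_pM // -[g](subrK w) addrC (le_trans (ler_normD _ _)) //.
  by rewrite lerD2l (le_trans gw) // ler_piMr.
by rewrite -mulrA ler_wpM2l.
Qed.

Lemma lip_at2_cst v : lip_at2 (fun _ _ _ _ _ => v) v.
Proof. by exists 0 => // *; rewrite subrr normr0 mul0r. Qed.

Lemma lip_at2D G1 G2 v1 v2 : lip_at2 G1 v1 -> lip_at2 G2 v2 ->
  lip_at2 (fun t x y x' y' => G1 t x y x' y' + G2 t x y x' y') (v1 + v2).
Proof.
move=> [K K0 GK] [L L0 GL]; exists (K + L); first exact: addr_ge0.
move=> d t x y x' y' d1 nb nb'.
rewrite opprD addrACA (le_trans (ler_normD _ _)) // mulrDl.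
by rewrite lerD ?GK ?GL.
Qed.

Lemma lip_at2M G1 G2 v1 v2 : lip_at2 G1 v1 -> lip_at2 G2 v2 ->
  lip_at2 (fun t x y x' y' => G1 t x y x' y' * G2 t x y x' y') (v1 * v2).
Proof.
move=> [K K0 GK] [L L0 GL]; exists (K * (`|v2| + L) + `|v1| * L).
  by rewrite addr_ge0 ?mulr_ge0 ?addr_ge0.
move=> d t x y x' y' d1 nb nb'.
by apply: lip_mul_bound; rewrite ?GK ?GL // (near_base_ge0 nb).
Qed.

Lemma lip_at2_fst F v : lip_at F v -> lip_at2 (fun t x y _ _ => F t x y) v.
Proof. by move=> [K K0 FK]; exists K => // d t x y x' y' d1 nb _; apply: FK. Qed.

Lemma lip_at2_snd F v : lip_at F v -> lip_at2 (fun t _ _ x y => F t x y) v.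
Proof. by move=> [K K0 FK]; exists K => // d t x y x' y' d1 _; apply: FK. Qed.

Lemma lip_at2_diag G v : lip_at2 G v -> lip_at (fun t x y => G t x y x y) v.
Proof. by move=> [K K0 GK]; exists K => // d t x y d1 nb; apply: GK. Qed.

(* Hadamard quotients: strict differentiability in (x, y), uniform in t. *)
Record diff_at F (v a b : R) : Prop := DiffAt {
  diff_at_lip : lip_at F v;
  diff_at_quot : exists G1 G2, [/\ lip_at2 G1 a, lip_at2 G2 b
    & forall t x y x' y', F t x y - F t x' y'
        = (x - x') * G1 t x y x' y' + (y - y') * G2 t x y x' y'] }.

Lemma diff_at_eq F v a b F' v' a' b' : diff_at F v a b ->
  (forall t x y, F t x y = F' t x y) -> v = v' -> a = a' -> b = b' ->
  diff_at F' v' a' b'.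
Proof.
move=> [[K K0 FK] [G1 [G2 [l1 l2 FG]]]] FF' <- <- <-; split.
  by exists K => // d t x y d1 nb; rewrite -FF' FK.
by exists G1, G2; split=> // t x y x' y'; rewrite -!FF'.
Qed.

Lemma diff_at_x : diff_at (fun _ x _ => x) 1 1 0.
Proof.
split; first by exists 1 => // d t x y _ /and3P[_ ? _]; rewrite mul1r.
exists (fun _ _ _ _ _ => 1), (fun _ _ _ _ _ => 0).
by split; [exact: lip_at2_cst|exact: lip_at2_cst|move=> *; ring].
Qed.

Lemma diff_at_y : diff_at (fun _ _ y => y) 1 0 1.
Proof.
split; first by exists 1 => // d t x y _ /and3P[_ _ ?]; rewrite mul1r.
exists (fun _ _ _ _ _ => 0), (fun _ _ _ _ _ => 1).
by split; [exact: lip_at2_cst|exact: lip_at2_cst|move=> *; ring].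
Qed.

(** The quotients compare points with the same t, so t counts as a constant. *)
Lemma diff_at_t : diff_at (fun t _ _ => t) 0 0 0.
Proof.
split; first by exists 1 => // d t x y _ /and3P[? _ _]; rewrite mul1r subr0.
exists (fun _ _ _ _ _ => 0), (fun _ _ _ _ _ => 0).
by split; [exact: lip_at2_cst|exact: lip_at2_cst|move=> *; ring].
Qed.

Lemma diff_at_cst c : diff_at (fun _ _ _ => c) c 0 0.
Proof.
split; first by exists 0 => // *; rewrite subrr normr0 mul0r.
exists (fun _ _ _ _ _ => 0), (fun _ _ _ _ _ => 0).
by split; [exact: lip_at2_cst|exact: lip_at2_cst|move=> *; ring].
Qed.

Lemma diff_atD F F' v a b v' a' b' : diff_at F v a b -> diff_at F' v' a' b' ->
  diff_at (fun t x y => F t x y + F' t x y) (v + v') (a + a') (b + b').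
Proof.
move=> [l [G1 [G2 [l1 l2 FG]]]] [l' [G1' [G2' [l1' l2' FG']]]]; split.
  exact: lip_at2_diag (lip_at2D (lip_at2_fst l) (lip_at2_fst l')).
exists (fun t x y x' y' => G1 t x y x' y' + G1' t x y x' y').
exists (fun t x y x' y' => G2 t x y x' y' + G2' t x y x' y').
split; [exact: lip_at2D|exact: lip_at2D|] => t x y x' y'.
by rewrite opprD addrACA FG FG'; ring.
Qed.

Lemma diff_atM F F' v a b v' a' b' : diff_at F v a b -> diff_at F' v' a' b' ->
  diff_at (fun t x y => F t x y * F' t x y) (v * v') (a * v' + v * a')
    (b * v' + v * b').
Proof.
move=> [l [G1 [G2 [l1 l2 FG]]]] [l' [G1' [G2' [l1' l2' FG']]]]; split.
  exact: lip_at2_diag (lip_at2M (lip_at2_fst l) (lip_at2_fst l')).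
exists (fun t x y x' y' => G1 t x y x' y' * F' t x y + F t x' y' * G1' t x y x' y').
exists (fun t x y x' y' => G2 t x y x' y' * F' t x y + F t x' y' * G2' t x y x' y').
have lf := lip_at2_fst l'; have ls := lip_at2_snd l.
split; [exact: (lip_at2D (lip_at2M _ _) (lip_at2M _ _))..|] => t x y x' y'.
have -> : F t x y * F' t x y - F t x' y' * F' t x' y'
  = (F t x y - F t x' y') * F' t x y + F t x' y' * (F' t x y - F' t x' y') by ring.
by rewrite FG FG'; ring.
Qed.

(** With the identity as Jacobian, F is dominated by x - 1 and G by y - 1 on a small box, and two
    applications of the one-variable intermediate value theorem suffice. *)
Lemma diff_at_solve_normalized F (G : R -> R -> R -> R) : diff_at F 0 1 0 -> diff_at G 0 0 1 ->
  forall rho : R, 0 < rho -> exists2 eps, 0 < eps &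
    forall t, `|t| <= eps -> exists x y,
      [/\ `|x - 1| <= rho, `|y - 1| <= rho, F t x y = 0 & G t x y = 0].
Proof.
move=> [[K K0 FK] [F1 [F2 [[K1 K10 F1K] [K2 K20 F2K] FE]]]].
move=> [[L L0 GL] [G1 [G2 [[L1 L10 G1L] [L2 L20 G2L] GE]]]] rho rho0.
(* On a box of radius at most 1 / M the four quotients stay within 1/4 of their values at the base
   point. *)
pose M := 4 * (K1 + K2 + L1 + L2 + 1).
have M0 : 0 < M by rewrite /M; lra.
pose r := Num.min (Num.min rho 1) M^-1.
have r0 : 0 < r by rewrite !lt_min rho0 ltr01 invr_gt0.
have r1 : r <= 1 by rewrite !ge_min lexx orbT.
have rrho : r <= rho by rewrite !ge_min lexx.
have rM : r * M <= 1 by rewrite -ler_pdivlMr // div1r !ge_min lexx !orbT.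
have small C : 0 <= C -> 4 * C <= M -> C * r <= 4^-1.
  move=> C0 CM; rewrite -(ler_pM2l (ltr0n R 4)) mulfV ?pnatr_eq0 // mulrA.
  by rewrite (le_trans _ rM) // mulrC ler_pM2l.
have K1r : K1 * r <= 4^-1 by apply: small => //; rewrite /M; lra.
have K2r : K2 * r <= 4^-1 by apply: small => //; rewrite /M; lra.
have L1r : L1 * r <= 4^-1 by apply: small => //; rewrite /M; lra.
have L2r : L2 * r <= 4^-1 by apply: small => //; rewrite /M; lra.
(* For |t| <= eps both functions are at most r / 4 in absolute value at (1, 1). *)
pose eps := Num.min r (r / (4 * (K + L + 1))).
have KL0 : 0 < 4 * (K + L + 1) by lra.
have eps0 : 0 < eps by rewrite lt_min r0 divr_gt0.
have epsr : eps <= r by rewrite ge_min lexx.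
have epsKL : eps * (4 * (K + L + 1)) <= r by rewrite -ler_pdivlMr // ge_min lexx orbT.
exists eps => // t tle.
have base : near_base eps t 1 1 by rewrite /near_base subrr normr0 tle ltW.
have F0 : `|F t 1 1| <= r / 4.
  have := FK _ _ _ _ (le_trans epsr r1) base; rewrite subr0; nra.
have G0 : `|G t 1 1| <= r / 4.
  have := GL _ _ _ _ (le_trans epsr r1) base; rewrite subr0; nra.
pose I (x : R) := 1 - r <= x <= 1 + r.
have In x : I x = (`|x - 1| <= r) by rewrite /I ler_distl.
have box x y : I x -> I y -> near_base r t x y.
  by rewrite !In /near_base => -> ->; rewrite (le_trans tle).
have I1 : I 1 by rewrite In subrr normr0 ltW.
have bF1 x y x' y' : I x -> I y -> I x' -> I y' -> `|F1 t x y x' y' - 1| <= 4^-1.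
  by move=> Ix Iy Ix' Iy'; rewrite (le_trans (F1K r _ _ _ _ _ _ _ _)) ?box.
have bF2 x y x' y' : I x -> I y -> I x' -> I y' -> `|F2 t x y x' y'| <= 4^-1.
  move=> Ix Iy Ix' Iy'; rewrite -[F2 _ _ _ _ _]subr0.
  by rewrite (le_trans (F2K r _ _ _ _ _ _ _ _)) ?box.
have bG1 x y x' y' : I x -> I y -> I x' -> I y' -> `|G1 t x y x' y'| <= 4^-1.
  move=> Ix Iy Ix' Iy'; rewrite -[G1 _ _ _ _ _]subr0.
  by rewrite (le_trans (G1L r _ _ _ _ _ _ _ _)) ?box.
have bG2 x y x' y' : I x -> I y -> I x' -> I y' -> `|G2 t x y x' y' - 1| <= 4^-1.
  by move=> Ix Iy Ix' Iy'; rewrite (le_trans (G2L r _ _ _ _ _ _ _ _)) ?box.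
have Imax : I (1 + r) by rewrite In addrC addKr gtr0_norm.
have Imin : I (1 - r) by rewrite In addrC addKr normrN gtr0_norm.
have le4 (u g : R) : `|u| <= r -> `|g| <= 4^-1 -> `|u * g| <= r / 4.
  by move=> ur g4; rewrite normrM ler_pM.
have ab : 1 - r <= 1 + r by lra.
(* Solve F = 0 for x = phi y first, then G (phi y) y = 0 for y. *)
have solve_x y : I y -> exists2 x, I x & F t x y = 0.
  move=> Iy.
  have Fy x : I x -> F t x y = F t 1 1 + ((x - 1) * F1 t x y 1 1 + (y - 1) * F2 t x y 1 1).
    by move=> Ix; rewrite -FE; ring.
  (* At x = 1 - r and x = 1 + r the main term has size at least 3 r / 4 and the two errors are at
     most r / 4 each, which gives the signs. *)
  have /(lipschitz_ivt (f := fun x => F t x y) ab (ltr0n R 2)) : forall x x', I x -> I x' ->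
      `|F t x y - F t x' y| <= 2 * `|x - x'|.
    move=> x x' Ix Ix'; rewrite FE subrr mul0r addr0 normrM mulrC ler_wpM2r //.
    by have := bF1 _ _ _ _ Ix Iy Ix' Iy; rewrite ler_distl ler_norml; lra.
  apply.
    have h2 : `|(y - 1) * F2 t (1 - r) y 1 1| <= r / 4 by rewrite le4 ?bF2 -?In.
    have h1 := bF1 _ _ _ _ Imin Iy I1 I1.
    rewrite Fy //; move: F0 h1 h2; rewrite !ler_norml; nra.
  have h2 : `|(y - 1) * F2 t (1 + r) y 1 1| <= r / 4 by rewrite le4 ?bF2 -?In.
  have h1 := bF1 _ _ _ _ Imax Iy I1 I1.
  rewrite Fy //; move: F0 h1 h2; rewrite !ler_norml; nra.
have [phi phiP] : {phi : R -> R & forall y, I y -> I (phi y) /\ F t (phi y) y = 0}.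
  apply: (@boolp.choice R R (fun y x => I y -> I x /\ F t x y = 0)) => y.
  by have [/solve_x [x Ix Fx]|nI] := boolP (I y); [exists x|exists 0].
have Iphi y : I y -> I (phi y) by move=> /phiP[].
(* Both points lie on F = 0, so 3/4 of the change of phi is at most 1/4 of the change of y. Hence G
   along phi is again Lipschitz. *)
have phi_lip y y' : I y -> I y' -> `|phi y - phi y'| <= `|y - y'|.
  move=> Iy Iy'; have [Ip Fp] := phiP _ Iy; have [Ip' Fp'] := phiP _ Iy'.
  have := FE t (phi y) y (phi y') y'; rewrite Fp Fp' subrr => /esym/eqP.
  rewrite addr_eq0 => /eqP e.
  have n1 : 3 / 4 * `|phi y - phi y'| <= `|(phi y - phi y') * F1 t (phi y) y (phi y') y'|.
    rewrite normrM mulrC ler_wpM2l // (le_trans _ (ler_norm _)) //.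
    by have := bF1 _ _ _ _ Ip Iy Ip' Iy'; rewrite ler_distl; lra.
  have n2 : `|(y - y') * F2 t (phi y) y (phi y') y'| <= `|y - y'| * 4^-1.
    by rewrite normrM ler_wpM2l // bF2.
  move: n1; rewrite e normrN => n1.
  have := normr_ge0 (phi y - phi y'); have := normr_ge0 (y - y'); lra.
have Gy y : I y -> G t (phi y) y = G t 1 1
    + ((phi y - 1) * G1 t (phi y) y 1 1 + (y - 1) * G2 t (phi y) y 1 1).
  by move=> Iy; rewrite -GE; ring.
have [||| y Iy Gy0] := @lipschitz_ivt _ (fun y => G t (phi y) y) _ _ 2 ab (ltr0n R 2).
- move=> y y' Iy Iy'; rewrite GE (le_trans (ler_normD _ _)) //.
  have n1 : `|(phi y - phi y') * G1 t (phi y) y (phi y') y'| <= `|y - y'| * 4^-1.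
    by rewrite normrM ler_pM ?phi_lip ?bG1 ?Iphi.
  have n2 : `|(y - y') * G2 t (phi y) y (phi y') y'| <= `|y - y'| * (5 / 4).
    rewrite normrM ler_wpM2l //.
    by have := bG2 _ _ _ _ (Iphi _ Iy) Iy (Iphi _ Iy') Iy'; rewrite ler_distl ler_norml; lra.
  by have := normr_ge0 (y - y'); lra.
- have h1 : `|(phi (1 - r) - 1) * G1 t (phi (1 - r)) (1 - r) 1 1| <= r / 4.
    by rewrite le4 ?bG1 -?In ?Iphi.
  have h2 := bG2 _ _ _ _ (Iphi _ Imin) Imin I1 I1.
  rewrite Gy //; move: G0 h1 h2; rewrite !ler_norml; nra.
- have h1 : `|(phi (1 + r) - 1) * G1 t (phi (1 + r)) (1 + r) 1 1| <= r / 4.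
    by rewrite le4 ?bG1 -?In ?Iphi.
  have h2 := bG2 _ _ _ _ (Iphi _ Imax) Imax I1 I1.
  rewrite Gy //; move: G0 h1 h2; rewrite !ler_norml; nra.
have [Ip Fp] := phiP _ Iy.
exists (phi y), y; split=> //.
  by rewrite (le_trans _ rrho) // -In.
by rewrite (le_trans _ rrho) // -In.
Qed.

(** Multiplying (F, G) by the inverse Jacobian matrix reduces to the normalized case. *)
Lemma diff_at_solve F (G : R -> R -> R -> R) a b c d : diff_at F 0 a b -> diff_at G 0 c d ->
  a * d - b * c != 0 ->
  forall rho : R, 0 < rho -> exists2 eps, 0 < eps &
    forall t, `|t| <= eps -> exists x y,
      [/\ `|x - 1| <= rho, `|y - 1| <= rho, F t x y = 0 & G t x y = 0].
Proof.
move=> dF dG D0 rho rho0; set D := _ - _ in D0.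
have dF' := diff_atD (diff_atM (diff_at_cst (d / D)) dF) (diff_atM (diff_at_cst (- b / D)) dG).
have dG' := diff_atD (diff_atM (diff_at_cst (- c / D)) dF) (diff_atM (diff_at_cst (a / D)) dG).
have [||eps eps0 sol] := @diff_at_solve_normalized
  (fun t x y => d / D * F t x y + - b / D * G t x y)
  (fun t x y => - c / D * F t x y + a / D * G t x y) _ _ rho rho0.
- by apply: (diff_at_eq dF') => //; rewrite /D; field.
- by apply: (diff_at_eq dG') => //; rewrite /D; field.
exists eps => // t /sol [x [y [xr yr e1 e2]]]; exists x, y; split=> //.
  have -> : F t x y = a * (d / D * F t x y + - b / D * G t x y)
     + b * (- c / D * F t x y + a / D * G t x y) by rewrite /D; field.
  by rewrite e1 e2 !mulr0 addr0.
have -> : G t x y = c * (d / D * F t x y + - b / D * G t x y)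
   + d * (- c / D * F t x y + a / D * G t x y) by rewrite /D; field.
by rewrite e1 e2 !mulr0 addr0.
Qed.

End Perturbation.

Section JetPerturbation.
Variable R : realType.
Implicit Types F : R -> R -> R -> R.

Lemma lip_atD F1 F2 v1 v2 : lip_at F1 v1 -> lip_at F2 v2 ->
  lip_at (fun t x y => F1 t x y + F2 t x y) (v1 + v2).
Proof. by move=> l1 l2; exact: lip_at2_diag (lip_at2D (lip_at2_fst l1) (lip_at2_fst l2)). Qed.

Lemma lip_atM F1 F2 v1 v2 : lip_at F1 v1 -> lip_at F2 v2 ->
  lip_at (fun t x y => F1 t x y * F2 t x y) (v1 * v2).
Proof. by move=> l1 l2; exact: lip_at2_diag (lip_at2M (lip_at2_fst l1) (lip_at2_fst l2)). Qed.

Lemma lip_at_cst (v : R) : lip_at (fun _ _ _ => v) v.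
Proof. exact: lip_at2_diag (lip_at2_cst v). Qed.

Lemma lip_atN F v : lip_at F v -> lip_at (fun t x y => - F t x y) (- v).
Proof.
by move=> [K K0 FK]; exists K => // d t x y d1 nb; rewrite -opprD normrN FK.
Qed.

Lemma lip_atX F (v : R) n : lip_at F v -> lip_at (fun t x y => F t x y ^+ n) (v ^+ n).
Proof.
move=> l; elim: n => [|n IH]; first exact: lip_at_cst.
have [K K0 FK] := lip_atM l IH; exists K => // d t x y d1 nb.
by rewrite !exprS FK.
Qed.

Lemma lip_at_neq0 F v : lip_at F v -> v != 0 ->
  exists2 d0 : R, 0 < d0 & forall d t x y, d <= d0 -> near_base d t x y -> F t x y != 0.
Proof.
move=> [K K0 FK] v0; have K1 : 0 < K + 1 by rewrite ltr_wpDl.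
have nv : 0 < `|v| by rewrite normr_gt0.
pose d0 := Num.min 1 (`|v| / (K + 1)).
have d00 : 0 < d0 by rewrite lt_min ltr01 divr_gt0.
exists d0 => // d t x y dd nb; apply: contraTneq nb => F0; apply/negP => nb.
have d1 : d <= 1 by rewrite (le_trans dd) // ge_min lexx.
have := FK _ _ _ _ d1 nb; rewrite F0 sub0r normrN leNgt => /negP; apply.
have dK : d * (K + 1) <= `|v| by rewrite -ler_pdivlMr // (le_trans dd) // ge_min lexx orbT.
have d0' := near_base_ge0 nb.
have [dz|dnz] := eqVneq d 0; first by rewrite dz mulr0.
by rewrite (lt_le_trans _ dK) // mulrC ltr_pM2l ?ltrDl // lt_neqAle eq_sym dnz.
Qed.

Variable Phi : R -> R -> R -> nat -> nat -> R.
Let J := Phi 0 1 1.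
(** At the base point the entries differentiate into one another like the derivatives of a single
    function. *)
Hypothesis diffPhi : forall i j,
  diff_at (fun t x y => Phi t x y i j) (J i j) (J i.+1 j) (J i j.+1).

Let lipPhi i j : lip_at (fun t x y => Phi t x y i j) (J i j).
Proof. by case: (diffPhi i j). Qed.

Let diff_cst (c : R) := diff_at_cst c.

Lemma diff_at_jhess_x :
  diff_at (fun t x y => jhess_x (Phi t x y)) (jhess_x J) (jhess_xx J) (jhess_xy J).
Proof.
have D := diff_atD (diff_atD (diff_atM (diffPhi 3 0) (diffPhi 0 2))
  (diff_atM (diffPhi 2 0) (diffPhi 1 2)))
  (diff_atM (diff_cst (-2)) (diff_atM (diffPhi 1 1) (diffPhi 2 1))).
by apply: (diff_at_eq D) => [t x y|||];
  rewrite ?/jhess_x ?/jhess_xx ?/jhess_xy; ring.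
Qed.

Lemma diff_at_jhess_y :
  diff_at (fun t x y => jhess_y (Phi t x y)) (jhess_y J) (jhess_xy J) (jhess_yy J).
Proof.
have D := diff_atD (diff_atD (diff_atM (diffPhi 2 1) (diffPhi 0 2))
  (diff_atM (diffPhi 2 0) (diffPhi 0 3)))
  (diff_atM (diff_cst (-2)) (diff_atM (diffPhi 1 1) (diffPhi 1 2))).
by apply: (diff_at_eq D) => [t x y|||];
  rewrite ?/jhess_y ?/jhess_xy ?/jhess_yy; ring.
Qed.

Lemma diff_at_jE1 :
  diff_at (fun t x y => jE1 (Phi t x y)) (jE1 J) (jE1_x J) (jE1_y J).
Proof.
have D := diff_atD (diff_atM (diff_cst (-1)) (diff_atM (diffPhi 2 0) diff_at_jhess_y))
  (diff_atM (diffPhi 1 1) diff_at_jhess_x).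
by apply: (diff_at_eq D) => [t x y|||]; rewrite ?/jE1 ?/jE1_x ?/jE1_y; ring.
Qed.

Lemma diff_at_jE2 :
  diff_at (fun t x y => jE2 (Phi t x y)) (jE2 J) (jE2_x J) (jE2_y J).
Proof.
have D := diff_atD (diff_atM (diff_cst (-1)) (diff_atM (diffPhi 1 1) diff_at_jhess_y))
  (diff_atM (diffPhi 0 2) diff_at_jhess_x).
by apply: (diff_at_eq D) => [t x y|||]; rewrite ?/jE2 ?/jE2_x ?/jE2_y; ring.
Qed.

Lemma lip_at_jdet : lip_at (fun t x y => jdet (Phi t x y)) (jdet J).
Proof.
have lxx : lip_at (fun t x y => jhess_xx (Phi t x y)) (jhess_xx J).
  by do ![exact: lipPhi | exact: lip_at_cst | apply: lip_atD | apply: lip_atN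
         | apply: lip_atM | apply: lip_atX].
have lxy : lip_at (fun t x y => jhess_xy (Phi t x y)) (jhess_xy J).
  by do ![exact: lipPhi | exact: lip_at_cst | apply: lip_atD | apply: lip_atN
         | apply: lip_atM | apply: lip_atX].
have lyy : lip_at (fun t x y => jhess_yy (Phi t x y)) (jhess_yy J).
  by do ![exact: lipPhi | exact: lip_at_cst | apply: lip_atD | apply: lip_atN
         | apply: lip_atM | apply: lip_atX].
have lx := diff_at_lip diff_at_jhess_x; have ly := diff_at_lip diff_at_jhess_y.
by do ![exact: lipPhi | exact: lx | exact: ly | exact: lxx | exact: lxy | exact: lyy
       | apply: lip_atD | apply: lip_atN | apply: lip_atM].
Qed.

(** The two equations are solved near the base point; the two inequalities persist on a small
    box. *)
Lemma tspp_jet_perturb : tspp_jet J -> forall rho : R, 0 < rho ->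
  exists2 eps : R, 0 < eps & forall t, `|t| <= eps ->
    exists x y, [/\ `|x - 1| <= rho, `|y - 1| <= rho & tspp_jet (Phi t x y)].
Proof.
move=> [e1 e2 gH det0] rho rho0.
have dE1 := diff_at_jE1; have dE2 := diff_at_jE2; rewrite e1 in dE1; rewrite e2 in dE2.
have [d1 d10 det_nz] := lip_at_neq0 lip_at_jdet det0.
have [d2 d20 grad_nz] : exists2 d2 : R, 0 < d2 & forall d t x y, d <= d2 ->
    near_base d t x y -> (jhess_x (Phi t x y) != 0) || (jhess_y (Phi t x y) != 0).
  case/orP: gH => nz.
    have [d2 d20 H] := lip_at_neq0 (diff_at_lip diff_at_jhess_x) nz.
    by exists d2 => // d t x y dd nb; rewrite (H _ _ _ _ dd nb).
  have [d2 d20 H] := lip_at_neq0 (diff_at_lip diff_at_jhess_y) nz.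
  by exists d2 => // d t x y dd nb; rewrite (H _ _ _ _ dd nb) orbT.
pose r := Num.min rho (Num.min d1 d2).
have r0 : 0 < r by rewrite !lt_min rho0 d10 d20.
have [rrho rd1 rd2] : [/\ r <= rho, r <= d1 & r <= d2].
  by rewrite /r !ge_min !lexx !orbT.
have [eps eps0 sol] := diff_at_solve dE1 dE2 det0 r0.
exists (Num.min eps r) => [|t]; first by rewrite lt_min eps0.
rewrite le_min => /andP[teps tr].
have [x [y [xr yr E10 E20]]] := sol t teps.
have nb : near_base r t x y by rewrite /near_base tr xr.
exists x, y; split; [exact: le_trans rrho|exact: le_trans rrho|split=> //].
- exact: grad_nz nb.
- exact: det_nz nb.
Qed.

End JetPerturbation.

(** * The subdivision and the function inducing it *)

Section PiecewiseLinear.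
Variable R : realType.

Definition pt2 (x y : R) : 'rV[R]_2 := \row_(i < 2) (if i == ord0 then x else y).

Lemma pt2E (q : 'rV[R]_2) : q = pt2 (q 0 ord0) (q 0 ord_max).
Proof.
apply/rowP => i; rewrite mxE.
by case: i => [[|[|//]]] Hi /=; congr (q _ _); apply/val_inj.
Qed.

Lemma lattice_pointE v : lattice_point R v = pt2 v.1%:R v.2%:R.
Proof. by apply/rowP => i; rewrite !mxE; case: ifP. Qed.

Lemma pt2D x y x' y' : pt2 x y + pt2 x' y' = pt2 (x + x') (y + y').
Proof. by apply/rowP => i; rewrite !mxE; case: ifP. Qed.

Lemma pt2Z s x y : s *: pt2 x y = pt2 (s * x) (s * y).
Proof. by apply/rowP => i; rewrite !mxE; case: ifP. Qed.

Lemma pt20 x y : pt2 x y 0 ord0 = x. Proof. by rewrite mxE. Qed.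
Lemma pt21 x y : pt2 x y 0 ord_max = y. Proof. by rewrite mxE. Qed.

Lemma hullP (a b c : nat * nat) (q : 'rV[R]_2) : hull [tuple a; b; c] q <->
  exists s0 s1 s2 : R, [/\ [/\ 0 <= s0, 0 <= s1 & 0 <= s2], s0 + s1 + s2 = 1 &
    q = pt2 (s0 * a.1%:R + s1 * b.1%:R + s2 * c.1%:R)
            (s0 * a.2%:R + s1 * b.2%:R + s2 * c.2%:R)].
Proof.
have sumE (s : 'I_3 -> R) : \sum_i s i *: lattice_point R (tnth [tuple a; b; c] i) =
    pt2 (s 0 * a.1%:R + s (lift ord0 ord0) * b.1%:R + s ord_max * c.1%:R)
        (s 0 * a.2%:R + s (lift ord0 ord0) * b.2%:R + s ord_max * c.2%:R).
  rewrite !big_ord_recl big_ord0 addr0 !lattice_pointE !pt2Z !pt2D.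
  rewrite !(tnth_nth (0, 0)%N) /= addrA [in X in pt2 _ X]addrA.
  by have -> : lift ord0 (lift ord0 ord0) = ord_max :> 'I_3 by apply/val_inj.
split=> [[s [s0 s1 ->]]|[s0 [s1 [s2 [[s00 s10 s20] s_1 ->]]]]].
  exists (s 0), (s (lift ord0 ord0)), (s ord_max); split=> //.
  rewrite -s1 !big_ord_recl big_ord0 addr0 addrA; congr (_ + _ + s _).
  exact/val_inj.
exists (fun i => if i == 0 then s0 else if i == ord_max then s2 else s1); split.
- by move=> i; case: ifP => // _; case: ifP.
- by rewrite !big_ord_recl big_ord0 /= addr0 addrA -s_1; ring.
- by rewrite (sumE (fun i : 'I_3 => if i == 0 then s0 else if i == ord_max then s2 else s1)).
Qed.

Lemma DeltaP d (x y : R) : (5 <= d)%N ->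
  Delta d (pt2 x y) <-> [/\ 2 <= x, 2 <= y & x + y <= d%:R].
Proof.
move=> d5; have d2 : (d - 2)%:R = d%:R - 2 :> R by rewrite natrB // (leq_trans _ d5).
have d5' : 5 <= d%:R :> R by rewrite (ler_nat R 5).
rewrite /Delta; split.
  move=> /hullP [s0 [s1 [s2 [[s00 s10 s20] s_1 e]]]].
  have := congr1 (fun q : 'rV[R]_2 => q 0 ord0) e.
  have := congr1 (fun q : 'rV[R]_2 => q 0 ord_max) e.
  rewrite !pt20 !pt21 /= d2 => -> ->.
  have -> : s0 = 1 - s1 - s2 by rewrite -s_1; ring.
  by split; nra.
move=> [x2 y2 xyd]; apply/hullP.
have d4 : d%:R - 4 != 0 :> R by apply/eqP; lra.
have d4p : 0 < d%:R - 4 :> R by lra.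
exists (1 - (x - 2) / (d%:R - 4) - (y - 2) / (d%:R - 4)), ((x - 2) / (d%:R - 4)),
  ((y - 2) / (d%:R - 4)); split.
- split; last 2 first.
  + by rewrite divr_ge0 ?(ltW d4p) ?subr_ge0.
  + by rewrite divr_ge0 ?(ltW d4p) ?subr_ge0.
  have -> : 1 - (x - 2) / (d%:R - 4) - (y - 2) / (d%:R - 4) = (d%:R - (x + y)) / (d%:R - 4).
    by field.
  by rewrite divr_ge0 ?(ltW d4p) ?subr_ge0.
- by ring.
- by rewrite /= d2; congr pt2; field.
Qed.

Lemma convex_pt2 d (lambda : 'rV[R]_2 -> R) (x y x' y' s : R) :
  @convex_function R 'rV[R]_2 (Delta d) lambda ->
  Delta d (pt2 x y) -> Delta d (pt2 x' y') -> 0 <= s <= 1 ->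
  lambda (pt2 (s * x + (1 - s) * x') (s * y + (1 - s) * y'))
    <= s * lambda (pt2 x y) + (1 - s) * lambda (pt2 x' y').
Proof.
move=> cvx D1 D2 /andP[s0 s1].
have := cvx (Itv01 s0 s1) (pt2 x y) (pt2 x' y'); rewrite !inE => /(_ D1 D2).
by rewrite /conv /= !pt2Z pt2D.
Qed.

Definition in_Delta (d : nat) (v : nat * nat) := [&& 2 <= v.1, 2 <= v.2 & v.1 + v.2 <= d]%N.

Lemma in_DeltaP d v : (5 <= d)%N -> in_Delta d v <-> Delta d (lattice_point R v).
Proof.
move=> d5; rewrite lattice_pointE DeltaP // /in_Delta -natrD !ler_nat.
by split=> [/and3P[]|[-> -> ->]].
Qed.

Definition tri_det (a b c : nat * nat) : R :=
  (b.1%:R - a.1%:R) * (c.2%:R - a.2%:R) - (c.1%:R - a.1%:R) * (b.2%:R - a.2%:R).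

Definition aff (p q r : R) (v : 'rV[R]_2) := p * v 0 ord0 + q * v 0 ord_max + r.

(** Unimodularity of all triangles. The determinant is squared because the triangles are listed with
    different orientations. *)
Lemma tauP d T : tau d T -> exists a b c, [/\ T = [tuple a; b; c],
  [/\ in_Delta d a, in_Delta d b & in_Delta d c] & tri_det a b c ^+ 2 = 1].
Proof.
case=> [i /andP[i2 id]|k l k2 /andP[l2 ld]|k l k2 /andP[l2 ld]].
- exists (i, 2)%N, (i + 1, 2)%N, (i, 3)%N; split=> //.
    by rewrite /in_Delta /=; split; lia.
  by rewrite /tri_det /= natrD; ring.
- exists (k + 1, l)%N, (k, l + 1)%N, (k, l + 2)%N; split=> //.
    by rewrite /in_Delta /=; split; lia.
  by rewrite /tri_det /= !natrD; ring.
- exists (k + 1, l)%N, (k, l + 2)%N, (k + 1, l + 1)%N; split=> //.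
    by rewrite /in_Delta /=; split; lia.
  by rewrite /tri_det /= !natrD; ring.
Qed.

Lemma aff_lattice p q r v :
  aff p q r (lattice_point R v) = p * v.1%:R + q * v.2%:R + r.
Proof. by rewrite /aff lattice_pointE pt20 pt21. Qed.

Lemma aff_eq0 a b c p q r : tri_det a b c ^+ 2 = 1 ->
  aff p q r (lattice_point R a) = 0 -> aff p q r (lattice_point R b) = 0 ->
  aff p q r (lattice_point R c) = 0 -> [/\ p = 0, q = 0 & r = 0].
Proof.
move=> D1; rewrite !aff_lattice; set A := _ + r; set B := _ + r; set C := _ + r.
move=> A0 B0 C0.
have D0 : tri_det a b c != 0 by rewrite -sqrf_eq0 D1 oner_eq0.
have p0 : p = 0.
  apply: (mulfI D0); rewrite mulr0.
  transitivity ((B - A) * (c.2%:R - a.2%:R) - (C - A) * (b.2%:R - a.2%:R)).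
    by rewrite /tri_det /A /B /C; ring.
  by rewrite A0 B0 C0; ring.
have q0 : q = 0.
  apply: (mulfI D0); rewrite mulr0.
  transitivity ((C - A) * (b.1%:R - a.1%:R) - (B - A) * (c.1%:R - a.1%:R)).
    by rewrite /tri_det /A /B /C; ring.
  by rewrite A0 B0 C0; ring.
by split=> //; rewrite -A0 /A p0 q0; ring.
Qed.

Lemma hull_vertex (T : triangle) v : v \in T -> hull T (lattice_point R v).
Proof.
move=> /tnthP[i ->]; exists (fun j => (j == i)%:R); split.
- by move=> j; rewrite ler0n.
- by rewrite (bigD1 i) //= eqxx big1 ?addr0 // => j /negPf ->.
- rewrite (bigD1 i) //= eqxx scale1r big1 ?addr0 // => j /negPf ->.
  by rewrite scale0r.
Qed.

Section InducedByLambda.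
Variables (d : nat) (lambda : 'rV[R]_2 -> R).
Hypotheses (d5 : (5 <= d)%N) (hlambda : induces_tau d lambda).

Definition affine_piece (T : triangle) (p q r : int) :=
  forall x, hull T x -> lambda x = aff p%:~R q%:~R r%:~R x.

(** Cramer's rule with determinant 1 or -1: integer values at the vertices give integer slopes and
    constant. Integrality is what makes the slopes usable as exponents of t. *)
Lemma affine_piece_exists T : tau d T -> exists p q r, affine_piece T p q r.
Proof.
move=> tT; have [a [b [c [eT [Da Db Dc] D1]]]] := tauP tT.
have [al [r lE]] := lambda_affine hlambda tT.
have lE' x : hull T x -> lambda x = aff (al ord0) (al ord_max) r x.
  move=> /lE ->; rewrite big_ord_recl big_ord1 /aff.
  by have -> : lift ord0 ord0 = ord_max :> 'I_2 by apply/val_inj.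
have vE v : v \in T -> al ord0 * v.1%:R + al ord_max * v.2%:R + r \is a Num.int.
  by move=> vT; rewrite -aff_lattice -lE' ?(lambda_int hlambda tT) //; exact: hull_vertex.
have [aT bT cT] : [/\ a \in T, b \in T & c \in T].
  by rewrite eT !inE !eqxx !orbT.
set p := al ord0 in lE' vE; set q := al ord_max in lE' vE.
have D1' : tri_det a b c * tri_det a b c = 1 by rewrite -expr2.
have intD v w : (v%:R - w%:R : R) \is a Num.int by rewrite rpredB ?rpred_nat.
have Dint : tri_det a b c \is a Num.int by rewrite rpredB ?rpredM.
have ip : p \is a Num.int.
  have -> : p = tri_det a b c * (
     ((p * b.1%:R + q * b.2%:R + r) - (p * a.1%:R + q * a.2%:R + r)) * (c.2%:R - a.2%:R)
    - ((p * c.1%:R + q * c.2%:R + r) - (p * a.1%:R + q * a.2%:R + r)) * (b.2%:R - a.2%:R)).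
    transitivity (tri_det a b c * (tri_det a b c * p)); first by rewrite mulrA D1' mul1r.
    by congr (_ * _); rewrite /tri_det; ring.
  by rewrite rpredM // rpredB // rpredM // rpredB // vE.
have iq : q \is a Num.int.
  have -> : q = tri_det a b c * (
     ((p * c.1%:R + q * c.2%:R + r) - (p * a.1%:R + q * a.2%:R + r)) * (b.1%:R - a.1%:R)
    - ((p * b.1%:R + q * b.2%:R + r) - (p * a.1%:R + q * a.2%:R + r)) * (c.1%:R - a.1%:R)).
    transitivity (tri_det a b c * (tri_det a b c * q)); first by rewrite mulrA D1' mul1r.
    by congr (_ * _); rewrite /tri_det; ring.
  by rewrite rpredM // rpredB // rpredM // rpredB // vE.
have ir : r \is a Num.int.
  have -> : r = (p * a.1%:R + q * a.2%:R + r) - p * a.1%:R - q * a.2%:R by ring.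
  by rewrite rpredB ?rpredM ?rpred_nat // rpredB ?rpredM ?rpred_nat // vE.
have [[pz pE] [qz qE] [rz rE]] : [/\ exists z, p = z%:~R, exists z, q = z%:~R
    & exists z, r = z%:~R].
  by split; apply/intrP.
by exists pz, qz, rz => x /lE' ->; rewrite pE qE rE.
Qed.

(** On the segment from x to the barycentre of T, a point close enough to the barycentre is still in
    T, where [lambda] equals its affine piece; convexity along the segment gives the bound at x. *)
Lemma affine_piece_le T p q r x : tau d T -> affine_piece T p q r -> Delta d x ->
  aff p%:~R q%:~R r%:~R x <= lambda x.
Proof.
move=> tT TE Dx; have [[a1 a2] [[b1 b2] [[c1 c2] [eT [Da Db Dc] D1]]]] := tauP tT.
rewrite /affine_piece eT in TE.
move: (p%:~R) (q%:~R) (r%:~R) TE => P Q S TE {p q r}.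
set D := tri_det _ _ _ in D1.
have D0 : D != 0 by rewrite -sqrf_eq0 D1 oner_eq0.
rewrite (pt2E x) in Dx *; move: (x 0 ord0) (x 0 ord_max) Dx => {x}x y Dx.
pose w1 := ((x - a1%:R) * (c2%:R - a2%:R) - (c1%:R - a1%:R) * (y - a2%:R)) / D.
pose w2 := ((b1%:R - a1%:R) * (y - a2%:R) - (x - a1%:R) * (b2%:R - a2%:R)) / D.
pose w0 := 1 - w1 - w2.
have xE : x = w0 * a1%:R + w1 * b1%:R + w2 * c1%:R.
  rewrite /w0 /w1 /w2; move: D0; rewrite /D /tri_det /= => D0; field; exact: D0.
have yE : y = w0 * a2%:R + w1 * b2%:R + w2 * c2%:R.
  rewrite /w0 /w1 /w2; move: D0; rewrite /D /tri_det /= => D0; field; exact: D0.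
pose W := `|w0| + `|w1| + `|w2|.
have W0 : 0 <= W by rewrite !addr_ge0.
(* Chosen so that (1 - s) / 3 = s W, which keeps the barycentric coordinates (1 - s) / 3 + s w_i of
   the intermediate point nonnegative. *)
pose s := (1 + 3 * W)^-1.
have s0 : 0 < s by rewrite invr_gt0 ltr_wpDr // mulr_ge0.
have sW : s + 3 * (s * W) = 1.
  by rewrite /s; field; rewrite gt_eqF // ltr_wpDr // mulr_ge0.
have s1 : s <= 1 by rewrite -[leRHS]sW lerDl !mulr_ge0 // ltW.
have coord w : `|w| <= W -> 0 <= (1 - s) / 3 + s * w.
  move=> wW; have : - (s * W) <= s * w.
    by rewrite -mulrN ler_pM2l // lerNl (le_trans _ wW) // -normrN ler_norm.
  lra.
have [c0 c1' c2'] : [/\ 0 <= (1 - s) / 3 + s * w0, 0 <= (1 - s) / 3 + s * w1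
    & 0 <= (1 - s) / 3 + s * w2].
  have := normr_ge0 w0; have := normr_ge0 w1; have := normr_ge0 w2.
  by split; apply: coord; rewrite /W; lra.
have in_a := proj1 (in_DeltaP _ d5) Da; have in_b := proj1 (in_DeltaP _ d5) Db.
have in_c := proj1 (in_DeltaP _ d5) Dc; rewrite !lattice_pointE /= in in_a in_b in_c.
pose gx : R := (a1%:R + b1%:R + c1%:R) / 3; pose gy : R := (a2%:R + b2%:R + c2%:R) / 3.
have Dg : Delta d (pt2 gx gy).
  move: in_a in_b in_c; rewrite !(DeltaP _ _ d5) => -[? ? ?] [? ? ?] [? ? ?].
  by rewrite /gx /gy; split; lra.
have hg : hull [tuple (a1, a2); (b1, b2); (c1, c2)] (pt2 gx gy).
  apply/hullP; exists (1 / 3), (1 / 3), (1 / 3); split; first by rewrite divr_ge0.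
    by field.
  by rewrite /gx /gy /=; congr pt2; field.
have hs : hull [tuple (a1, a2); (b1, b2); (c1, c2)]
    (pt2 (s * x + (1 - s) * gx) (s * y + (1 - s) * gy)).
  apply/hullP; exists ((1 - s) / 3 + s * w0), ((1 - s) / 3 + s * w1), ((1 - s) / 3 + s * w2).
  split=> //; first by rewrite /w0; field.
  by rewrite /= [in LHS]xE [in LHS]yE /gx /gy; congr pt2; field.
have := convex_pt2 (lambda_convex hlambda) Dx Dg (s := s); rewrite (ltW s0) s1 => /(_ isT).
rewrite (TE _ hs) (TE _ hg) /aff !pt20 !pt21 => le.
rewrite -(ler_pM2l s0) -(lerD2r ((1 - s) * (P * gx + Q * gy + S))) (le_trans _ le) //.
by rewrite le_eqVlt; apply/orP; left; apply/eqP; ring.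
Qed.

(* [w] measures the (signed, normalized) distance to the common edge of [T] and
   [T'], and [b] is the vertex of [T'] off that edge. Beyond the edge the affine
   piece of [T'] is that of [T] plus a positive multiple of [- w]. *)
Lemma affine_piece_lt_across T T' p q r b (w1 w2 w0 : int) v :
  tau d T -> tau d T' -> affine_piece T p q r -> b \in T' ->
  (forall u, u \in T -> 0 <= w1 * u.1%:Z + w2 * u.2%:Z + w0) ->
  (forall u, u \in T' -> u = b \/ (u \in T /\ w1 * u.1%:Z + w2 * u.2%:Z + w0 = 0)) ->
  w1 * b.1%:Z + w2 * b.2%:Z + w0 = - 1 ->
  in_Delta d v -> w1 * v.1%:Z + w2 * v.2%:Z + w0 < 0 ->
  aff p%:~R q%:~R r%:~R (lattice_point R v) < lambda (lattice_point R v).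
Proof.
move=> tT tT' TE bT' wT wT' wb Dv wv.
have [p' [q' [r' TE']]] := affine_piece_exists tT'.
have Dl u := proj1 (in_DeltaP u d5).
have [a1 [b1 [c1 [eT' [Da Db Dc] D1]]]] := tauP tT'.
have [aT bT cT] : [/\ a1 \in T', b1 \in T' & c1 \in T'].
  by rewrite eT' !inE !eqxx !orbT.
have DT' u : u \in T' -> in_Delta d u.
  by rewrite eT' !inE => /or3P[] /eqP ->.
have wE u : aff w1%:~R w2%:~R w0%:~R (lattice_point R u)
    = (w1 * u.1%:Z + w2 * u.2%:Z + w0)%:~R.
  by rewrite aff_lattice !rmorphD !rmorphM.
have affB (x1 x2 x3 y1 y2 y3 k z1 z2 z3 : R) x :
    aff (x1 - y1 + k * z1) (x2 - y2 + k * z2) (x3 - y3 + k * z3) x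
     = aff x1 x2 x3 x - aff y1 y2 y3 x + k * aff z1 z2 z3 x by rewrite /aff; ring.
(* The change of slope across the edge: the difference of the two pieces plus [kappa] times [w]
   vanishes at the vertices of T', hence identically. *)
pose kappa := aff p'%:~R q'%:~R r'%:~R (lattice_point R b)
   - aff p%:~R q%:~R r%:~R (lattice_point R b).
have edge u : u \in T' -> aff (p'%:~R - p%:~R + kappa * w1%:~R)
   (q'%:~R - q%:~R + kappa * w2%:~R) (r'%:~R - r%:~R + kappa * w0%:~R) (lattice_point R u) = 0.
  move=> uT'; rewrite affB wE; have [->|[uT ->]] := wT' _ uT'.
    by rewrite wb /kappa; ring.
  by rewrite -TE' -?TE ?subrr ?mulr0 ?addr0 //; exact: hull_vertex.
have [e1 e2 e3] := aff_eq0 D1 (edge _ aT) (edge _ bT) (edge _ cT).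
have glob x : aff p'%:~R q'%:~R r'%:~R x = aff p%:~R q%:~R r%:~R x
    - kappa * aff w1%:~R w2%:~R w0%:~R x.
  have := affB p'%:~R q'%:~R r'%:~R p%:~R q%:~R r%:~R kappa w1%:~R w2%:~R w0%:~R x.
  rewrite e1 e2 e3 {1}/aff !mul0r !addr0 => /esym/eqP.
  by rewrite addrAC subr_eq0 => /eqP <-; rewrite addrK.
have kappa0 : 0 <= kappa.
  rewrite subr_ge0 -TE'; last exact: hull_vertex.
  exact: affine_piece_le tT TE (Dl _ (DT' _ bT')).
(* Otherwise [lambda] would be affine on the union. The two hulls differ, because [w] is negative at
   [b] and nonnegative on T. *)
have kappa1 : kappa != 0.
  apply/eqP => k0; apply: (lambda_break hlambda tT tT').
    move=> eh; have : hull T (lattice_point R b) by rewrite eh; exact: hull_vertex.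
    have [a [b' [c [eT _ _]]]] := tauP tT.
    have := wT; rewrite eT => wabc.
    have wa := wabc a; have wb' := wabc b'; have wc := wabc c.
    move=> /hullP [s0 [s1 [s2 [[s00 s10 s20] s_1 /(congr1 (aff w1%:~R w2%:~R w0%:~R))]]]].
    rewrite wE wb /aff pt20 pt21.
    have {}wa : 0 <= (w1%:~R * a.1%:R + w2%:~R * a.2%:R + w0%:~R : R).
      by rewrite -aff_lattice wE ler0z wa // !inE eqxx.
    have {}wb' : 0 <= (w1%:~R * b'.1%:R + w2%:~R * b'.2%:R + w0%:~R : R).
      by rewrite -aff_lattice wE ler0z wb' // !inE eqxx ?orbT.
    have {}wc : 0 <= (w1%:~R * c.1%:R + w2%:~R * c.2%:R + w0%:~R : R).
      by rewrite -aff_lattice wE ler0z wc // !inE eqxx ?orbT.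
    move=> h; have := mulr_ge0 s00 wa; have := mulr_ge0 s10 wb'; have := mulr_ge0 s20 wc.
    have -> : s2 = 1 - s0 - s1 by rewrite -s_1; ring.
    move: h; have -> : s2 = 1 - s0 - s1 by rewrite -s_1; ring.
    by nra.
  exists (fun i => if i == ord0 then p%:~R else q%:~R), r%:~R => x [hx|hx].
    by rewrite (TE _ hx) /aff big_ord_recl big_ord1 /=; congr (_ + _ * x _ _ + _); apply/val_inj.
  rewrite (TE' _ hx) glob k0 mul0r subr0.
  by rewrite /aff big_ord_recl big_ord1 /=; congr (_ + _ * x _ _ + _); apply/val_inj.
rewrite (lt_le_trans _ (affine_piece_le tT' TE' (Dl _ Dv))) // glob.
rewrite ltrDl oppr_gt0 pmulr_rlt0; last by rewrite lt_neqAle eq_sym kappa1.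
by rewrite wE ltrz0.
Qed.

End InducedByLambda.

End PiecewiseLinear.

Section TauCombinatorics.
Variable R : realType.
Variables (d : nat) (lambda : 'rV[R]_2 -> R).
Hypotheses (d5 : (5 <= d)%N) (hlambda : induces_tau d lambda).

Ltac vertices := rewrite !inE; case/or3P => /eqP -> /=.

Ltac across tT TE Dv T' b w1 w2 w0 :=
  apply: (affine_piece_lt_across d5 hlambda tT (T' := T') _ TE (b := b) (w1 := w1)
            (w2 := w2) (w0 := w0) _ _ _ _ Dv);
  [ constructor; lia
  | by rewrite !inE !xpair_eqE /=; lia
  | by move=> u; vertices; lia
  | by move=> u; vertices;
      first [left; congr (_, _); lia
            | right; split; [rewrite ?inE !xpair_eqE /=; lia | lia] ]
  | by rewrite /=; lia
  | by rewrite /=; lia ].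

(** A unimodular triangle contains no lattice points besides its vertices, so v lies strictly beyond
    some edge. As v is in Delta, that edge is not on the boundary, and the cases name the triangle
    on its other side. *)
Lemma affine_piece_lt T p q r v : tau d T -> affine_piece lambda T p q r ->
  in_Delta d v -> v \notin T ->
  aff p%:~R q%:~R r%:~R (lattice_point R v) < lambda (lattice_point R v).
Proof.
move=> tT; move: (tT); case: tT => [i id|k l k2 ld|k l k2 ld] tT TE Dv; have := Dv;
  rewrite /in_Delta !inE; case: v Dv => x y Dv; rewrite !xpair_eqE /= => Dv' vT.
- have [xi|ix] := ltnP x i.
    across tT TE Dv (Delta3 (i - 1) 2) (i - 1, 4)%N (1 : int) (0 : int) (- i%:Z).
  across tT TE Dv (Delta2 i 2) (i, 4)%N (- 1 : int) (- 1 : int) (i%:Z + 3).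
- have [xk|kx] := ltnP x k.
    across tT TE Dv (Delta3 (k - 1) (l + 1)) (k - 1, l + 3)%N (1 : int) (0 : int) (- k%:Z).
  have [xy|yx] := ltnP (x + y) (k + l + 1)%N.
    have [l3|l2] := ltnP 2 l.
      across tT TE Dv (Delta3 k (l - 1)) (k + 1, l - 1)%N (1 : int) (1 : int) (- (k + l + 1)%:Z).
    across tT TE Dv (Delta1 k) (k, 2)%N (1 : int) (1 : int) (- (k + l + 1)%:Z).
  across tT TE Dv (Delta3 k l) (k + 1, l + 1)%N (- 2 : int) (- 1 : int) (2 * k + l + 2)%:Z.
- have [xk|kx] := ltnP (k + 1)%N x.
    have [l3|l2] := ltnP 2 l.
      across tT TE Dv (Delta2 (k + 1) (l - 1)) (k + 2, l - 1)%N (- 1 : int) (0 : int) (k + 1)%:Z.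
    across tT TE Dv (Delta1 (k + 1)) (k + 2, 2)%N (- 1 : int) (0 : int) (k + 1)%:Z.
  have [xy|yx] := ltnP (k + l + 2)%N (x + y).
    across tT TE Dv (Delta2 k (l + 1)) (k, l + 3)%N (- 1 : int) (- 1 : int) (k + l + 2)%:Z.
  across tT TE Dv (Delta2 k l) (k, l + 1)%N (2 : int) (1 : int) (- (2 * k + l + 2)%:Z).
Qed.

(** Makes [lambda] an integer at every exponent of f, so that truncation in [patchwork] loses
    nothing. *)
Lemma lattice_point_in_tau v : in_Delta d v -> exists2 T, tau d T & v \in T.
Proof.
case: v => x y; rewrite /in_Delta /= => Dv.
have [y2|y2] := leqP y 2; last have [y3|y3] := leqP y 3.
- have [xd|xd] := leqP x (d - 3).
    by exists (Delta1 x); [constructor|rewrite !inE !xpair_eqE /=]; lia.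
  by exists (Delta1 (x - 1)); [constructor|rewrite !inE !xpair_eqE /=]; lia.
- by exists (Delta1 x); [constructor|rewrite !inE !xpair_eqE /=]; lia.
- by exists (Delta2 x (y - 2)); [constructor|rewrite !inE !xpair_eqE /=]; lia.
Qed.

Lemma tau_subset_eq T T' : tau d T -> tau d T' ->
  (forall v, v \in T' -> v \in T) -> T = T'.
Proof.
move=> tT tT' sub.
have [a' [b' [c' [eT' [Da' Db' Dc'] _]]]] := tauP R tT'.
have aT : a' \in T by apply: sub; rewrite eT' !inE eqxx.
have bT : b' \in T by apply: sub; rewrite eT' !inE eqxx orbT.
have cT : c' \in T by apply: sub; rewrite eT' !inE eqxx !orbT.
move: tT tT' aT bT cT eT' => [i id|k l k2 ld|k l k2 ld] [i' id'|k' l' k2' ld'|k' l' k2' ld'];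
  move=> aT bT cT /(congr1 val) /= [ea eb ec]; move: aT bT cT;
  rewrite -ea -eb -ec !inE !xpair_eqE /= => aT bT cT.
all: try (by exfalso; lia).
- by have -> : i = i' by lia.
- by have [-> ->] : k = k' /\ l = l' by lia.
- by have [-> ->] : k = k' /\ l = l' by lia.
Qed.

(** Each piece lies below [lambda], so equal slopes force equal constants. The common piece then
    attains [lambda] at the vertices of T', which strictness allows only at vertices of T. *)
Lemma affine_piece_inj T T' p q r r' : tau d T -> tau d T' ->
  affine_piece lambda T p q r -> affine_piece lambda T' p q r' -> T = T'.
Proof.
move=> tT tT' TE TE'.
have vert T0 v : tau d T0 -> v \in T0 -> in_Delta d v.
  by move=> /(tauP R)[a [b [c [-> [? ? ?] _]]]]; rewrite !inE => /or3P[] /eqP ->.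
have le T1 T2 r1 r2 : tau d T1 -> tau d T2 -> affine_piece lambda T1 p q r1 ->
    affine_piece lambda T2 p q r2 -> r1 <= r2.
  move=> t1 t2 E1 E2; have [a [b [c [eT2 [Da _ _] _]]]] := tauP R t2.
  have aT2 : a \in T2 by rewrite eT2 !inE eqxx.
  have := affine_piece_le d5 hlambda t1 E1 (proj1 (in_DeltaP _ _ d5) Da).
  by rewrite (E2 _ (hull_vertex _ aT2)) /aff lerD2l ler_int.
have rr' : r = r' by apply/le_anti; rewrite (le T T' r r') // (le T' T r' r).
apply: tau_subset_eq => // v vT'.
apply/negPn/negP => nvT.
have := affine_piece_lt tT TE (vert _ _ tT' vT') nvT.
by rewrite (TE' _ (hull_vertex _ vT')) rr' ltxx.
Qed.

End TauCombinatorics.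

(** * Branches of transversal special parabolic points of the patchwork *)

Section ScaledJets.
Variable R : fieldType.

Lemma tspp_jet_scale (J J' : nat -> nat -> R) (a b c : R) :
  a != 0 -> b != 0 -> c != 0 -> (forall i j, J' i j = c * a ^+ i * b ^+ j * J i j) ->
  tspp_jet J' -> tspp_jet J.
Proof.
move=> a0 b0 c0 JJ'.
have hx : jhess_x J' = c ^+ 2 * a ^+ 3 * b ^+ 2 * jhess_x J.
  by rewrite /jhess_x !JJ'; ring.
have hy : jhess_y J' = c ^+ 2 * a ^+ 2 * b ^+ 3 * jhess_y J.
  by rewrite /jhess_y !JJ'; ring.
have hxx : jhess_xx J' = c ^+ 2 * a ^+ 4 * b ^+ 2 * jhess_xx J.
  by rewrite /jhess_xx !JJ'; ring.
have hxy : jhess_xy J' = c ^+ 2 * a ^+ 3 * b ^+ 3 * jhess_xy J.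
  by rewrite /jhess_xy !JJ'; ring.
have hyy : jhess_yy J' = c ^+ 2 * a ^+ 2 * b ^+ 4 * jhess_yy J.
  by rewrite /jhess_yy !JJ'; ring.
have e1 : jE1 J' = c ^+ 3 * a ^+ 4 * b ^+ 3 * jE1 J.
  by rewrite /jE1 hx hy !JJ'; ring.
have e2 : jE2 J' = c ^+ 3 * a ^+ 3 * b ^+ 4 * jE2 J.
  by rewrite /jE2 hx hy !JJ'; ring.
have det : jdet J' = c ^+ 6 * a ^+ 8 * b ^+ 8 * jdet J.
  rewrite /jdet /jE1_x /jE1_y /jE2_x /jE2_y hx hy hxx hxy hyy !JJ'.
  move: (jhess_x J) (jhess_y J) (jhess_xx J) (jhess_xy J) (jhess_yy J) => *.
  by ring.
have nz n1 n2 n3 : c ^+ n1 * a ^+ n2 * b ^+ n3 != 0 by rewrite !mulf_neq0 ?expf_neq0.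
rewrite /tspp_jet hx hy e1 e2 det => -[].
move=> /eqP; rewrite mulf_eq0 (negPf (nz _ _ _)) /= => /eqP ->.
move=> /eqP; rewrite mulf_eq0 (negPf (nz _ _ _)) /= => /eqP ->.
rewrite (mulf_eq0 _ (jhess_x J)) (mulf_eq0 _ (jhess_y J)) (mulf_eq0 _ (jdet J)).
by rewrite !(negPf (nz _ _ _)).
Qed.

End ScaledJets.

Section MonomialJets.
Variable R : realType.
Implicit Types (m : 'X_{1..2}) (s : seq 'X_{1..2}).

Lemma eval2_monomial m (x y : R) :
  eval2 'X_[m] (pt2 x y) = x ^+ m ord0 * y ^+ m ord_max.
Proof.
rewrite /eval2 mevalX big_ord_recl big_ord1 /=.
have -> : lift ord0 ord0 = ord_max :> 'I_2 by apply/val_inj.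
by rewrite pt20 pt21.
Qed.

Lemma jetE (h : {mpoly R[2]}) q i j : jet h q i j = eval2 h^`M(ord_max, j)^`M(ord0, i) q.
Proof. by rewrite /jet !mderivn_iter. Qed.

(** When an exponent would become negative, the falling factorial is 0 and the truncated subtraction
    is harmless. *)
Lemma jet_monomial m (x y : R) i j : jet 'X_[m] (pt2 x y) i j =
  (m ord0 ^_ i * m ord_max ^_ j)%:R * x ^+ (m ord0 - i) * y ^+ (m ord_max - j).
Proof.
rewrite jetE mderivnX mderivmZ mderivnX /eval2 !mevalZ -/(eval2 _ _) eval2_monomial.
rewrite !mnmBE !mulmnE !mnm1E /= !mul1n !mul0n subn0 ?subn0 natrM; ring.
Qed.

Lemma jet_sum s (c : 'X_{1..2} -> R) q i j :
  jet (\sum_(m <- s) c m *: 'X_[m]) q i j = \sum_(m <- s) c m * jet 'X_[m] q i j.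
Proof.
rewrite jetE !raddf_sum /= /eval2 raddf_sum /=; apply: eq_bigr => m _.
by rewrite !mderivmZ mevalZ jetE.
Qed.

(* Jet of the rescaled patchwork; the exponents [nu m] vanish exactly at the vertices
   of the chosen triangle. *)
Definition tropical_jet s (C : 'X_{1..2} -> R) (nu : 'X_{1..2} -> nat) (t x y : R) i j :=
  \sum_(m <- s) C m * t ^+ nu m * (m ord0 ^_ i * m ord_max ^_ j)%:R
    * x ^+ (m ord0 - i) * y ^+ (m ord_max - j).

Lemma diff_at_exp_x n : diff_at (fun _ x _ : R => x ^+ n) 1 n%:R 0.
Proof.
elim: n => [|n IH]; first exact: (diff_at_eq (diff_at_cst 1)).
apply: (diff_at_eq (diff_atM (diff_at_x R) IH)) => [t x y|||]; rewrite ?exprS //.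
- exact: mulr1.
- by rewrite -natr1; ring.
- by ring.
Qed.

Lemma diff_at_exp_y n : diff_at (fun _ _ y : R => y ^+ n) 1 0 n%:R.
Proof.
elim: n => [|n IH]; first exact: (diff_at_eq (diff_at_cst 1)).
apply: (diff_at_eq (diff_atM (diff_at_y R) IH)) => [t x y|||]; rewrite ?exprS //.
- exact: mulr1.
- by ring.
- by rewrite -natr1; ring.
Qed.

Lemma diff_at_exp_t n : diff_at (fun t _ _ : R => t ^+ n) (0 ^+ n) 0 0.
Proof.
elim: n => [|n IH]; first exact: (diff_at_eq (diff_at_cst 1)).
by apply: (diff_at_eq (diff_atM (diff_at_t R) IH)) => [t x y|||];
  rewrite ?exprS //; ring.
Qed.

Lemma diff_at_tropical_jet s C nu i j :
  diff_at (fun t x y => tropical_jet s C nu t x y i j) (tropical_jet s C nu 0 1 1 i j)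
    (tropical_jet s C nu 0 1 1 i.+1 j) (tropical_jet s C nu 0 1 1 i j.+1).
Proof.
rewrite /tropical_jet; elim: s => [|m s IH].
  by apply: (diff_at_eq (diff_at_cst 0)) => [t x y|||]; rewrite big_nil.
have D := diff_atM (diff_atM (diff_atM (diff_atM (diff_at_cst (C m)) (diff_at_exp_t (nu m)))
  (diff_at_cst (m ord0 ^_ i * m ord_max ^_ j)%:R)) (diff_at_exp_x (m ord0 - i)))
  (diff_at_exp_y (m ord_max - j)).
apply: (diff_at_eq (diff_atD D IH)) => [t x y|||]; rewrite big_cons //.
- by rewrite !expr1n.
- by rewrite ffactnSr !expr1n !natrM; congr (_ + _); ring.
- by rewrite ffactnSr !expr1n !natrM; congr (_ + _); ring.
Qed.

End MonomialJets.

Section PatchworkBranch.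
Variable R : realType.
Variables (f : {mpoly R[2]}) (lambda : 'rV[R]_2 -> R).

Let ht m := Num.truncn (lambda (lattice_point R (exponent_pair m))).

(** The slopes may be negative integers, so the substitution is not polynomial in t; only the
    rescaled jet is, with the exponents [nu]. This covers t of either sign. *)
Lemma patchwork_branch (al be ga : int) (nu : 'X_{1..2} -> nat) (x0 y0 : R) :
  x0 != 0 -> y0 != 0 ->
  (forall m, m \in msupp f ->
    (ht m)%:Z = al * (m ord0)%:Z + be * (m ord_max)%:Z + ga + (nu m)%:Z) ->
  tspp_jet (tropical_jet (msupp f) (fun m => f@_m * x0 ^+ m ord0 * y0 ^+ m ord_max)
    nu 0 1 1) ->
  forall rho : R, 0 < rho -> exists2 eps : R, 0 < eps &
    forall t, t != 0 -> `|t| <= eps -> exists x y,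
      [/\ `|x - 1| <= rho, `|y - 1| <= rho
        & tspp_jet (jet (patchwork lambda f t)
            (pt2 (t ^ (- al) * x0 * x) (t ^ (- be) * y0 * y)))].
Proof.
move=> x00 y00 htE tJ rho rho0.
have [eps eps0 sol] := tspp_jet_perturb (diff_at_tropical_jet _ _ nu) tJ rho0.
exists eps => // t t0 /sol [x [y [xr yr tPhi]]]; exists x, y; split=> //.
have a0 : t ^ (- al) * x0 != 0 by rewrite mulf_neq0 // expfz_neq0.
have b0 : t ^ (- be) * y0 != 0 by rewrite mulf_neq0 // expfz_neq0.
have c0 : t ^ (- ga) != 0 by rewrite expfz_neq0.
apply: tspp_jet_scale a0 b0 c0 _ tPhi => i j.
rewrite /patchwork jet_sum mulr_sumr /tropical_jet !big_seq; apply: eq_bigr => m ms.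
rewrite jet_monomial -/(ht m).
have [im|mi] := leqP i (m ord0); last by rewrite ffact_small // mul0n !(mulr0, mul0r).
have [jm|mj] := leqP j (m ord_max); last first.
  by rewrite [m ord_max ^_ j]ffact_small // muln0 !(mulr0, mul0r).
set a := t ^ (- al) * x0; set b := t ^ (- be) * y0.
rewrite (exprMn _ a x) (exprMn _ b y).
have tE : t ^+ nu m = t ^ (- ga) * (t ^ (- al)) ^+ m ord0 * (t ^ (- be)) ^+ m ord_max * t ^+ ht m.
  rewrite !exprnP !exprz_exp -!expfzDr //; congr (_ ^ _).
  rewrite htE //; ring.
have xE : a ^+ m ord0 = a ^+ i * a ^+ (m ord0 - i) by rewrite -exprD subnKC.
have yE : b ^+ m ord_max = b ^+ j * b ^+ (m ord_max - j) by rewrite -exprD subnKC.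
rewrite tE; transitivity (t ^ (- ga) * (f@_m * t ^+ ht m) * (m ord0 ^_ i * m ord_max ^_ j)%:R
   * x ^+ (m ord0 - i) * y ^+ (m ord_max - j) * a ^+ m ord0 * b ^+ m ord_max).
  by rewrite /a /b !exprMn; ring.
rewrite xE yE; move: (a ^+ i) (b ^+ j) (a ^+ (m ord0 - i)) (b ^+ (m ord_max - j)) => a1 b1 a2 b2.
by move: (x ^+ _) (y ^+ _) (t ^+ _) (t ^ _) (f@_m) (_%:R) => *; ring.
Qed.

End PatchworkBranch.

Section Seeds.
Variable R : realType.
Variable f : {mpoly R[2]}.
Implicit Types (v : nat * nat) (q : R * R).

Definition mon v : 'X_{1..2} := [multinom (if i == ord0 then v.1 else v.2) | i < 2].

Lemma mon0 v : mon v ord0 = v.1. Proof. by rewrite mnmE. Qed.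
Lemma mon1 v : mon v ord_max = v.2. Proof. by rewrite mnmE. Qed.

Lemma monK v : exponent_pair (mon v) = v.
Proof. by rewrite /exponent_pair mon0 mon1; case: v. Qed.

Lemma exponent_pairK m : mon (exponent_pair m) = m.
Proof.
apply/mnmP => i; rewrite mnmE /exponent_pair.
by case: i => [[|[|//]]] Hi /=; congr (m _); apply/val_inj.
Qed.

(** The jet at (1, 1) of the part of f carried by T, after x and y are scaled by the coordinates of
    q. *)
Definition coef_jet q (T : seq (nat * nat)) (i j : nat) : R :=
  \sum_(v <- T) f@_(mon v) * q.1 ^+ v.1 * q.2 ^+ v.2 * (v.1 ^_ i * v.2 ^_ j)%:R.

Lemma natr_ffact n i : (n ^_ i)%:R = falling n%:R i :> R.
Proof.
elim: i => [|i IH]; first by rewrite ffactn0 falling0.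
rewrite ffactnSr fallingS -IH natrM.
have [le_in|lt_ni] := leqP i n; first by rewrite natrB.
by rewrite ffact_small // !mul0r.
Qed.

(** The monomials matter only up to a common factor r. The last two conclusions recover the slope s
    from the jet, which distinguishes points belonging to different roots. *)
Lemma coef_jet_tspp (a b c : nat * nat) (a1 a2 b1 b2 c1 c2 s r : R) q :
  a.1%:R = a1 -> a.2%:R = a2 -> b.1%:R = b1 -> b.2%:R = b2 -> c.1%:R = c1 -> c.2%:R = c2 ->
  conic_det a1 a2 b1 b2 c1 c2 != 0 /\ affine_det a1 a2 b1 b2 c1 c2 != 0 ->
  simple_slope a1 a2 b1 b2 c1 c2 s -> r != 0 ->
  f@_(mon a) * q.1 ^+ a.1 * q.2 ^+ a.2 = r * conic_coord b1 b2 c1 c2 s ->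
  f@_(mon b) * q.1 ^+ b.1 * q.2 ^+ b.2 = r * conic_coord c1 c2 a1 a2 s ->
  f@_(mon c) * q.1 ^+ c.1 * q.2 ^+ c.2 = r * conic_coord a1 a2 b1 b2 s ->
  [/\ tspp_jet (coef_jet q [:: a; b; c]), coef_jet q [:: a; b; c] 2 0 != 0
    & coef_jet q [:: a; b; c] 1 1 = - s * coef_jet q [:: a; b; c] 2 0].
Proof.
move=> <- <- <- <- <- <- [D0 V0] [P0 P'0 X10 X20 X30] r0 ea eb ec.
have [tJ J20 J11] := tri_jet_tspp D0 V0 X10 X20 X30 P0 P'0.
set J := tri_jet _ _ _ _ _ _ _ _ _ in tJ J20 J11.
have JE i j : coef_jet q [:: a; b; c] i j = r * J i j.
  rewrite /coef_jet !big_cons big_nil addr0 ea eb ec /J /tri_jet !natrM !natr_ffact.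
  by ring.
split; first last.
- by rewrite !JE J11; ring.
- by rewrite JE mulf_neq0.
- apply: (@tspp_jet_scale _ _ J 1 1 r^-1); rewrite ?oner_eq0 ?invr_eq0 // => i j.
  by rewrite JE !expr1n !mulr1 mulKf.
Qed.

(** Ratios of the monomials are x and y here; for the other two types they are y together with x / y
    or x / y^2. So each system is solved rationally, whatever the signs. *)
Lemma solve_Delta1 (k l : nat) (c1 c2 c3 X1 X2 X3 : R) :
  c1 != 0 -> c2 != 0 -> c3 != 0 -> X1 != 0 -> X2 != 0 -> X3 != 0 ->
  exists q r, [/\ [/\ q.1 != 0, q.2 != 0 & r != 0],
    c1 * q.1 ^+ k * q.2 ^+ l = r * X1, c2 * q.1 ^+ (k + 1) * q.2 ^+ l = r * X2
    & c3 * q.1 ^+ k * q.2 ^+ (l + 1) = r * X3].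
Proof.
move=> c10 c20 c30 X10 X20 X30.
pose x := X2 * c1 / (X1 * c2); pose y := X3 * c1 / (X1 * c3).
have x0 : x != 0 by rewrite !(mulf_neq0, invr_eq0).
have y0 : y != 0 by rewrite !(mulf_neq0, invr_eq0).
exists (x, y), (c1 * x ^+ k * y ^+ l / X1) => /=; split.
- by rewrite x0 y0 !(mulf_neq0, invr_eq0, expf_neq0).
- by field.
- have -> : c2 * x ^+ (k + 1) * y ^+ l = c2 * x * (x ^+ k * y ^+ l) by rewrite addn1 exprS; ring.
  move: (x ^+ k) (y ^+ l) => M N; rewrite /x; field; rewrite ?X10 ?X20 ?X30 ?c10 ?c20 ?c30 //.
- have -> : c3 * x ^+ k * y ^+ (l + 1) = c3 * y * (x ^+ k * y ^+ l) by rewrite addn1 exprS; ring.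
  move: (x ^+ k) (y ^+ l) => M N; rewrite /y; field; rewrite ?X10 ?X20 ?X30 ?c10 ?c20 ?c30 //.
Qed.

Lemma solve_Delta2 (k l : nat) (c1 c2 c3 X1 X2 X3 : R) :
  c1 != 0 -> c2 != 0 -> c3 != 0 -> X1 != 0 -> X2 != 0 -> X3 != 0 ->
  exists q r, [/\ [/\ q.1 != 0, q.2 != 0 & r != 0],
    c1 * q.1 ^+ (k + 1) * q.2 ^+ l = r * X1, c2 * q.1 ^+ k * q.2 ^+ (l + 1) = r * X2
    & c3 * q.1 ^+ k * q.2 ^+ (l + 2) = r * X3].
Proof.
move=> c10 c20 c30 X10 X20 X30.
pose y := X3 * c2 / (X2 * c3); pose x := X1 * c2 * y / (X2 * c1).
have y0 : y != 0 by rewrite !(mulf_neq0, invr_eq0).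
have x0 : x != 0 by rewrite !(mulf_neq0, invr_eq0).
exists (x, y), (c2 * (x ^+ k * y ^+ l) * y / X2) => /=; split.
- by rewrite x0 y0 !(mulf_neq0, invr_eq0, expf_neq0).
- have -> : c1 * x ^+ (k + 1) * y ^+ l = c1 * x * (x ^+ k * y ^+ l) by rewrite addn1 exprS; ring.
  move: (x ^+ k) (y ^+ l) => M N; rewrite /x; field; rewrite ?X10 ?X20 ?X30 ?c10 ?c20 ?c30 //.
- have -> : c2 * x ^+ k * y ^+ (l + 1) = c2 * y * (x ^+ k * y ^+ l) by rewrite addn1 exprS; ring.
  by move: (x ^+ k) (y ^+ l) => M N; field.
- have -> : c3 * x ^+ k * y ^+ (l + 2) = c3 * y * y * (x ^+ k * y ^+ l).
    by rewrite addn2 !exprS; ring.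
  move: (x ^+ k) (y ^+ l) => M N; rewrite {1}/y; field; rewrite ?X10 ?X20 ?X30 ?c10 ?c20 ?c30 //.
Qed.

Lemma solve_Delta3 (k l : nat) (c1 c2 c3 X1 X2 X3 : R) :
  c1 != 0 -> c2 != 0 -> c3 != 0 -> X1 != 0 -> X2 != 0 -> X3 != 0 ->
  exists q r, [/\ [/\ q.1 != 0, q.2 != 0 & r != 0],
    c1 * q.1 ^+ (k + 1) * q.2 ^+ l = r * X1, c2 * q.1 ^+ k * q.2 ^+ (l + 2) = r * X2
    & c3 * q.1 ^+ (k + 1) * q.2 ^+ (l + 1) = r * X3].
Proof.
move=> c10 c20 c30 X10 X20 X30.
pose y := X3 * c1 / (X1 * c3); pose x := X1 * c2 * y ^+ 2 / (X2 * c1).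
have y0 : y != 0 by rewrite !(mulf_neq0, invr_eq0).
have x0 : x != 0 by rewrite !(mulf_neq0, invr_eq0, expf_neq0).
exists (x, y), (c1 * (x ^+ k * y ^+ l) * x / X1) => /=; split.
- by rewrite x0 y0 !(mulf_neq0, invr_eq0, expf_neq0).
- have -> : c1 * x ^+ (k + 1) * y ^+ l = c1 * x * (x ^+ k * y ^+ l) by rewrite addn1 exprS; ring.
  by move: (x ^+ k) (y ^+ l) => M N; field.
- have -> : c2 * x ^+ k * y ^+ (l + 2) = c2 * y ^+ 2 * (x ^+ k * y ^+ l).
    by rewrite addn2 !exprS; ring.
  move: (x ^+ k) (y ^+ l) => M N; rewrite /x; field; rewrite ?X10 ?X20 ?X30 ?c10 ?c20 ?c30 //.
- have -> : c3 * x ^+ (k + 1) * y ^+ (l + 1) = c3 * y * x * (x ^+ k * y ^+ l).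
    by rewrite !addn1 !exprS; ring.
  move: (x ^+ k) (y ^+ l) => M N; rewrite {1}/y; field; rewrite ?X10 ?X20 ?X30 ?c10 ?c20 ?c30 //.
Qed.

Definition seed (T : seq (nat * nat)) q :=
  [/\ q.1 != 0, q.2 != 0 & tspp_jet (coef_jet q T)].

Lemma Delta1_seed (i : nat) : (2 <= i)%N ->
  (forall v, v \in Delta1 i -> f@_(mon v) != 0) -> exists q, seed (Delta1 i) q.
Proof.
move=> i2 fT.
have i2' : 2 <= i%:R :> R by rewrite (ler_nat R 2).
have l2' : 2 <= 2%:R :> R by [].
have ss := Delta1_slope i2' l2'; have [_ _ X1 X2 X3] := ss.
have [f1 f2 f3] : [/\ f@_(mon (i, 2)%N) != 0, f@_(mon (i + 1, 2)%N) != 0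
    & f@_(mon (i, 3)%N) != 0] by split; apply: fT; rewrite !inE eqxx ?orbT.
have [q [r [[q1 q2 r0] e1 e2 e3]]] := solve_Delta1 i 2 f1 f2 f3 X1 X2 X3.
exists q; split=> //.
have [//] := coef_jet_tspp (a := (i, 2)%N) (b := (i + 1, 2)%N) (c := (i, 3)%N)
  erefl erefl (natrD _ i 1) erefl erefl (natrD _ 2 1) (Delta1_dets i2' l2') ss r0 e1 e2 e3.
Qed.

Lemma Delta2_seed (k l : nat) : (2 <= k)%N -> (2 <= l)%N ->
  (forall v, v \in Delta2 k l -> f@_(mon v) != 0) -> exists q, seed (Delta2 k l) q.
Proof.
move=> k2 l2 fT.
have k2' : 2 <= k%:R :> R by rewrite (ler_nat R 2).
have l2' : 2 <= l%:R :> R by rewrite (ler_nat R 2).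
have [s ss] := Delta2_slope k2' l2'; have [_ _ X1 X2 X3] := ss.
have [f1 f2 f3] : [/\ f@_(mon (k + 1, l)%N) != 0, f@_(mon (k, l + 1)%N) != 0
    & f@_(mon (k, l + 2)%N) != 0] by split; apply: fT; rewrite !inE eqxx ?orbT.
have [q [r [[q1 q2 r0] e1 e2 e3]]] := solve_Delta2 k l f1 f2 f3 X1 X2 X3.
exists q; split=> //.
have [//] := coef_jet_tspp (a := (k + 1, l)%N) (b := (k, l + 1)%N) (c := (k, l + 2)%N)
  (natrD _ k 1) erefl erefl (natrD _ l 1) erefl (natrD _ l 2) (Delta2_dets k2' l2')
  ss r0 e1 e2 e3.
Qed.

Lemma Delta3_seeds (k l : nat) : (2 <= k)%N -> (2 <= l)%N ->
  (forall v, v \in Delta3 k l -> f@_(mon v) != 0) ->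
  exists qs : seq (R * R), [/\ uniq qs, size qs = 3
    & forall q, q \in qs -> seed (Delta3 k l) q].
Proof.
move=> k2 l2 fT.
have k2' : 2 <= k%:R :> R by rewrite (ler_nat R 2).
have l2' : 2 <= l%:R :> R by rewrite (ler_nat R 2).
have [s1 [s2 [s3 [s12 s23 ss1 ss2 ss3]]]] := Delta3_slopes k2' l2'.
have sol s : simple_slope (k%:R + 1) l%:R k%:R (l%:R + 2) (k%:R + 1) (l%:R + 1) s ->
    exists q, [/\ seed (Delta3 k l) q, coef_jet q (Delta3 k l) 2 0 != 0
      & coef_jet q (Delta3 k l) 1 1 = - s * coef_jet q (Delta3 k l) 2 0].
  move=> ss; have [_ _ X1 X2 X3] := ss.
  have [f1 f2 f3] : [/\ f@_(mon (k + 1, l)%N) != 0, f@_(mon (k, l + 2)%N) != 0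
    & f@_(mon (k + 1, l + 1)%N) != 0] by split; apply: fT; rewrite !inE eqxx ?orbT.
  have [q [r [[q1 q2 r0] e1 e2 e3]]] := solve_Delta3 k l f1 f2 f3 X1 X2 X3.
  exists q; have [tJ J20 J11] := coef_jet_tspp (a := (k + 1, l)%N) (b := (k, l + 2)%N)
    (c := (k + 1, l + 1)%N) (natrD _ k 1) erefl erefl (natrD _ l 2) (natrD _ k 1)
    (natrD _ l 1) (Delta3_dets k2' l2') ss r0 e1 e2 e3.
  by split.
have [q1 [sq1 n1 e1]] := sol _ ss1; have [q2 [sq2 n2 e2]] := sol _ ss2.
have [q3 [sq3 n3 e3]] := sol _ ss3.
(* The quotient of h_xy by h_xx at the point is -s. *)
have qinj q q' s s' : s < s' -> coef_jet q (Delta3 k l) 2 0 != 0 ->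
    coef_jet q (Delta3 k l) 1 1 = - s * coef_jet q (Delta3 k l) 2 0 ->
    coef_jet q' (Delta3 k l) 1 1 = - s' * coef_jet q' (Delta3 k l) 2 0 -> q != q'.
  move=> ss' nq eq eq'; apply: contraTneq ss' => qq'; move: eq; rewrite qq' eq' -qq'.
  by move=> /(mulIf nq) /oppr_inj ->; rewrite ltxx.
exists [:: q1; q2; q3]; split=> //.
  rewrite /= !inE !negb_or (qinj _ _ _ _ s12 n1 e1 e2) (qinj _ _ _ _ s23 n2 e2 e3).
  by rewrite (qinj _ _ _ _ (lt_trans s12 s23) n1 e1 e3).
by move=> q; rewrite !inE => /or3P[] /eqP ->.
Qed.

End Seeds.

Section Branches.
Variable R : realType.
Variables (d : nat) (f g : {mpoly R[2]}) (lambda : 'rV[R]_2 -> R).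
Hypotheses (d5 : (5 <= d)%N) (hf : f = 'X_ord0 ^+ 2 * 'X_ord_max ^+ 2 * g)
  (hg : complete (d - 4) g) (hlambda : induces_tau d lambda)
  (hsupp : forall m, m \in msupp f -> Delta d (lattice_point R (exponent_pair m))).

Lemma tau_in_Delta T v : tau d T -> v \in T -> in_Delta d v.
Proof.
by move=> /(tauP R)[a [b [c [-> [? ? ?] _]]]]; rewrite !inE => /or3P[] /eqP ->.
Qed.

Lemma coef_neq0 v : in_Delta d v -> f@_(mon v) != 0.
Proof.
case: v => x y /and3P[/= x2 y2 xyd].
have -> : mon (x, y) = (mon (2, 2)%N + mon (x - 2, y - 2)%N)%MM.
  apply/mnmP => i; rewrite mnmDE !mnmE /=; case: ifP => _; lia.
have -> : f = g * 'X_[mon (2, 2)%N].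
  rewrite hf mulrC (mpolyXE_id _ (mon (2, 2)%N)) big_ord_recl big_ord1 mon0.
  have -> : lift ord0 ord0 = ord_max :> 'I_2 by apply/val_inj.
  by rewrite mon1.
rewrite mcoeffMX; apply: (proj2 hg).
rewrite mdegE big_ord_recl big_ord1 mon0.
have -> : lift ord0 ord0 = ord_max :> 'I_2 by apply/val_inj.
rewrite mon1 /=; lia.
Qed.

Lemma sum_msupp_tau T (F : 'X_{1..2} -> R) : tau d T ->
  (forall m, m \in msupp f -> exponent_pair m \notin T -> F m = 0) ->
  \sum_(m <- msupp f) F m = \sum_(v <- T) F (mon v).
Proof.
move=> tT F0.
have uT : uniq T.
  by case: tT => *; rewrite /= !inE !xpair_eqE /=; lia.
rewrite (bigID (fun m => exponent_pair m \in T)) /= [X in _ + X]big_seq_cond.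
rewrite [X in _ + X]big1 ?addr0; last by move=> m /andP[ms mT]; apply: F0.
rewrite -big_filter -(big_map (@mon) xpredT F); apply: perm_big.
apply: uniq_perm; first exact/filter_uniq/msupp_uniq.
  by rewrite map_inj_uniq // => v w vw; rewrite -[v]monK -[w]monK vw.
move=> m; rewrite mem_filter; apply/andP/mapP.
  by move=> [mT ms]; exists (exponent_pair m) => //; rewrite exponent_pairK.
move=> [v vT ->]; rewrite monK; split=> //.
by rewrite mcoeff_msupp // coef_neq0 // (tau_in_Delta tT).
Qed.

(** The exponent [z] is the height of [lambda] above the affine piece of T: nonnegative by
    convexity, 0 on T, positive elsewhere. At t = 0 only the trinomial survives. *)
Lemma tau_branch T (p r c : int) (q : R * R) :
  tau d T -> affine_piece lambda T p r c -> seed f T q ->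
  forall rho : R, 0 < rho -> exists2 eps : R, 0 < eps &
    forall t, t != 0 -> `|t| <= eps -> exists x y,
      [/\ `|x - 1| <= rho, `|y - 1| <= rho
        & tspp_jet (jet (patchwork lambda f t)
            (pt2 (t ^ (- p) * q.1 * x) (t ^ (- r) * q.2 * y)))].
Proof.
move=> tT TE [q1 q2 tJ].
pose ht m := Num.truncn (lambda (lattice_point R (exponent_pair m))).
pose z m : int := (ht m)%:Z - (p * (m ord0)%:Z + r * (m ord_max)%:Z + c).
have affE m : aff p%:~R r%:~R c%:~R (lattice_point R (exponent_pair m))
    = (p * (m ord0)%:Z + r * (m ord_max)%:Z + c)%:~R.
  by rewrite aff_lattice !rmorphD !rmorphM.
have in_D m : m \in msupp f -> in_Delta d (exponent_pair m).
  by move=> ms; apply/(in_DeltaP R _ d5)/hsupp.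
have htE m : m \in msupp f -> lambda (lattice_point R (exponent_pair m)) = (ht m)%:R.
  move=> ms; have [T' tT' mT'] := lattice_point_in_tau d5 (in_D _ ms).
  rewrite /ht truncnK // natrEint (lambda_int hlambda tT' mT') /=.
  exact: (lambda_ge0 hlambda (hsupp ms)).
have zE m : m \in msupp f -> (z m)%:~R = lambda (lattice_point R (exponent_pair m))
    - aff p%:~R r%:~R c%:~R (lattice_point R (exponent_pair m)).
  by move=> ms; rewrite affE (htE _ ms) rmorphB.
have z0 m : m \in msupp f -> 0 <= z m.
  move=> ms; rewrite -(ler_int R) zE // subr_ge0.
  exact: (affine_piece_le d5 hlambda tT TE (hsupp ms)).
apply: (patchwork_branch (nu := fun m => `|z m|%N) (ga := c)) => //.
  by move=> m ms; rewrite gez0_abs ?z0 // /z; ring.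
suff -> : tropical_jet (msupp f)
    (fun m => f@_m * q.1 ^+ m ord0 * q.2 ^+ m ord_max) (fun m => `|z m|%N) 0 1 1
    = coef_jet f q T by [].
apply/funext => i; apply/funext => j; rewrite /tropical_jet /coef_jet.
rewrite (sum_msupp_tau tT).
  apply: eq_big_seq => v vT; rewrite !mon0 !mon1 !expr1n.
  have -> : z (mon v) = 0.
    have vs : mon v \in msupp f.
      by rewrite mcoeff_msupp // coef_neq0 // (tau_in_Delta tT).
    apply/eqP; rewrite -(intr_eq0 R) zE // monK.
    by rewrite (TE _ (hull_vertex _ vT)) subrr.
  by rewrite expr0; ring.
move=> m ms mT; have : 0 < z m.
  rewrite -(ltr_int R) zE // subr_gt0.
  exact: (affine_piece_lt d5 hlambda tT TE (in_D _ ms) mT).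
case: (z m) => [[//|n]|//] _.
by rewrite /= exprS !(mul0r, mulr0).
Qed.

End Branches.

(** * Counting *)

Section Separation.
Variable R : realType.

Lemma scaled_neq_same (a a' : R) : a != a' -> exists2 delta : R, 0 < delta &
  forall x x', `|x - 1| <= delta -> `|x' - 1| <= delta -> a * x != a' * x'.
Proof.
move=> aa'; have na : 0 < `|a - a'| by rewrite normr_gt0 subr_eq0.
have s0 : 0 < 2 * (`|a| + `|a'| + 1) by rewrite mulr_gt0 // ltr_wpDl // addr_ge0.
exists (`|a - a'| / (2 * (`|a| + `|a'| + 1))); first exact: divr_gt0.
move=> x x' xd xd'; apply/eqP => e.
have : `|a - a'| <= (`|a| + `|a'|) * (`|a - a'| / (2 * (`|a| + `|a'| + 1))).
  have -> : a - a' = a' * (x' - 1) - a * (x - 1) by rewrite !mulrBr e; ring.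
  rewrite (le_trans (ler_normB _ _)) // !normrM mulrDl addrC.
  have -> : a' * (x' - 1) - a * (x - 1) = a - a' by rewrite !mulrBr e; ring.
  by rewrite lerD // ler_wpM2l.
rewrite leNgt => /negP; apply.
rewrite mulrA ltr_pdivrMr // mulrC ltr_pM2l //.
by have := normr_ge0 a; have := normr_ge0 a'; lra.
Qed.

(** Equality would give t^(n' - n) a x = a' x', where the left side is at most 2 |a| |t| <= |a'| / 4
    and the right side at least |a'| / 2 in absolute value. *)
Lemma scaled_neq_lt (a a' : R) (n n' : int) : a != 0 -> a' != 0 -> n < n' ->
  exists2 delta : R, 0 < delta & forall t x x', t != 0 -> `|t| <= delta ->
    `|x - 1| <= delta -> `|x' - 1| <= delta -> t ^ (- n) * a * x != t ^ (- n') * a' * x'.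
Proof.
move=> a0 a'0 nn'.
have na : 0 < `|a| by rewrite normr_gt0.
have na' : 0 < `|a'| by rewrite normr_gt0.
exists (Num.min 2^-1 (`|a'| / (8 * `|a|))).
  by rewrite lt_min invr_gt0 ltr0n divr_gt0 // mulr_gt0.
move=> t x x' t0; rewrite !le_min => /andP[t2 ta] /andP[x2 _] /andP[x'2 _].
apply/eqP => e.
have nt : 0 < `|t| by rewrite normr_gt0.
have [k kE] : exists k : nat, n' - n = k.+1%:Z.
  by exists (`|n' - n|%N.-1); lia.
have e' : t ^+ k.+1 * (a * x) = a' * x'.
  have -> : t ^+ k.+1 = t ^ n' * t ^ (- n) by rewrite exprnP -kE expfzDr.
  have -> : a' * x' = t ^ n' * (t ^ (- n') * a' * x').
    by rewrite !mulrA -expfzDr // subrr expr0z mul1r.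
  by rewrite -e; ring.
have := congr1 Num.norm e'; rewrite !normrM => e''.
have tk : `|t ^+ k.+1| <= `|t|.
  by rewrite normrX exprS ler_piMr // exprn_ile1 // (le_trans t2) // invf_le1 ?ltr0n // ler1n.
have xle : `|x| <= 2.
  by rewrite -[x](subrK 1) (le_trans (ler_normD _ _)) // normr1;
  move: (`|x - 1|) x2 => *; lra.
have x'ge : 2^-1 <= `|x'|.
  have : `|1 : R| <= `|x'| + `|x' - 1|.
    by rewrite -[1 in leLHS](subKr x') (le_trans (ler_normB _ _)).
  by rewrite normr1; lra.
have ta' : `|t| * (8 * `|a|) <= `|a'| by rewrite -ler_pdivlMr // mulr_gt0.
have h1 : `|t ^+ k.+1| * (`|a| * `|x|) <= `|t| * (`|a| * 2).
  by rewrite ler_pM // ?mulr_ge0 // ler_wpM2l // ltW.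
have h2 : `|a'| * 2^-1 <= `|a'| * `|x'| by rewrite ler_wpM2l // ltW.
rewrite e'' in h1; have := le_trans h2 h1.
have -> : `|t| * (`|a| * 2) = 4^-1 * (`|t| * (8 * `|a|)) by field.
move: ta' na'; clear; move: (`|t| * _) `|a'| => u v; lra.
Qed.

Lemma scaled_neq (a a' : R) (n n' : int) : a != 0 -> a' != 0 ->
  (n != n') || (a != a') ->
  exists2 delta : R, 0 < delta & forall t x x', t != 0 -> `|t| <= delta ->
    `|x - 1| <= delta -> `|x' - 1| <= delta -> t ^ (- n) * a * x != t ^ (- n') * a' * x'.
Proof.
move=> a0 a'0; have [lt|lt|->] := ltgtP n n'.
- by move=> _; apply: scaled_neq_lt.
- move=> _; have [delta d0 sep] := scaled_neq_lt a'0 a0 lt.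
  by exists delta => // t x x' t0 td xd xd'; rewrite eq_sym sep.
- move=> /= aa'; have [delta d0 sep] := scaled_neq_same aa'.
  exists delta => // t x x' t0 _ xd xd'; rewrite -!mulrA.
  by rewrite (inj_eq (mulfI _)) ?sep // expfz_neq0.
Qed.

Lemma uniform_delta (T : eqType) (s : seq T) (Q : T -> R -> Prop) :
  (forall z, z \in s -> exists2 delta, 0 < delta & forall e, e <= delta -> Q z e) ->
  exists2 delta, 0 < delta & forall z e, z \in s -> e <= delta -> Q z e.
Proof.
elim: s => [|z s IH] H; first by exists 1.
have [|d1 d10 H1] := IH; first by move=> z' z's; apply: H; rewrite inE z's orbT.
have [|d2 d20 H2] := H z; first by rewrite inE eqxx.
exists (Num.min d1 d2) => [|z' e]; first by rewrite lt_min d10.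
rewrite inE le_min => /orP[/eqP ->|z's] /andP[e1 e2]; first exact: H2.
exact: H1.
Qed.

End Separation.

Section Counting.
Local Open Scope nat_scope.

Lemma card_ge_uniq (T : choiceType) (A : set T) (s : seq T) :
  uniq s -> (forall x, x \in s -> A x) -> (`I_(size s) #<= A)%card.
Proof.
case: s => [|x0 s] us sA; first by rewrite II0 card_ge0.
rewrite -(card_le_eql (A := nth x0 (x0 :: s) @` `I_(size (x0 :: s)))).
  by apply: subset_card_le => _ [i Hi <-]; exact/sA/mem_nth.
apply: inj_card_eq => i j; rewrite !inE /= => Hi Hj /eqP.
by rewrite nth_uniq // => /eqP.
Qed.

(** Doubled to avoid division; the offset [a] is free for the induction. *)
Lemma sumn_countdown a n : (sumn [seq n + a - k | k <- iota a n]).*2 = n * n.+1.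
Proof.
elim: n a => [//|n IH] a /=; rewrite doubleD.
have -> : [seq n.+1 + a - k | k <- iota a.+1 n] = [seq n + a.+1 - k | k <- iota a.+1 n].
  by apply: eq_map => k; rewrite addSnnS.
rewrite IH addnK; lia.
Qed.

Variable R : realType.
Variable f : {mpoly R[2]}.

Lemma seeds_of (Ts : seq triangle) (n : nat) : uniq Ts ->
  (forall T, T \in Ts -> exists qs : seq (R * R), [/\ uniq qs, size qs = n
     & forall q, q \in qs -> seed f T q]) ->
  exists L : seq (triangle * (R * R)), [/\ uniq L, size L = size Ts * n
    & forall z, z \in L -> z.1 \in Ts /\ seed f z.1 z.2].
Proof.
elim: Ts => [|T Ts IH] /= => [_ _|/andP[nT uTs] H]; first by exists [::].
have [//|T' T's|L [uL sL HL]] := IH; first by apply: H; rewrite inE T's orbT.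
have [|qs [uq sq Hq]] := H T; first by rewrite inE eqxx.
exists ([seq (T, q) | q <- qs] ++ L); split.
- rewrite cat_uniq uL map_inj_uniq ?uq ?andbT /=; last by move=> q q' [].
  apply/hasPn => z /HL [zT _]; apply/mapP => -[q _ zq].
  by move: zT; rewrite zq (negPf nT).
- by rewrite size_cat size_map sq sL mulSn.
- move=> z; rewrite mem_cat => /orP[/mapP[q qqs ->]|/HL [zT sz]].
    by rewrite inE eqxx; split=> //; apply: Hq.
  by rewrite inE zT orbT.
Qed.

(** k stops at d - 4, the last value for which some l is allowed. *)
Definition upper_triangles (D : nat -> nat -> triangle) (d : nat) :=
  [seq D k l | k <- iota 2 (d - 5), l <- iota 2 (d - k - 3)].

Lemma mem_upper_triangles D d T : T \in upper_triangles D d ->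
  exists k l, [/\ T = D k l, 2 <= k & 2 <= l <= d - k - 2].
Proof.
case/allpairsPdep => k [l [kd ld ->]]; exists k, l.
by move: kd ld; rewrite !mem_iota; split=> //; lia.
Qed.

Lemma size_upper_triangles D d : 5 <= d ->
  (size (upper_triangles D d)).*2 = (d - 5) * (d - 4).
Proof.
move=> d5; rewrite size_allpairs_dep.
have -> : [seq size (iota 2 (d - k - 3)) | k <- iota 2 (d - 5)] =
    [seq (d - 5) + 2 - k | k <- iota 2 (d - 5)].
  by apply: eq_map => k; rewrite size_iota; lia.
by rewrite sumn_countdown; congr (_ * _); lia.
Qed.

Lemma uniq_upper_triangles (D : nat -> nat -> triangle) d :
  (forall k l k' l', D k l = D k' l' -> k = k' /\ l = l') ->
  uniq (upper_triangles D d).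
Proof.
move=> Dinj; apply: allpairs_uniq_dep; rewrite ?iota_uniq //.
  by move=> k _; rewrite iota_uniq.
by move=> [k l] [k' l'] _ _ /= /Dinj [-> ->].
Qed.

End Counting.

Section SeedList.
Variable R : realType.
Variables (d : nat) (f g : {mpoly R[2]}).
Hypotheses (d5 : (5 <= d)%N) (hf : f = 'X_ord0 ^+ 2 * 'X_ord_max ^+ 2 * g)
  (hg : complete (d - 4) g).

Lemma tau_seeds : exists L : seq (triangle * (R * R)),
  [/\ uniq L, size L = ((d - 4) * (2 * d - 9))%N
    & forall z, z \in L -> tau d z.1 /\ seed f z.1 z.2].
Proof.
have cf T v : tau d T -> v \in T -> f@_(mon v) != 0.
  by move=> tT vT; apply: (coef_neq0 d5 hf hg); apply: (tau_in_Delta R tT).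
have D1inj i i' : Delta1 i = Delta1 i' -> i = i' by move=> /(congr1 val) [].
have D2inj k l k' l' : Delta2 k l = Delta2 k' l' -> k = k' /\ l = l'.
  by move=> /(congr1 val) /= [? ? ? _ _ _]; split; lia.
have D3inj k l k' l' : Delta3 k l = Delta3 k' l' -> k = k' /\ l = l'.
  by move=> /(congr1 val) /= [? ? ? _ _ _]; split; lia.
have one T : (exists q, seed f T q) ->
    exists qs : seq (R * R), [/\ uniq qs, size qs = 1%N & forall q, q \in qs -> seed f T q].
  by move=> [q sq]; exists [:: q]; split=> // q'; rewrite inE => /eqP ->.
have mem1 T : T \in [seq Delta1 i | i <- iota 2 (d - 4)] ->
    exists2 i, T = Delta1 i & (2 <= i <= d - 3)%N.
  by move=> /mapP[i]; rewrite mem_iota => id ->; exists i => //; lia.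
have [||L1 [uL1 sL1 HL1]] := @seeds_of R f [seq Delta1 i | i <- iota 2 (d - 4)] 1.
- by rewrite map_inj_uniq ?iota_uniq // => i i' /D1inj.
- move=> T /mem1 [i -> id]; apply/one/Delta1_seed; first by case/andP: id.
  by move=> v; apply: cf; constructor.
have [||L2 [uL2 sL2 HL2]] := @seeds_of R f (upper_triangles Delta2 d) 1.
- exact: uniq_upper_triangles.
- move=> T /mem_upper_triangles [k [l [-> k2 ld]]].
  apply/one/Delta2_seed => //; first by case/andP: ld.
  by move=> v; apply: cf; constructor.
have [||L3 [uL3 sL3 HL3]] := @seeds_of R f (upper_triangles Delta3 d) 3.
- exact: uniq_upper_triangles.
- move=> T /mem_upper_triangles [k [l [-> k2 ld]]].
  apply/Delta3_seeds => //; first by case/andP: ld.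
  by move=> v; apply: cf; constructor.
exists (L1 ++ L2 ++ L3); split.
- rewrite !cat_uniq uL1 uL2 uL3 /= andbT; apply/andP; split.
    apply/hasPn => z; rewrite mem_cat => zL; apply/negP => /HL1 [/mem1 [i zi id] _].
    case/orP: zL => [/HL2|/HL3] [/mem_upper_triangles [k [l [zk k2 ld]]] _];
      move: zk; rewrite zi => /(congr1 val) /= [? ? ? ? _ _]; lia.
  apply/hasPn => z /HL3 [/mem_upper_triangles [k [l [zk k2 ld]]] _].
  apply/negP => /HL2 [/mem_upper_triangles [k' [l' [zk' k2' ld']]] _].
  by move: zk'; rewrite zk => /(congr1 val) /= [? ? ? ? _ _]; lia.
- have := size_upper_triangles Delta2 d5; have := size_upper_triangles Delta3 d5.
  rewrite !size_cat sL1 sL2 sL3 size_map size_iota -!muln2.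
  move: (size _) (size _) => s3 s2.
  (* Writing d = n + 5 removes the truncated subtractions. *)
  have -> : d = ((d - 5) + 5)%N by lia.
  by move: (d - 5)%N => n; rewrite addnK; nia.
- move=> z; rewrite !mem_cat => /or3P[/HL1|/HL2|/HL3] [].
  + by move=> /mem1 [i -> id] sz; split=> //; constructor.
  + by move=> /mem_upper_triangles [k [l [-> k2 ld]]] sz; split=> //; constructor.
  + by move=> /mem_upper_triangles [k [l [-> k2 ld]]] sz; split=> //; constructor.
Qed.

End SeedList.

Theorem theorem9p1 (R : realType) (d : nat) (f g : {mpoly R[2]})
    (lambda : 'rV[R]_2 -> R)
    (hd : (5 <= d <= 10000)%N)
    (hf : f = 'X_ord0 ^+ 2 * 'X_ord_max ^+ 2 * g)
    (hdeg : msize f = d.+1)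
    (hsupp : forall m, m \in msupp f ->
       Delta d (lattice_point R (exponent_pair m)))
    (hg : complete (d - 4) g)
    (hlambda : induces_tau d lambda) :
  exists2 eps : R, 0 < eps &
    forall t : R, 0 < `|t| -> `|t| < eps ->
      (`I_((d - 4) * (2 * d - 9)) #<= TSPP_star (patchwork lambda f t))%card.
Proof.
have /andP[d5 _] := hd.
have [L [uL <- HL]] := tau_seeds d5 hf hg.
have [sl slP] : {sl : triangle -> int * int * int & forall T, tau d T ->
    affine_piece lambda T (sl T).1.1 (sl T).1.2 (sl T).2}.
  apply: (@boolp.choice _ _ (fun T s => tau d T -> affine_piece lambda T s.1.1 s.1.2 s.2)) => T.
  have [tT|nT] := pselect (tau d T); last by exists (0, 0, 0).
  by have [p [r [c TE]]] := affine_piece_exists hlambda tT; exists (p, r, c).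
pose px (z : triangle * (R * R)) (t x : R) := t ^ (- (sl z.1).1.1) * z.2.1 * x.
pose py (z : triangle * (R * R)) (t y : R) := t ^ (- (sl z.1).1.2) * z.2.2 * y.
have nz z : z \in L -> z.2.1 != 0 /\ z.2.2 != 0 by move=> /HL [_ []].
have [delta delta0 sep] : exists2 delta : R, 0 < delta &
    forall z e, z \in L -> e <= delta -> forall z', z' \in L -> z != z' ->
    forall t x y x' y', t != 0 -> `|t| <= e -> `|x - 1| <= e -> `|y - 1| <= e ->
      `|x' - 1| <= e -> `|y' - 1| <= e -> (px z t x != px z' t x') || (py z t y != py z' t y').
  apply: uniform_delta => z zL.
  have [|delta delta0 H] := @uniform_delta R _ L (fun z' e => z != z' ->
      forall t x y x' y', t != 0 -> `|t| <= e -> `|x - 1| <= e -> `|y - 1| <= e ->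
      `|x' - 1| <= e -> `|y' - 1| <= e -> (px z t x != px z' t x') || (py z t y != py z' t y')).
    move=> z' z'L; have [<-|zz'] := eqVneq z z'; first by exists 1.
    have [[z1 z2] [z1' z2']] := (nz _ zL, nz _ z'L).
    (* Distinct seeds differ in a slope of their triangles or in a coordinate of their points;
       either separates the corresponding coordinate of the two branches for small t. *)
    have : ((sl z.1).1.1 != (sl z'.1).1.1) || (z.2.1 != z'.2.1)
        || (((sl z.1).1.2 != (sl z'.1).1.2) || (z.2.2 != z'.2.2)).
      apply: contraNT zz'; rewrite !negb_or !negbK.
      move=> /andP[/andP[/eqP e1 /eqP e2] /andP[/eqP e3 /eqP e4]].
      have [[tz _] [tz' _]] := (HL _ zL, HL _ z'L).
      have E := slP _ tz; have E' := slP _ tz'; rewrite -e1 -e3 in E'.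
      have eT := affine_piece_inj d5 hlambda tz tz' E E'.
      by rewrite -pair_eqE /pair_eq /= eT eqxx -pair_eqE /pair_eq /= e2 e4 !eqxx.
    case/orP => [/(scaled_neq z1 z1')|/(scaled_neq z2 z2')] [delta delta0 H];
      exists delta => // e ed _ t x y x' y' t0 te xe ye xe' ye'.
      by rewrite H //; apply: le_trans ed.
    by rewrite [X in _ || X]H ?orbT //; apply: le_trans ed.
  exists delta => // e ed z' z'L zz'; exact: H.
(* The bound [delta] keeps the branches apart; 1/2 keeps the factors x, y near 1 away from 0, hence
   the points in the torus. *)
pose rho := Num.min delta 2^-1.
have rho0 : 0 < rho by rewrite lt_min delta0 invr_gt0 ltr0n.
have rhod : rho <= delta by rewrite ge_min lexx.
have rho2 : rho <= 2^-1 by rewrite ge_min lexx orbT.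
have [eps eps0 sol] : exists2 eps : R, 0 < eps & forall z e, z \in L -> e <= eps ->
    forall t, t != 0 -> `|t| <= e -> exists x y, [/\ `|x - 1| <= rho, `|y - 1| <= rho
      & tspp_jet (jet (patchwork lambda f t) (pt2 (px z t x) (py z t y)))].
  apply: uniform_delta => z zL; have [tz sz] := HL _ zL.
  have [eps eps0 H] := tau_branch d5 hf hg hlambda hsupp tz (slP _ tz) sz rho0.
  by exists eps => // e ee t t0 te; apply: H => //; apply: le_trans ee.
(* Separation needs |t| <= [rho] as well. *)
exists (Num.min eps rho) => [|t]; first by rewrite lt_min eps0.
rewrite normr_gt0 lt_min => t0 /andP[/ltW teps /ltW trho].
have [F FP] : {F : triangle * (R * R) -> R * R & forall z, z \in L ->
    [/\ `|(F z).1 - 1| <= rho, `|(F z).2 - 1| <= rho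
      & tspp_jet (jet (patchwork lambda f t) (pt2 (px z t (F z).1) (py z t (F z).2)))]}.
  apply: (@boolp.choice _ _ (fun z w => z \in L -> [/\ `|w.1 - 1| <= rho, `|w.2 - 1| <= rho
      & tspp_jet (jet (patchwork lambda f t) (pt2 (px z t w.1) (py z t w.2)))])) => z.
  have [zL|nzL] := boolP (z \in L); last by exists (0, 0).
  by have [x [y H]] := sol z eps zL (lexx _) t t0 teps; exists (x, y).
pose P z := pt2 (px z t (F z).1) (py z t (F z).2).
pose lift3 (q : 'rV[R]_2) : 'rV[R]_3 := row_mx q (eval2 (patchwork lambda f t) q)%:M.
have proj_lift q : proj (lift3 q) = q.
  apply/rowP => i; rewrite mxE /lift3.
  have -> : widen_ord (leqnSn 2) i = lshift 1 i by apply/val_inj.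
  exact: row_mxEl.
have graph_lift q : graph (patchwork lambda f t) (lift3 q).
  rewrite /graph /= proj_lift /lift3.
  have -> : ord_max = rshift 2 ord0 :> 'I_(2 + 1) by apply/val_inj.
  by apply: etrans (row_mxEr _ _ _ _) _; rewrite mxE eqxx.
rewrite -(size_map (lift3 \o P)); apply: card_ge_uniq.
  rewrite map_inj_in_uniq // => z z' zL z'L /(congr1 (@proj R)).
  rewrite /= !proj_lift => ePP.
  apply/eqP/negPn/negP => zz'; have [x1 y1 _] := FP _ zL; have [x2 y2 _] := FP _ z'L.
  have := sep z rho zL rhod z' z'L zz' t _ _ _ _ t0 trho x1 y1 x2 y2.
  have := congr1 (fun q : 'rV[R]_2 => q 0 ord0) ePP.
  have := congr1 (fun q : 'rV[R]_2 => q 0 ord_max) ePP.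
  by rewrite !pt20 !pt21 => -> ->; rewrite !eqxx.
move=> _ /mapP[z zL ->]; have [x1 y1 tJ] := FP _ zL; have [z1 z2] := nz _ zL.
have near1 (x : R) : `|x - 1| <= rho -> x != 0.
  move=> xr; apply: contraTneq (le_trans xr rho2) => ->.
  by rewrite sub0r normrN normr1 -ltNge invf_lt1 ?ltr0n // ltr1n.
split; first by apply: tspp_of_jet; rewrite /= ?proj_lift.
move=> i; rewrite /= proj_lift mxE.
by case: ifP => _; rewrite !mulf_neq0 ?expfz_neq0 // near1.
Qed.
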